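(* Let $M=(\mathcal O,\mathcal A,p,\mathcal R,\mathcal P,L,H)$ be a labeled MDP with probabilistic reward machine $\mathcal R=(\mathcal Q,2^{\mathcal P},\tau,\nu)$, with $O=|\mathcal O|$, $A=|\mathcal A|$, $Q=|\mathcal Q|$. Let $\rho\in(0,1)$, let $K\ge 1$ be the number of episodes, $T=KH$, and $\iota=\ln(6QOAT/\rho)$. If the learner, who knows $\mathcal R$ and $L$ but not $p$, runs the algorithm UCBVI-PRM (defined in the context) with parameter $\rho$ for $K$ episodes, then with probability at least $1-\rho$, $$\mathrm{Regret}(K)\le 72\,\iota\sqrt{OAHT}+2500\,H^2O^2A^{3/2}\iota^2+4H\sqrt{T\iota}.$$
   Context: **Labeled MDP with PRM.** $\mathcal O$ (observations), $\mathcal A$ (actions), $\mathcal Q$ (PRM states) are finite sets; $p(\cdot|o,a)$ is a probability distribution on $\mathcal O$ for each $(o,a)$; $\mathcal P$ is a set of atomic propositions; $L:\mathcal O\times\mathcal A\times\mathcal O\to 2^{\mathcal P}$ is a labeling function; $\tau(\cdot|q,\sigma)$ is a probability distribution on $\mathcal Q$ for each $q\in\mathcal Q$, $\sigma\in 2^{\mathcal P}$; $\nu(q,\sigma,q')$ is a reward distribution on $[0,1]$ (in formulas below $\nu(q,\sigma,q')$ also denotes its mean); $H\ge1$ is the episode length. In an episode, at step $t\in\{1,\dots,H\}$ the agent in observation $o_t$ and PRM state $q_t$ takes action $a_t$; then $o_{t+1}\sim p(\cdot|o_t,a_t)$, $\sigma_t=L(o_t,a_t,o_{t+1})$, $q_{t+1}\sim\tau(\cdot|q_t,\sigma_t)$,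 and a reward drawn from $\nu(q_t,\sigma_t,q_{t+1})$ is received. The agent observes $(q_{t+1},o_{t+1})$. **Cross-product MDP.** $\mathcal S=\mathcal Q\times\mathcal O$. For $s=(q,o)$, $s'=(q',o')$: $P(s'|s,a)=p(o'|o,a)\,\tau(q'|q,L(o,a,o'))$ and $R(s,a)=\sum_{s'}P(s'|s,a)\,\nu(q,L(o,a,o'),q')$. A policy is a map $\pi:\mathcal S\times\{1,\dots,H\}\to\mathcal A$; $V_h^\pi(s)$ is the expected sum of rewards collected at steps $h,\dots,H$ under $\pi$ starting from $s_h=s$; $V_h^*(s)=\sup_\pi V_h^\pi(s)$. **Regret.** In episode $k=1,\dots,K$ the learner starts in $s_{k,1}$ and follows policy $\pi_k$, producing $s_{k,h}=(q_{k,h},o_{k,h})$ and $a_{k,h}$. $\mathrm{Regret}(K)=\sum_{k=1}^K\big(V_1^*(s_{k,1})-V_1^{\pi_k}(s_{k,1})\big)$. **Algorithm UCBVI-PRM.** Initialize $Q_{0,h}(s,a)=H$ for all $s,a,h$. At the start of episode $k$, from the data of episodes $1,\dots,k-1$ compute: $N_k(o,a,o')$, the number of transitions $o\to o'$ under action $a$ (over all steps); $N_k(o,a)=\sum_{o'}N_k(o,a,o')$; $N'_{k,h}(o)$, the number of previous episodes in which observation $o$ was visited at step $h$; and $\widehat p_k(o'|o,a)=N_k(o,a,o')/N_k(o,a)$ whenever $N_k(o,a)>0$. Set $V_{k,H+1}=0$. For $h=H,H-1,\dots,1$, every $s=(q,o)\in\mathcal S$ and $a\in\mathcal A$: - if $N_k(o,a)=0$,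 set $Q_{k,h}(s,a)=H$; - if $N_k(o,a)>0$, let $\widehat P_k(s'|s,a)=\widehat p_k(o'|o,a)\tau(q'|q,L(o,a,o'))$, $\widehat R_k(s,a)=\sum_{s'}\widehat P_k(s'|s,a)\nu(q,L(o,a,o'),q')$, and set $$Q_{k,h}(s,a)=\min\Big\{Q_{k-1,h}(s,a),\;H,\;\widehat R_k(s,a)+\sum_{s'}\widehat P_k(s'|s,a)V_{k,h+1}(s')+b_{k,h}(s,a)\Big\};$$ then set $V_{k,h}(s)=\max_aQ_{k,h}(s,a)$. The bonus is $$b_{k,h}(s,a)=\sqrt{\tfrac{8\iota\,\widehat{\mathbb W}_{k,h+1}}{N_k(o,a)}}+\tfrac{14H\iota}{3N_k(o,a)}+\sqrt{\tfrac{2\iota}{N_k(o,a)}}+\sqrt{\tfrac{8\sum_{o'\in\mathcal O}\widehat p_k(o'|o,a)\min\left(\frac{100^2H^3O^2A\iota^2}{N'_{k,h+1}(o')},\,H^2\right)}{N_k(o,a)}},$$ where $W_{k,h+1}(q,o,a,o')=\sum_{q'\in\mathcal Q}\tau(q'|q,L(o,a,o'))V_{k,h+1}(q',o')$, $\widehat{\mathbb W}_{k,h+1}=\operatorname{Var}_{o'\sim\widehat p_k(\cdot|o,a)}\big(W_{k,h+1}(q,o,a,o')\big)$, and the minimum is read as $H^2$ if $N'_{k,h+1}(o')=0$. In episode $k$ the learner plays $a_{k,h}=\arg\max_aQ_{k,h}(s_{k,h},a)$ for $h=1,\dots,H$ (so $\pi_k(s,h)=\arg\max_aQ_{k,h}(s,a)$,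 ties broken by a fixed rule). *)

(* Defs.v *)
From HB Require Import structures.
From mathcomp Require Import all_boot all_order all_algebra.
From mathcomp Require Import all_classical all_reals all_analysis.

Set Implicit Arguments.
Unset Strict Implicit.
Unset Printing Implicit Defensive.

Import Order.TTheory GRing.Theory Num.Theory.
Import numFieldNormedType.Exports.

Local Open Scope classical_set_scope.
Local Open Scope ring_scope.

(* Episodes k = 1..K and steps h = 1..H are plain
   natural numbers, numbered from 1; values at indices outside these ranges are
   junk and are never used.  A label is a set of atomic propositions, [set AP]. *)

Definition is_pmf (R : realType) (T : finType) (f : T -> R) : Prop :=
  (forall x, 0 <= f x) /\ \sum_x f x = 1.

Record prm (R : realType) (Qst : finType) (AP : Type) := PRM {
  tau : Qst -> set AP -> Qst -> R;
  nu : Qst -> set AP -> Qst -> probability (measurableTypeR R) R;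
  tau_pmf : forall q sigma, is_pmf (tau q sigma);
  nu_unit_interval : forall q sigma q', nu q sigma q' [set` `[(0 : R), 1]] = 1%E
}.

Record labeled_mdp (R : realType) (Obs Act Qst : finType) (AP : Type) :=
  LabeledMDP {
    trans : Obs -> Act -> Obs -> R;
    trans_pmf : forall o a, is_pmf (trans o a);
    machine : prm R Qst AP;
    label : Obs -> Act -> Obs -> set AP;
    horizon : nat;
    horizon_gt0 : (0 < horizon)%N
  }.

Notation state Obs Qst := (Qst * Obs)%type (only parsing).

Section CrossProduct.
Context (R : realType) (Obs Act Qst : finType) (AP : Type).

Local Notation state := (state Obs Qst).

Definition nu_mean (rm : prm R Qst AP) (q : Qst) (sigma : set AP) (q' : Qst) : R :=
  fine ('E_(nu rm q sigma q')[fun r : R => r])%E.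

(* These two take the observation kernel [p] as an argument so that they apply
   both to the true kernel and to the learner's empirical one. *)
Definition cross_trans (rm : prm R Qst AP) (L : Obs -> Act -> Obs -> set AP)
    (p : Obs -> Act -> Obs -> R) (s : state) (a : Act) (s' : state) : R :=
  p s.2 a s'.2 * tau rm s.1 (L s.2 a s'.2) s'.1.

Definition cross_reward (rm : prm R Qst AP) (L : Obs -> Act -> Obs -> set AP)
    (p : Obs -> Act -> Obs -> R) (s : state) (a : Act) : R :=
  \sum_(s' : state) cross_trans rm L p s a s' * nu_mean rm s.1 (L s.2 a s'.2) s'.1.

Definition policy : Type := nat -> state -> Act.

Variable M : labeled_mdp R Obs Act Qst AP.
Let L := label M.
Let rm := machine M.
Let H := horizon M.

Definition mdp_trans : state -> Act -> state -> R :=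
  cross_trans rm L (trans M).

(* Probability that, from state [s] at step [h], the next states are those
   listed in [t]. *)
Fixpoint traj_prob (pi : policy) (h : nat) (s : state) (t : seq state) : R :=
  if t is s' :: t' then
    mdp_trans s (pi h s) s' * traj_prob pi h.+1 s' t'
  else 1.

(* Conditional expectation of the sum of the rewards given the trajectory: the
   reward of a step with transition (q, sigma, q') has law nu(q, sigma, q'). *)
Fixpoint traj_reward (pi : policy) (h : nat) (s : state) (t : seq state) : R :=
  if t is s' :: t' then
    nu_mean rm s.1 (L s.2 (pi h s) s'.2) s'.1 + traj_reward pi h.+1 s' t'
  else 0.

Definition value (pi : policy) (h : nat) (s : state) : R :=
  \sum_(t : (H.+1 - h).-tuple state) traj_prob pi h s t * traj_reward pi h s t.

Definition opt_value (h : nat) (s : state) : R :=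
  sup [set value pi h s | pi in [set: policy]].

Definition regret (K : nat) (init : nat -> state) (pi : nat -> policy) : R :=
  \sum_(1 <= k < K.+1) (opt_value 1 (init k) - value (pi k) 1 (init k)).

End CrossProduct.

Section Algorithm.
(* What the learner knows: the reward machine, the labeling function, the
   horizon, the number of episodes and rho, but not the transition kernel. *)
Context (R : realType) (Obs Act Qst : finType) (AP : Type).
Variables (rm : prm R Qst AP) (L : Obs -> Act -> Obs -> set AP).
Variables (H K : nat) (rho : R).
Local Notation state := (state Obs Qst).

(* The interaction record: st k h = s_{k,h} for 1 <= h <= H + 1 and
   ac k h = a_{k,h} for 1 <= h <= H.  Everything computed for episode k below
   reads only the data of episodes 1, ..., k - 1. *)
Variables (st : nat -> nat -> state) (ac : nat -> nat -> Act).

Let nO : R := #|Obs|%:R.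
Let nA : R := #|Act|%:R.
Let nQ : R := #|Qst|%:R.
Let Hr : R := H%:R.

Definition log_factor : R := ln (6 * nQ * nO * nA * (K * H)%:R / rho).

Definition count3 (k : nat) (o : Obs) (a : Act) (o' : Obs) : nat :=
  (\sum_(1 <= j < k) \sum_(1 <= h < H.+1)
     [&& (st j h).2 == o, ac j h == a & (st j h.+1).2 == o'])%N.

Definition count2 (k : nat) (o : Obs) (a : Act) : nat :=
  (\sum_(o' : Obs) count3 k o a o')%N.

Definition count_visit (k h : nat) (o : Obs) : nat :=
  (\sum_(1 <= j < k) ((st j h).2 == o))%N.

Definition phat (k : nat) (o : Obs) (a : Act) (o' : Obs) : R :=
  (count3 k o a o')%:R / (count2 k o a)%:R.

Definition variance_of (f : Obs -> R) (X : Obs -> R) : R :=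
  \sum_o f o * (X o - \sum_o' f o' * X o') ^+ 2.

Definition W (Vnext : state -> R) (q : Qst) (o : Obs) (a : Act) (o' : Obs) : R :=
  \sum_(q' : Qst) tau rm q (L o a o') q' * Vnext (q', o').

Definition visit_term (k h : nat) (o' : Obs) : R :=
  let n := count_visit k h o' in
  if n == 0%N then Hr ^+ 2
  else Num.min (100 ^+ 2 * Hr ^+ 3 * nO ^+ 2 * nA * log_factor ^+ 2 / n%:R)
               (Hr ^+ 2).

Definition bonus (k h : nat) (Vnext : state -> R) (s : state) (a : Act) : R :=
  let: (q, o) := s in
  let N : R := (count2 k o a)%:R in
  Num.sqrt (8 * log_factor * variance_of (phat k o a) (W Vnext q o a) / N)
  + 14 * Hr * log_factor / (3 * N)
  + Num.sqrt (2 * log_factor / N)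
  + Num.sqrt (8 * (\sum_(o' : Obs) phat k o a o' * visit_term k h.+1 o') / N).

(* Q_{k,h}(s,a) from Qprev = Q_{k-1,h} and Vnext = V_{k,h+1}. *)
Definition Q_update (Qprev : state -> Act -> R) (k h : nat) (Vnext : state -> R)
    (s : state) (a : Act) : R :=
  if count2 k s.2 a == 0%N then Hr
  else Num.min (Qprev s a) (Num.min Hr
    (cross_reward rm L (phat k) s a
     + \sum_(s' : state) cross_trans rm L (phat k) s a s' * Vnext s'
     + bonus k h Vnext s a)).

Definition max_act (f : Act -> R) : R := sup (range f).

(* V_{k,H+1-n}, by recursion on n, given Qprev = Q_{k-1,.}. *)
Fixpoint V_back (Qprev : nat -> state -> Act -> R) (k n : nat) : state -> R :=
  if n is m.+1 then
    fun s => max_act (Q_update (Qprev (H - m)%N) k (H - m) (V_back Qprev k m) s)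
  else fun=> 0.

Fixpoint ucb_Q (k : nat) : nat -> state -> Act -> R :=
  if k is k'.+1 then
    fun h => Q_update (ucb_Q k' h) k h (V_back (ucb_Q k') k (H - h))
  else fun _ _ _ => Hr.

Definition ucb_V (k h : nat) : state -> R := V_back (ucb_Q k.-1) k (H.+1 - h).

Lemma ucb_V_last k : ucb_V k H.+1 = fun=> 0.
Proof. by rewrite /ucb_V subnn. Qed.

Lemma ucb_QE k h : (0 < k)%N ->
  ucb_Q k h = Q_update (ucb_Q k.-1 h) k h (ucb_V k h.+1).
Proof. by case: k => // k _; rewrite /ucb_V subSS. Qed.

Lemma ucb_VE k h s : (0 < k)%N -> (0 < h <= H)%N ->
  ucb_V k h s = max_act (ucb_Q k h s).
Proof.
move=> k0 /andP[h0 hH]; rewrite ucb_QE // /ucb_V subSn // subSS /=.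
by rewrite subKn.
Qed.

(* [argmax] selects a maximizing action, i.e., embodies the tie-breaking rule. *)
Definition ucb_policy (argmax : (Act -> R) -> Act) (k : nat) : policy Obs Act Qst :=
  fun h s => argmax (ucb_Q k h s).

End Algorithm.

Section Interaction.
Context (R : realType) (Obs Act Qst : finType) (AP : Type).
Variable M : labeled_mdp R Obs Act Qst AP.
Context (d : measure_display) (Omega : measurableType d).
Variables (Pr : probability Omega R) (K : nat).
Local Notation state := (state Obs Qst).
Variables (st : nat -> nat -> Omega -> state) (ac : nat -> nat -> Omega -> Act).
Let H := horizon M.

(* The states and actions up to and including step [h] of episode [k] are those
   prescribed by [x] and [y]. *)
Definition history (k h : nat) (x : nat -> nat -> state) (y : nat -> nat -> Act)
    : set Omega :=
  [set w | [/\ forall j i, (0 < j < k)%N -> (0 < i <= H.+1)%N -> st j i w = x j i,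
               forall j i, (0 < j < k)%N -> (0 < i <= H)%N -> ac j i w = y j i,
               forall i, (0 < i <= h)%N -> st k i w = x k i &
               forall i, (0 < i <= h)%N -> ac k i w = y k i]].

(* Given any history, the next state has law P( . | s_{k,h}, a_{k,h}).  The
   initial states s_{k,1} are unconstrained: they may be random and may depend
   on all the previous episodes. *)
Definition mdp_interaction : Prop :=
  (forall k h s, (0 < k <= K)%N -> (0 < h <= H.+1)%N ->
     measurable [set w | st k h w = s]) /\
  (forall k h x y s', (0 < k <= K)%N -> (0 < h <= H)%N ->
     Pr (history k h x y `&` [set w | st k h.+1 w = s']) =
     ((mdp_trans M (x k h) (y k h) s')%:E * Pr (history k h x y))%E).

Variables (rho : R) (argmax : (Act -> R) -> Act).

(* pi_k, as a random policy. *)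
Definition ucbvi_policy (w : Omega) (k : nat) : policy Obs Act Qst :=
  ucb_policy (machine M) (label M) H K rho
    (fun j i => st j i w) (fun j i => ac j i w) argmax k.

Definition plays_ucbvi : Prop :=
  forall k h w, (0 < k <= K)%N -> (0 < h <= H)%N ->
    ac k h w = ucbvi_policy w k h (st k h w).

End Interaction.

(* Main.v *)
Require Import Defs.
From mathcomp Require Import all_boot all_order all_algebra.
From mathcomp Require Import all_classical all_reals all_analysis.
From mathcomp Require Import measurable_realfun ring lra zify.
Import Order.TTheory GRing.Theory Num.Theory.
Import numFieldNormedType.Exports.
Local Open Scope classical_set_scope.
Local Open Scope ring_scope.

Set Implicit Arguments.
Unset Strict Implicit.
Unset Printing Implicit Defensive.

(* For a predictable family [F] of functions of the next state, let [noise] be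
   the value of [F] at that state minus its conditional expectation.  When [F]
   oscillates by at most [1 / 3], [exp (sum noise - 2 / 3 * sum noise ^+ 2)] is a
   supermartingale, because [expR (u - 2 / 3 * u ^+ 2) <= 1 + u] for
   [u >= - 1 / 3].  All concentration comes from this: scaled indicators of a
   visit to [(o, a)] times a function of the next observation give an empirical
   Bernstein inequality and [phat <= (1 + O(1 / H)) p + O(H iota / n)].

   Optimism holds because, under [phat], the standard deviation of the optimal
   return exceeds that of the optimistic value by at most [1 / 2] plus the square
   root of [H] times the mean of the gap between them, and the latter is absorbed
   by that mean via AM-GM, so that the last term of the bonus is not even needed.
   The regret then satisfies a recursion with factor [1 + O(1 / H)], whose bonuses sum up to
   [sqrt (O A iota * (sum of variances))]; telescoping [V_h ^+ 2] along an episode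
   bounds the variances by [H (T + sum of bonuses)], which closes the inequality.
   When [T] is too small for this, the trivial bound [T] on the regret suffices. *)

(** * Exponential and variance inequalities *)

(** The bonus contains the empirical variance of [V_k], a function that depends on the data, so no
    fixed martingale concerns it. Only the deterministic function [opt_return] is concentrated; the
    gap between it and the optimistic value is transferred from [phat] to [p] by a pointwise
    multiplicative bound, which serves all functions at once at the price of a factor [O].
    Normalising by realised squares instead of conditional variances makes the empirical variance
    appear in the exponent itself, with no conversion from the true one.

    Ville's inequality bounds each exponent at the start of every episode simultaneously, so the
    random counts need no union bound. But the scale of the exponential bound must be fixed before
    the count is known: the union runs over [K] dyadic scales instead, and these, times the [H]
    steps, give the factor [T] inside [iota].

    Initial states may depend on the past in any way, so the only probabilistic input is the
    conditional law of the next state within an episode. *)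

Section Exponential.
Variable R : realType.
Implicit Types u x y : R.

(** The value needed at the endpoint [u = - 1 / 3] below, where [2 / 3 * u ^+ 2 - u = 11 / 27]. It
    comes from [1 + x <= expR x] at [x = 11 / 1728], raised to the power 64 in two rounds to keep
    the rationals small. *)
Lemma three_halves_le_expR : 3 / 2 <= expR (11 / 27 : R).
Proof.
have pow8 c c' x : 0 <= c -> c <= expR x -> c' <= c ^+ 8 -> c' <= expR (x * 8).
  move=> c0 cx c'c; apply: le_trans c'c _.
  by rewrite expRM_natr lerXn2r // nnegrE (le_trans c0).
have h : 263 / 250 <= expR (11 / 1728 * 8 : R).
  by apply: pow8 (expR_ge1Dx _) _; lra.
have : 3 / 2 <= expR (11 / 1728 * 8 * 8 : R) by apply: pow8 h _; lra.
by rewrite (_ : 11 / 1728 * 8 * 8 = 11 / 27) //; lra.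
Qed.

Let f u := (1 + u) * expR (2 / 3 * u ^+ 2 - u).

Let df u : is_derive u 1 f (expR (2 / 3 * u ^+ 2 - u) * (u * (4 / 3 * u + 1 / 3))).
Proof.
apply: is_derive_eq.
rewrite -![_%:A]/(_ * 1) -![_ *: _]/(_ * _) !mulr1; set e := expR _; by field.
Qed.

Let f1E u : derive1 f u = expR (2 / 3 * u ^+ 2 - u) * (u * (4 / 3 * u + 1 / 3)).
Proof. by rewrite derive1E; have [_ ->] := df u. Qed.

Let f_derivable u : derivable f u 1. Proof. by have [] := df u. Qed.

Let f_continuous : continuous f.
Proof.
move=> u; apply: differentiable_continuous; apply/derivable1_diffP.
exact: f_derivable.
Qed.

(** Equivalent to [1 <= f u]. The derivative of [f] has the sign of [u * (4 * u + 1)], so on the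
    half-line from [- 1 / 3] the minimum is reached at [0], where [f] is 1, or at [- 1 / 3], where
    [f] is [2 / 3 * expR (11 / 27)]. This last value barely exceeds 1: the constants [2 / 3] and
    [1 / 3] are matched. *)
Lemma expR_sub_sqr_le u : - (1 / 3) <= u -> expR (u - 2 / 3 * u ^+ 2) <= 1 + u.
Proof.
move=> u3; suff : 1 <= f u.
  rewrite /f => fu; rewrite -(opprK (u - _)) expRN opprB -div1r ler_pdivrMr ?expR_gt0 //.
have f0 : f 0 = 1 by rewrite /f expr0n /= mulr0 subr0 expR0 addr0 mulr1.
have incr a b : a <= b -> (forall x, a < x < b -> 0 <= derive1 f x) -> f a <= f b.
  move=> ab h; apply: (@ger0_derive1_le_cc _ f a b) => //.
  - exact: continuous_subspaceT.
  - by rewrite in_itv /= lexx ab.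
  - by rewrite in_itv /= lexx ab.
have decr a b : a <= b -> (forall x, a < x < b -> derive1 f x <= 0) -> f b <= f a.
  move=> ab h; apply: (@ler0_derive1_le_cc _ f a b) => //.
  - exact: continuous_subspaceT.
  - by rewrite in_itv /= lexx ab.
  - by rewrite in_itv /= lexx ab.
have [u0|u0] := leP 0 u.
  rewrite -f0; apply: incr => // x /andP[x0 _]; rewrite f1E mulr_ge0 ?expR_ge0 //; nra.
have [u4|u4] := leP (- (1 / 4)) u.
  rewrite -f0; apply: decr; first exact: ltW.
  move=> x /andP[x0 x1]; rewrite f1E mulr_ge0_le0 ?expR_ge0 //; nra.
apply: (@le_trans _ _ (f (- (1 / 3)))).
  rewrite /f (_ : 2 / 3 * _ - _ = 11 / 27); last by lra.
  have := three_halves_le_expR; lra.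
apply: incr => // x /andP[x0 x1]; rewrite f1E mulr_ge0 ?expR_ge0 //; nra.
Qed.

Lemma ln_ge_1_sub_inv x : 0 < x -> 1 - x^-1 <= ln x.
Proof.
move=> x0; have := @le_ln1Dx R (x^-1 - 1).
rewrite ltrBrDl subrr invr_gt0 => /(_ x0).
rewrite addrC subrK lnV ?posrE //; lra.
Qed.

End Exponential.

(* Freedman-type one-step bound, normalised by the empirical square
   [xi s ^+ 2] instead of the variance. *)
Lemma pmf_expR_le1 (R : realType) (S : finType) (p g : S -> R) :
  is_pmf p -> (forall s s', `|g s - g s'| <= 1 / 3) ->
  \sum_s p s * expR (let xi := g s - \sum_s' p s' * g s' in xi - 2 / 3 * xi ^+ 2) <= 1.
Proof.
move=> [p0 p1] hg /=; pose xi s := g s - \sum_s' p s' * g s'.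
have xi3 s : - (1 / 3) <= xi s.
  have : \sum_s' p s' * g s' <= \sum_s' p s' * (g s + 1 / 3).
    apply: ler_sum => s' _; rewrite ler_wpM2l //.
    by have := hg s s'; rewrite ler_norml; lra.
  by rewrite -mulr_suml p1 /xi; lra.
apply: (@le_trans _ _ (\sum_s p s * (1 + xi s))).
  apply: ler_sum => s _; apply: ler_wpM2l => //.
  exact: (expR_sub_sqr_le (xi3 s)).
under eq_bigr do rewrite mulrDr mulr1 /xi mulrBr.
by rewrite big_split /= sumrB -mulr_suml !p1 mul1r subrr addr0.
Qed.

Section SumInequalities.
Variable R : realType.

Lemma sum_sqr_le0 (I : Type) (r : seq I) (P : pred I) (b : I -> R) :
  \sum_(i <- r | P i) b i ^+ 2 <= 0 ->
  forall F : I -> R, \sum_(i <- r | P i) F i * b i = 0.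
Proof.
move=> + F; elim: r => [|i r IH]; first by rewrite !big_nil.
rewrite !big_cons; case: (P i); last exact: IH.
move=> h; have s0 : 0 <= \sum_(j <- r | P j) b j ^+ 2.
  by apply: sumr_ge0 => j _; exact: sqr_ge0.
have b0 := sqr_ge0 (b i).
have bi : b i ^+ 2 = 0 by apply: le_anti; rewrite b0 andbT; lra.
by rewrite IH; [rewrite (eqP (_ : b i == 0)) ?mulr0 ?addr0 // -sqrf_eq0 bi|lra].
Qed.

Lemma cauchy_schwarz_sum (I : Type) (r : seq I) (P : pred I) (a b : I -> R) :
  (\sum_(i <- r | P i) a i * b i) ^+ 2 <=
  (\sum_(i <- r | P i) a i ^+ 2) * (\sum_(i <- r | P i) b i ^+ 2).
Proof.
set A := \sum_(i <- r | P i) a i ^+ 2; set B := \sum_(i <- r | P i) b i ^+ 2.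
set C := \sum_(i <- r | P i) a i * b i.
have B0 : 0 <= B by apply: sumr_ge0 => i _; exact: sqr_ge0.
have [B0'|Bpos] := leP B 0.
  rewrite /C sum_sqr_le0 ?expr0n ?mulr_ge0 //.
    by apply: sumr_ge0 => i _; exact: sqr_ge0.
have : 0 <= \sum_(i <- r | P i) (B * a i - C * b i) ^+ 2.
  by apply: sumr_ge0 => i _; exact: sqr_ge0.
have -> : \sum_(i <- r | P i) (B * a i - C * b i) ^+ 2 =
    B ^+ 2 * A - 2 * B * C * C + C ^+ 2 * B.
  rewrite (eq_bigr (fun i => B ^+ 2 * a i ^+ 2 - 2 * B * C * (a i * b i)
      + C ^+ 2 * b i ^+ 2)); last by move=> i _; ring.
  by rewrite big_split sumrB /= -!mulr_sumr.
have -> : B ^+ 2 * A - 2 * B * C * C + C ^+ 2 * B = B * (A * B - C ^+ 2) by ring.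
by rewrite pmulr_rge0 // subr_ge0.
Qed.

Lemma sum_sqrtM_le (I : Type) (r : seq I) (P : pred I) (x y : I -> R) :
  (forall i, P i -> 0 <= x i) -> (forall i, P i -> 0 <= y i) ->
  \sum_(i <- r | P i) Num.sqrt (x i) * Num.sqrt (y i) <=
  Num.sqrt ((\sum_(i <- r | P i) x i) * \sum_(i <- r | P i) y i).
Proof.
move=> x0 y0; set S := leLHS.
have S0 : 0 <= S by apply: sumr_ge0 => i _; rewrite mulr_ge0 ?sqrtr_ge0.
rewrite -(ger0_norm S0) -sqrtr_sqr ler_wsqrtr //; apply: le_trans (cauchy_schwarz_sum _ _ _ _) _.
rewrite (eq_bigr x) => [|i Pi]; last by rewrite sqr_sqrtr ?x0.
by rewrite [X in _ * X](eq_bigr y) // => i Pi; rewrite sqr_sqrtr ?y0.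
Qed.

End SumInequalities.

Section Averages.
Variables (R : realType) (I : finType).
Implicit Types (f X Y : I -> R) (c : R).

Definition avg f X : R := \sum_o f o * X o.

Lemma avgD f X Y : avg f (fun o => X o + Y o) = avg f X + avg f Y.
Proof. by rewrite /avg -big_split; apply: eq_bigr => o _; rewrite /= mulrDr. Qed.

Lemma avgB f X Y : avg f (fun o => X o - Y o) = avg f X - avg f Y.
Proof. by rewrite /avg -sumrB; apply: eq_bigr => o _; rewrite /= mulrBr. Qed.

Lemma avgZ f c X : avg f (fun o => c * X o) = c * avg f X.
Proof. by rewrite /avg mulr_sumr; apply: eq_bigr => o _; rewrite mulrCA. Qed.

Lemma eq_avg f X Y : X =1 Y -> avg f X = avg f Y.
Proof. by move=> XY; apply: eq_bigr => o _; rewrite XY. Qed.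

Variable f : I -> R.
Hypothesis fpmf : is_pmf f.
Let f0 o : 0 <= f o. Proof. by case: fpmf. Qed.
Let f1 : \sum_o f o = 1. Proof. by case: fpmf. Qed.

Lemma avg_cst c : avg f (fun=> c) = c.
Proof. by rewrite /avg -mulr_suml f1 mul1r. Qed.

Lemma le_avg X Y : (forall o, X o <= Y o) -> avg f X <= avg f Y.
Proof. by move=> XY; apply: ler_sum => o _; rewrite ler_wpM2l. Qed.

Lemma avg_ge0 X : (forall o, 0 <= X o) -> 0 <= avg f X.
Proof. by move=> X0; rewrite -(avg_cst 0) le_avg. Qed.

Lemma avg_le X c : (forall o, X o <= c) -> avg f X <= c.
Proof. by move=> Xc; rewrite -[leRHS](avg_cst c) le_avg. Qed.

Lemma variance_of_ge0 X : 0 <= variance_of f X.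
Proof. by apply: avg_ge0 => o; exact: sqr_ge0. Qed.

(** With [f] empirical and [c] the true mean, this splits the squared noise at the visits into the
    empirical variance and the squared deviation of the means. *)
Lemma variance_sqr_dev X c :
  avg f (fun o => (X o - c) ^+ 2) = variance_of f X + (avg f X - c) ^+ 2.
Proof.
rewrite -[variance_of f X]/(avg f (fun o => (X o - avg f X) ^+ 2)).
set m := avg f X.
rewrite (@eq_avg _ _ (fun o => (X o - m) ^+ 2 + ((m - c) ^+ 2 + 2 * (m - c) * (X o - m)))); last first.
  by move=> o /=; ring.
by rewrite avgD avgD avg_cst avgZ avgB avg_cst -/m subrr mulr0 addr0.
Qed.

Lemma variance_le_dev X c : variance_of f X <= avg f (fun o => (X o - c) ^+ 2).
Proof. by rewrite variance_sqr_dev lerDl sqr_ge0. Qed.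

Lemma variance_le_sqr X : variance_of f X <= avg f (fun o => X o ^+ 2).
Proof.
apply: le_trans (variance_le_dev X 0) _.
by rewrite (@eq_avg _ _ (fun o => X o ^+ 2)) // => o; rewrite subr0.
Qed.

Lemma variance_ofE X : variance_of f X = avg f (fun o => X o ^+ 2) - avg f X ^+ 2.
Proof.
have := variance_sqr_dev X 0.
rewrite (@eq_avg _ _ (fun o => X o ^+ 2)); last by move=> o; rewrite subr0.
by rewrite subr0 => ->; rewrite addrK.
Qed.

Lemma variance_le_mean X c : (forall o, 0 <= X o <= c) ->
  variance_of f X <= c * avg f X.
Proof.
move=> Xc; apply: le_trans (variance_le_sqr X) _; rewrite -avgZ; apply: le_avg => o.
by have /andP[? ?] := Xc o; rewrite expr2 ler_wpM2r.
Qed.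

Lemma variance_le_quarter X : (forall o, 0 <= X o <= 1) -> variance_of f X <= 1 / 4.
Proof.
move=> X1; apply: le_trans (variance_le_dev X (1 / 2)) _; apply: avg_le => o.
have /andP[? ?] := X1 o; nra.
Qed.

(** The standard deviation is the weighted L2 norm of the centred function; Cauchy-Schwarz, with the
    weight shared as [sqrt f * sqrt f], bounds the covariance. *)
Lemma std_triangle X Y :
  Num.sqrt (variance_of f (fun o => X o + Y o)) <=
  Num.sqrt (variance_of f X) + Num.sqrt (variance_of f Y).
Proof.
set x := fun o => X o - avg f X; set y := fun o => Y o - avg f Y.
have VX : variance_of f X = avg f (fun o => x o ^+ 2) by [].
have VY : variance_of f Y = avg f (fun o => y o ^+ 2) by [].
have VXY : variance_of f (fun o => X o + Y o) =
    variance_of f X + 2 * avg f (fun o => x o * y o) + variance_of f Y.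
  rewrite VX VY -avgZ -!avgD.
  rewrite -[LHS]/(avg f (fun o => (X o + Y o - avg f (fun o => X o + Y o)) ^+ 2)).
  by apply: eq_avg => o; rewrite avgD /x /y; ring.
have CS : avg f (fun o => x o * y o) <=
    Num.sqrt (variance_of f X) * Num.sqrt (variance_of f Y).
  have := cauchy_schwarz_sum (index_enum I) xpredT (fun o => Num.sqrt (f o) * x o)
    (fun o => Num.sqrt (f o) * y o).
  rewrite (eq_bigr (fun o => f o * (x o * y o))); last first.
    by move=> o _; rewrite mulrACA -expr2 sqr_sqrtr.
  rewrite [X in X * _](eq_bigr (fun o => f o * x o ^+ 2)); last first.
    by move=> o _; rewrite exprMn sqr_sqrtr.
  rewrite [X in _ * X](eq_bigr (fun o => f o * y o ^+ 2)); last first.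
    by move=> o _; rewrite exprMn sqr_sqrtr.
  rewrite -[X in X ^+ 2]/(avg f (fun o => x o * y o)) => h.
  rewrite -sqrtrM ?variance_of_ge0 //; apply: le_trans (ler_norm _) _.
  by rewrite -sqrtr_sqr; exact: ler_wsqrtr h.
rewrite -[leRHS]ger0_norm ?addr_ge0 ?sqrtr_ge0 // -sqrtr_sqr ler_wsqrtr // VXY.
by rewrite sqrrD !sqr_sqrtr ?variance_of_ge0 //; lra.
Qed.

End Averages.

(** * Scalar inequalities behind the Bernstein bound *)

Section BernsteinArithmetic.
Variable R : realType.
Implicit Types (H u v D sW sX y : R).

Let c : R := Num.sqrt (2 / 3).
Let c2 : c ^+ 2 = 2 / 3. Proof. by rewrite sqr_sqrtr //; lra. Qed.
Let c0 : 0 <= c. Proof. exact: sqrtr_ge0. Qed.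
Let c_le : c <= 49 / 60.
Proof. by rewrite -(@ler_pXn2r _ 2) ?nnegrE // c2; lra. Qed.

(* The free parameter of the exponential bound is optimised over the geometric
   grid [1 / 3 * 2 ^ - j]; the first alternative is the case of an interior
   optimum, the second one that of an optimum above the grid. *)
Lemma bernstein_grid H u v D (K : nat) : (0 < K)%N -> 0 < H -> 0 < u -> 0 <= v <= H ^+ 2 ->
  D <= H -> 1 / 3 * (2 ^- K) <= u ->
  (forall j, (j < K)%N -> let l := 1 / 3 * 2 ^- j in
     D <= H * u ^+ 2 / l + 2 / 3 * l / H * (v + D ^+ 2)) ->
  D <= 21 / 8 * u * Num.sqrt v \/
  D <= 21 / 20 * u * Num.sqrt v + 27 / 7 * H * u ^+ 2.
Proof.
move=> K0 H0 u0 /andP[v0 vH] DH uK hj.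
set s := Num.sqrt v.
have s0 : 0 <= s by exact: sqrtr_ge0.
have s2 : s ^+ 2 = v by rewrite sqr_sqrtr.
have sH : s <= H by rewrite -(ger0_norm (ltW H0)) -sqrtr_sqr ler_wsqrtr.
have [D0|D0] := leP D 0; first by left; apply: le_trans D0 _; rewrite !mulr_ge0 //; lra.
pose a := c * s.
have a0 : 0 <= a by rewrite mulr_ge0.
have a2 : a ^+ 2 = 2 / 3 * v by rewrite exprMn c2 s2.
have aH : a < H.
  have : a <= 49 / 60 * s by rewrite ler_wpM2r.
  lra.
pose l j : R := 1 / 3 * 2 ^- j.
have l0 j : 0 < l j by rewrite mulr_gt0 ?invr_gt0 ?exprn_gt0 //; lra.
have l3 j : l j <= 1 / 3.
  rewrite /l ler_piMr ?invf_le1 ?exprn_gt0 ?exprn_ege1 //; lra.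
(* Since [D <= H] and [l <= 1 / 3], the term in [D ^+ 2] is at most [2 / 9 * D] and moves to the
   left-hand side. *)
have hD j : (j < K)%N -> 7 / 9 * D <= H * u ^+ 2 / l j + l j * a ^+ 2 / H.
  move=> jK; have := hj j jK; rewrite -/(l j) /= a2 => h.
  have : 2 / 3 * l j / H * D ^+ 2 <= 2 / 9 * D.
    rewrite expr2 mulrA ler_wpM2r ?(ltW D0) //.
    rewrite mulrAC ler_pdivrMr //; have := l3 j; have := l0 j; nra.
  by move: h; rewrite mulrDr (_ : 2 / 3 * l j / H * v = l j * (2 / 3 * v) / H);
    [lra | ring].
(* The right-hand side of [hD] is minimal at [l = H * u / a]. If this is at least [1 / 3], the first
   grid point is used: [27 / 7 = 9 / 7 * 3] and [21 / 20 = 9 / 7 * (49 / 60)]. *)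
have [a3|a3] := leP (1 / 3 * a) (H * u).
  right; have := hD 0%N K0; rewrite /l expr0 invr1 mulr1.
  have -> : H * u ^+ 2 / (1 / 3) = 3 * H * u ^+ 2 by field.
  have : 1 / 3 * a ^+ 2 / H <= c * (u * s).
    rewrite ler_pdivrMr // (_ : c * _ * _ = H * u * a); last by rewrite /a; ring.
    by rewrite expr2 mulrA ler_wpM2r.
  have : c * (u * s) <= 49 / 60 * (u * s) by rewrite ler_wpM2r // mulr_ge0 // ltW.
  lra.
left.
(* The grid point just before the first one below the optimum overshoots it by a factor in [[1, 2]],
   so that the sum of the two terms is at most [5 / 2] times their geometric mean;
   [21 / 8 = 9 / 7 * (5 / 2) * (49 / 60)]. *)
have ex : exists j, l j * a < H * u.
  exists K; apply: le_lt_trans (_ : u * a < _); first by rewrite ler_wpM2r.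
  by rewrite mulrC ltr_pM2r.
case: (ex_minnP ex) => -[|j] hj1 jmin.
  by move: (hj1); rewrite /l expr0 invr1 mulr1; lra.
have jlow : H * u <= l j * a by rewrite leNgt; apply/negP => /jmin; rewrite ltnn.
have jK : (j < K)%N.
  apply: jmin; apply: le_lt_trans (_ : u * a < _); first by rewrite ler_wpM2r.
  by rewrite mulrC ltr_pM2r.
have jup : l j * a <= 2 * (H * u).
  move: hj1; rewrite /l exprS invfM.
  set z := 2 ^- j; lra.
have key : H * u ^+ 2 / l j + l j * a ^+ 2 / H <= 5 / 2 * (a * u).
  have -> : H * u ^+ 2 / l j + l j * a ^+ 2 / H =
      ((H * u) ^+ 2 + (l j * a) ^+ 2) / (l j * H).
    by field; rewrite !gt_eqF.
  rewrite ler_pdivrMr ?mulr_gt0 //.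
  have -> : 5 / 2 * (a * u) * (l j * H) = 5 / 2 * ((l j * a) * (H * u)) by ring.
  have : 0 < H * u by rewrite mulr_gt0.
  move: jlow jup; set P := l j * a; set Q := H * u; nra.
have := hD j jK; have : a * u <= 49 / 60 * (u * s).
  by rewrite /a mulrAC -mulrA (ler_wpM2r _ c_le) // mulr_ge0 // ltW.
lra.
Qed.

(** The coefficients are those that the bonus can pay: [21 / 8 <= sqrt 8], [21 / 16 <= sqrt 2], and
    [14 / 3] exactly. Here [y] is the empirical mean of the gap; optimism has all of it to spare, so
    AM-GM may spend the whole [y] on the cross term. *)
Lemma optimism_arith H u sW sX y D : 0 < H -> 0 < u -> 0 <= sW -> 0 <= y ->
  sX <= sW + 1 / 2 + Num.sqrt (H * y) ->
  D <= 21 / 8 * u * sX \/ D <= 21 / 20 * u * sX + 27 / 7 * H * u ^+ 2 ->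
  D <= 21 / 8 * (u * sW) + 21 / 16 * u + 14 / 3 * (H * u ^+ 2) + y.
Proof.
move=> H0 u0 sW0 y0; set z := Num.sqrt _ => sX_le.
have z0 : 0 <= z by exact: sqrtr_ge0.
have z2 : z ^+ 2 = H * y by rewrite sqr_sqrtr // mulr_ge0 // ltW.
have usX : u * sX <= u * sW + u * (1 / 2) + u * z.
  by rewrite -!mulrDr ler_wpM2l // ltW.
have usW : 0 <= u * sW by rewrite mulr_ge0 // ltW.
have amgm b : u * z * b <= y + b ^+ 2 / 4 * (H * u ^+ 2).
  rewrite -(ler_pM2l H0) [H * (y + _)]mulrDr -z2.
  have := sqr_ge0 (z - b * H * u / 2); nra.
have := amgm (21 / 8); have := amgm (21 / 20).
have Hu : 0 <= H * u ^+ 2 by rewrite mulr_ge0 ?sqr_ge0 // ltW.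
move=> h1 h2 [h|h]; lra.
Qed.

(** In the regret recursion only a fraction [O(1 / H)] of the gap may be spent, lest the factors
    compound beyond a constant over [H] steps. AM-GM at that rate costs
    [7 * (21 / 16) ^+ 2 <= 121 / 10] times [H ^+ 2 * u ^+ 2]. *)
Lemma regret_arith H u sW sX y D : 0 < H -> 0 < u -> 0 <= sW -> 0 <= y ->
  sX <= sW + 1 / 2 + Num.sqrt (H * y) ->
  D <= 21 / 8 * u * sX \/ D <= 21 / 20 * u * sX + 27 / 7 * H * u ^+ 2 ->
  D <= 21 / 8 * (u * sW) + 21 / 16 * u + 27 / 7 * (H * u ^+ 2) + y / (7 * H)
       + 121 / 10 * (H ^+ 2 * u ^+ 2).
Proof.
move=> H0 u0 sW0 y0; set z := Num.sqrt _ => sX_le.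
have z0 : 0 <= z by exact: sqrtr_ge0.
have z2 : z ^+ 2 = H * y by rewrite sqr_sqrtr // mulr_ge0 // ltW.
have usX : u * sX <= u * sW + u * (1 / 2) + u * z.
  by rewrite -!mulrDr ler_wpM2l // ltW.
have usW : 0 <= u * sW by rewrite mulr_ge0 // ltW.
have amgm : 21 / 8 * (u * z) <= y / (7 * H) + 121 / 10 * (H ^+ 2 * u ^+ 2).
  have H2 : 0 < H ^+ 2 by rewrite exprn_gt0.
  rewrite -(ler_pM2l H2) mulrDr (_ : H ^+ 2 * (y / (7 * H)) = z ^+ 2 / 7).
    have : 0 <= (z / 7 - 21 / 16 * (H ^+ 2 * u)) ^+ 2 by exact: sqr_ge0.
    nra.
  by rewrite z2; field; rewrite gt_eqF.
have Hu : 0 <= H * u ^+ 2 by rewrite mulr_ge0 ?sqr_ge0 // ltW.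
have y7 : 0 <= y / (7 * H) by rewrite divr_ge0 // mulr_ge0 // ltW.
have uz : 0 <= u * z by rewrite mulr_ge0 // ltW.
move=> [h|h]; lra.
Qed.

End BernsteinArithmetic.

(** * Mean rewards and values in the cross-product MDP *)

Lemma expectation_unit_interval (R : realType) (P : probability (measurableTypeR R) R) :
  P [set` `[(0 : R), 1]] = 1%E ->
  0 <= fine ('E_P[fun r : R => r])%E <= 1.
Proof.
move=> P1; set D := [set` `[(0 : R), 1]] in P1 *.
have mD : measurable D by exact: measurable_itv.
(* Truncation to [[0, 1]] agrees with the identity almost everywhere and is bounded on the whole
   line, so the integral can be compared with constants. *)
pose g : R -> R := fun r => Num.max 0 (Num.min 1 r).
have g01 r : 0 <= g r <= 1.
  by rewrite /g le_max lexx /= ge_max ler01 /= ge_min lexx.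
have mg : measurable_fun setT g.
  apply: measurable_maxr => //; exact: measurable_minr.
have Pc : P (~` D) = 0%E by rewrite probability_setC // P1 subee.
have -> : ('E_P[fun r : R => r] = \int[P]_x (g x)%:E)%E.
  rewrite unlock; apply: ae_eq_integral => //.
  - exact/measurable_EFinP.
  exists (~` D); split => //; first exact: measurableC.
  move=> r /= h Dr; apply: h => _; move: Dr; rewrite /D /= in_itv /= => /andP[r0 r1].
  by rewrite /g (min_idPr r1) (max_idPr r0).
have i0 : (0 <= \int[P]_x (g x)%:E)%E.
  by apply: integral_ge0 => x _; rewrite lee_fin; case/andP: (g01 x).
have i1 : (\int[P]_x (g x)%:E <= 1)%E.
  apply: le_trans (_ : _ <= \int[P]_x (cst 1%E x))%E _.
    apply: ge0_le_integral => //.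
    - by move=> x _; rewrite lee_fin; case/andP: (g01 x).
    - exact/measurable_EFinP.
    - by move=> x _; rewrite lee_fin; case/andP: (g01 x).
  by rewrite integral_cst // mul1e; exact: probability_le1.
rewrite fine_ge0 //= -(@lee_fin R) fineK //.
by rewrite ge0_fin_numE // (le_lt_trans i1) // ltry.
Qed.

Lemma big_tupleS (R : nmodType) (T : finType) n (F : seq T -> R) :
  \sum_(t : n.+1.-tuple T) F t = \sum_(x : T) \sum_(t : n.-tuple T) F (x :: t).
Proof.
rewrite pair_big /= (reindex (fun p : T * n.-tuple T => [tuple of p.1 :: p.2])) //=.
exists (fun t : n.+1.-tuple T => (thead t, [tuple of behead t])) => /=.
  by move=> [x t] _ /=; congr pair; apply: val_inj.
by move=> t _; rewrite -tuple_eta.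
Qed.

Section Values.
Variables (R : realType) (Obs Act Qst : finType) (AP : Type).
Variable M : labeled_mdp R Obs Act Qst AP.
Local Notation state := (Qst * Obs)%type.
Local Notation L := (label M).
Local Notation rm := (machine M).
Local Notation H := (horizon M).
Implicit Types (s : state) (a : Act) (q : Qst) (o : Obs) (V : state -> R).

Lemma nu_mean_itv q sigma q' : 0 <= nu_mean rm q sigma q' <= 1.
Proof. exact: expectation_unit_interval (nu_unit_interval _ _ _ _). Qed.

(** The reward machine is known, so its transition is integrated out into [W]. What remains is an
    average over observations, and only the observation kernel has to be estimated; this is why [Q]
    enters the final bound through [iota] only. *)
Lemma cross_transE (p : Obs -> Act -> Obs -> R) s a V :
  \sum_(s' : state) cross_trans rm L p s a s' * V s' =
  avg (p s.2 a) (W rm L V s.1 s.2 a).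
Proof.
rewrite (eq_bigr (fun s' : state => cross_trans rm L p s a (s'.1, s'.2) * V (s'.1, s'.2)));
  last by case.
rewrite -(pair_bigA _ (fun q' o' => cross_trans rm L p s a (q', o') * V (q', o'))) /=.
rewrite exchange_big; apply: eq_bigr => o' _.
by rewrite mulr_sumr; apply: eq_bigr => q' _; rewrite /cross_trans /= mulrA.
Qed.

(** The mean reward given the next observation, written as an instance of [W] so that the lemmas on
    [W] apply; inside [W], [s'.2] is [o']. *)
Definition rbar q o a (o' : Obs) : R :=
  W rm L (fun s' => nu_mean rm q (L o a s'.2) s'.1) q o a o'.

Lemma cross_rewardE (p : Obs -> Act -> Obs -> R) s a :
  cross_reward rm L p s a = avg (p s.2 a) (rbar s.1 s.2 a).
Proof. exact: cross_transE. Qed.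

Lemma WE V q o a o' : W rm L V q o a o' = avg (tau rm q (L o a o')) (fun q' => V (q', o')).
Proof. by []. Qed.

Lemma le_W V V' q o a o' : (forall s, V s <= V' s) -> W rm L V q o a o' <= W rm L V' q o a o'.
Proof. by move=> h; rewrite !WE; apply: le_avg => //; exact: tau_pmf. Qed.

Lemma WB V V' q o a o' :
  W rm L (fun s => V s - V' s) q o a o' = W rm L V q o a o' - W rm L V' q o a o'.
Proof. by rewrite !WE avgB. Qed.

Lemma W_cst c q o a o' : W rm L (fun=> c) q o a o' = c.
Proof. by rewrite WE avg_cst //; exact: tau_pmf. Qed.

Lemma W_ge0 V q o a o' : (forall s, 0 <= V s) -> 0 <= W rm L V q o a o'.
Proof. by move=> h; rewrite -(W_cst 0 q o a o') le_W. Qed.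

Lemma W_le V c q o a o' : (forall s, V s <= c) -> W rm L V q o a o' <= c.
Proof. by move=> h; rewrite -[leRHS](W_cst c q o a o') le_W. Qed.

(** Jensen for the machine transition. The bonus sees the variance of [W] only, while the
    telescoping of squares follows the full state, machine state included. *)
Lemma W_sqr_le V q o a o' :
  W rm L V q o a o' ^+ 2 <= W rm L (fun s => V s ^+ 2) q o a o'.
Proof.
have tp := tau_pmf rm q (L o a o').
by rewrite !WE -subr_ge0 -variance_ofE // variance_of_ge0.
Qed.

Lemma rbar_itv q o a o' : 0 <= rbar q o a o' <= 1.
Proof.
rewrite /rbar W_ge0 ?W_le // => s; by have /andP[] := nu_mean_itv q (L o a s.2) s.1.
Qed.

Lemma cross_trans_pmf (p : Obs -> Act -> Obs -> R) s a :
  is_pmf (p s.2 a) -> is_pmf (cross_trans rm L p s a).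
Proof.
move=> pp; split=> [s'|].
  by rewrite /cross_trans mulr_ge0 //; [case: pp|case: (tau_pmf rm s.1 (L s.2 a s'.2))].
rewrite (eq_bigr (fun s' => cross_trans rm L p s a s' * 1)); last by move=> *; rewrite mulr1.
by rewrite cross_transE (eq_avg _ (Y := fun=> 1)) ?avg_cst // => o'; rewrite W_cst.
Qed.

Lemma mdp_trans_pmf s a : is_pmf (mdp_trans M s a).
Proof. by apply: cross_trans_pmf; exact: trans_pmf. Qed.

Lemma mdp_transE s a V :
  \sum_(s' : state) mdp_trans M s a s' * V s' = avg (trans M s.2 a) (W rm L V s.1 s.2 a).
Proof. exact: cross_transE. Qed.

Lemma sum_traj_prob n (pi : policy Obs Act Qst) h s :
  \sum_(t : n.-tuple state) traj_prob M pi h s t = 1.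
Proof.
elim: n h s => [|n IH] h s.
  by rewrite (big_pred1 [tuple]) // => t; rewrite [t]tuple0 /= eqxx.
rewrite (big_tupleS _ (traj_prob M pi h s)) /=.
under eq_bigr do rewrite -mulr_sumr IH mulr1.
by case: (mdp_trans_pmf s (pi h s)).
Qed.

Lemma valueS (pi : policy Obs Act Qst) h s : (h <= H)%N ->
  value M pi h s = avg (trans M s.2 (pi h s))
    (fun o' => rbar s.1 s.2 (pi h s) o' + W rm L (value M pi h.+1) s.1 s.2 (pi h s) o').
Proof.
move=> hH; rewrite avgD /rbar -!mdp_transE -big_split /=.
rewrite /value subSS subSn //.
rewrite (big_tupleS _ (fun t => traj_prob M pi h s t * traj_reward M pi h s t)) /=.
apply: eq_bigr => s' _.
rewrite -mulrDr -[X in X + _]mul1r -(sum_traj_prob (H - h) pi h.+1 s') mulr_suml.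
rewrite -big_split /= mulr_sumr; apply: eq_bigr => t _.
by rewrite -mulrA -mulrDr.
Qed.

Lemma value_last (pi : policy Obs Act Qst) s : value M pi H.+1 s = 0.
Proof.
rewrite /value subnn big1 // => t _; rewrite tuple0 /=; exact: mulr0.
Qed.

Lemma value_itv (pi : policy Obs Act Qst) h s : (h <= H.+1)%N ->
  0 <= value M pi h s <= (H.+1 - h)%:R.
Proof.
move=> hH; have [n hn] : exists n, (n + h = H.+1)%N by exists (H.+1 - h)%N; rewrite subnK.
elim: n h s hH hn => [|n IH] h s hH hn.
  by rewrite -[h]add0n hn value_last subnn lexx.
have hH' : (h <= H)%N by rewrite -ltnS -hn ltnS leq_addl.
have IH' s' := IH h.+1 s' hH' ltac:(by rewrite addnS -hn).
have tp := trans_pmf M s.2 (pi h s).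
rewrite valueS // subSn // avg_ge0 ?avg_le // => o'.
  rewrite -natr1 addrC lerD //; last by have /andP[] := rbar_itv s.1 s.2 (pi h s) o'.
  by apply: W_le => s'; case/andP: (IH' s'); rewrite subSS.
rewrite addr_ge0 //; first by have /andP[] := rbar_itv s.1 s.2 (pi h s) o'.
by apply: W_ge0 => s'; case/andP: (IH' s').
Qed.

Hypothesis Act_inhabited : Act.

Let values_sup h s : (h <= H.+1)%N ->
  has_sup [set value M pi h s | pi in [set: policy Obs Act Qst]].
Proof.
move=> hH; split; first by exists (value M (fun _ _ => Act_inhabited) h s), (fun _ _ => Act_inhabited).
by exists (H.+1 - h)%:R => _ [pi _ <-]; case/andP: (value_itv pi s hH).
Qed.

Lemma value_le_opt (pi : policy Obs Act Qst) h s : (h <= H.+1)%N ->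
  value M pi h s <= opt_value M h s.
Proof.
move=> hH; apply: sup_upper_bound; first exact: values_sup.
by exists pi.
Qed.

Lemma opt_value_le h s c : (h <= H.+1)%N -> (forall pi, value M pi h s <= c) ->
  opt_value M h s <= c.
Proof.
move=> hH hc; apply: sup_le_ub; first by case: (values_sup s hH).
by move=> _ [pi _ <-]; exact: hc.
Qed.

Lemma opt_value_itv h s : (h <= H.+1)%N -> 0 <= opt_value M h s <= (H.+1 - h)%:R.
Proof.
move=> hH; rewrite opt_value_le //; last first.
  by move=> pi; case/andP: (value_itv pi s hH).
rewrite andbT (le_trans _ (value_le_opt (fun _ _ => Act_inhabited) s hH)) //.
by case/andP: (value_itv (fun _ _ => Act_inhabited) s hH).
Qed.

(** Reward and optimal continuation are concentrated together, as one function of the next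
    observation. It does not depend on the data, so finitely many of them suffice. *)
Definition opt_return h q o a (o' : Obs) : R :=
  rbar q o a o' + W rm L (opt_value M h.+1) q o a o'.

Lemma opt_return_itv h q o a o' : (0 < h <= H)%N -> 0 <= opt_return h q o a o' <= H%:R.
Proof.
move=> /andP[h0 hH]; have /andP[r0 r1] := rbar_itv q o a o'.
rewrite /opt_return addr_ge0 //=; last first.
  by apply: W_ge0 => s; case/andP: (opt_value_itv s (h := h.+1) hH).
apply: le_trans (_ : _ <= 1 + (H.+1 - h.+1)%:R) _.
  rewrite lerD //; apply: W_le => s; by case/andP: (opt_value_itv s (h := h.+1) hH).
by rewrite subSS nat1r ler_nat -subSn // leq_subLR addnC -addn1 leq_add2l.
Qed.

Lemma value_le_opt_return (pi : policy Obs Act Qst) h s : (h <= H)%N ->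
  value M pi h s <= avg (trans M s.2 (pi h s)) (opt_return h s.1 s.2 (pi h s)).
Proof.
move=> hH; rewrite valueS //; apply: le_avg; first exact: trans_pmf.
move=> o'; rewrite lerD2l; apply: le_W => s'; exact: value_le_opt.
Qed.

End Values.

(** * Empirical estimates *)

Section EmpiricalEstimates.
Variables (R : realType) (Obs Act Qst : finType) (AP : Type).
Variable M : labeled_mdp R Obs Act Qst AP.
Local Notation state := (Qst * Obs)%type.
Local Notation H := (horizon M).
Variables (st : nat -> nat -> state) (ac : nat -> nat -> Act).
Implicit Types (o : Obs) (a : Act) (X : Obs -> R) (F : nat -> nat -> state -> R).

Definition martingale_diff F (j h : nat) : R :=
  F j h (st j h.+1) - \sum_s' mdp_trans M (st j h) (ac j h) s' * F j h s'.

Local Notation noise := martingale_diff.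

(* The exponent of the self-normalised supermartingale attached to [F], at the
   start of episode [k]. *)
Definition sn_exponent F (k : nat) : R :=
  \sum_(1 <= j < k) \sum_(1 <= h < H.+1) (noise F j h - 2 / 3 * noise F j h ^+ 2).

Definition at_visits o a X (j h : nat) (s' : state) : R :=
  ((st j h).2 == o)%:R * (ac j h == a)%:R * X s'.2.

Local Notation N k o a := (count2 H st ac k o a).
Local Notation ph k o a := (phat R H st ac k o a).

Lemma count2E k o a :
  N k o a = (\sum_(1 <= j < k) \sum_(1 <= h < H.+1)
               ((st j h).2 == o) && (ac j h == a))%N.
Proof.
rewrite /count2 /count3 exchange_big; apply: eq_bigr => j _ /=.
rewrite exchange_big; apply: eq_bigr => h _ /=.
rewrite (bigD1 (st j h.+1).2) //= eqxx andbT big1 ?addn0 // => o' /negPf.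
by rewrite eq_sym => ->; rewrite !andbF.
Qed.

Lemma count2_le k o a : (N k o a <= k.-1 * H)%N.
Proof.
rewrite count2E; apply: (@leq_trans (\sum_(1 <= j < k) \sum_(1 <= h < H.+1) 1)).
  by apply: leq_sum => j _; apply: leq_sum => h _; exact: leq_b1.
rewrite (eq_bigr (fun=> H)); last by move=> j _; rewrite sum_nat_const_nat muln1 subn1.
by rewrite sum_nat_const_nat subn1.
Qed.

Lemma sum_at_visits k o a X :
  \sum_(1 <= j < k) \sum_(1 <= h < H.+1)
    ((st j h).2 == o)%:R * (ac j h == a)%:R * X (st j h.+1).2 =
  \sum_o' (count3 H st ac k o a o')%:R * X o'.
Proof.
rewrite /count3; under [RHS]eq_bigr do rewrite natr_sum mulr_suml.
rewrite [RHS]exchange_big; apply: eq_bigr => j _ /=.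
under [RHS]eq_bigr do rewrite natr_sum mulr_suml.
rewrite [RHS]exchange_big; apply: eq_bigr => h _ /=.
rewrite (bigD1 (st j h.+1).2) //= eqxx andbT big1 ?addr0 -?natrM ?mulnb // => o' /negPf.
by rewrite eq_sym => ->; rewrite !andbF mul0r.
Qed.

Section Visited.
Variables (k : nat) (o : Obs) (a : Act).
Hypothesis N_gt0 : (0 < N k o a)%N.

Let N0 : (N k o a)%:R != 0 :> R. Proof. by rewrite pnatr_eq0 -lt0n. Qed.

Lemma phat_pmf : is_pmf (ph k o a).
Proof.
split=> [x|]; first by rewrite divr_ge0.
by rewrite /phat -mulr_suml -natr_sum mulfV.
Qed.

Lemma sum_at_visits_phat X :
  \sum_(1 <= j < k) \sum_(1 <= h < H.+1)
    ((st j h).2 == o)%:R * (ac j h == a)%:R * X (st j h.+1).2 =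
  (N k o a)%:R * avg (ph k o a) X.
Proof.
rewrite sum_at_visits /avg mulr_sumr; apply: eq_bigr => o' _.
by rewrite mulrA /phat mulrCA mulfV // mulr1.
Qed.

Lemma noise_at_visits X j h :
  noise (at_visits o a X) j h =
  ((st j h).2 == o)%:R * (ac j h == a)%:R * (X (st j h.+1).2 - avg (trans M o a) X).
Proof.
rewrite /martingale_diff mdp_transE /at_visits mulrBr; congr (_ - _).
case: eqP => [->|_]; last first.
  rewrite !mul0r (eq_avg _ (Y := fun=> 0)) ?avg_cst //; first exact: trans_pmf.
  by move=> o'; rewrite WE (eq_avg _ (Y := fun=> 0)) ?avg_cst //; [exact: tau_pmf|move=> ?; rewrite !mul0r].
case: eqP => [->|_]; last first.
  rewrite mul1r !mul0r (eq_avg _ (Y := fun=> 0)) ?avg_cst //; first exact: trans_pmf.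
  by move=> o'; rewrite WE (eq_avg _ (Y := fun=> 0)) ?avg_cst //; [exact: tau_pmf|move=> ?; rewrite !(mul0r, mulr0)].
rewrite !mul1r; apply: eq_avg => o'; rewrite WE (eq_avg _ (Y := fun=> X o')) ?avg_cst //.
  exact: tau_pmf.
by move=> q' /=; rewrite !mul1r.
Qed.

(** The noise vanishes off the visits to [(o, a)], so the exponent depends on the data only through
    the count, the empirical mean and the empirical second moment about the true mean. *)
Lemma sn_exponent_at_visits X : let m := avg (trans M o a) X in
  sn_exponent (at_visits o a X) k =
  (N k o a)%:R * ((avg (ph k o a) X - m)
    - 2 / 3 * (variance_of (ph k o a) X + (avg (ph k o a) X - m) ^+ 2)).
Proof.
move=> m; rewrite -variance_sqr_dev; last exact: phat_pmf.
rewrite -avgZ -{1}(avg_cst phat_pmf m) -!avgB -sum_at_visits_phat.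
apply: eq_bigr => j _; apply: eq_bigr => h _; rewrite noise_at_visits -/m.
rewrite exprMn; case: (_ == o); case: (_ == a); rewrite ?(mul1r, mul0r, mulr0, subr0, expr1n, expr0n) //=; ring.
Qed.

Variable iota : R.
Hypothesis iota_ge1 : 1 <= iota.
Local Notation u := (Num.sqrt (iota / (N k o a)%:R)).
Local Notation Hr := (H%:R : R).

Let H0 : 0 < Hr. Proof. by rewrite ltr0n horizon_gt0. Qed.
Let n0 : 0 < (N k o a)%:R :> R. Proof. by rewrite ltr0n. Qed.

Let iota_gt0 : 0 < iota. Proof. exact: lt_le_trans ltr01 iota_ge1. Qed.

Let u2 : u ^+ 2 = iota / (N k o a)%:R.
Proof. by rewrite sqr_sqrtr // divr_ge0 // ltW. Qed.

Lemma u_gt0 : 0 < u. Proof. by rewrite sqrtr_gt0 divr_gt0. Qed.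

(** The boolean [b] selects the side of the deviation. [K] bounds the episode index and is also the
    number of scales in the grid. *)
Lemma empirical_bernstein X (b : bool) (K : nat) : (0 < k <= K)%N -> (H <= K)%N ->
  (forall o', 0 <= X o' <= Hr) ->
  (forall j, (j < K)%N ->
     sn_exponent (at_visits o a (fun o' => (-1) ^+ b * (1 / 3 * 2 ^- j / Hr) * X o')) k
       <= iota) ->
  let D := (-1) ^+ b * (avg (ph k o a) X - avg (trans M o a) X) in
  let sd := Num.sqrt (variance_of (ph k o a) X) in
  D <= 21 / 8 * u * sd \/ D <= 21 / 20 * u * sd + 27 / 7 * Hr * u ^+ 2.
Proof.
move=> /andP[k0 kK] HK XH hsn D sd.
have K0 : (0 < K)%N by exact: leq_trans kK.
have pp := phat_pmf; have tp := trans_pmf M o a.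
have a1 : 0 <= avg (ph k o a) X <= Hr.
  by rewrite avg_ge0 ?avg_le // => o'; case/andP: (XH o').
have a2 : 0 <= avg (trans M o a) X <= Hr.
  by rewrite avg_ge0 ?avg_le // => o'; case/andP: (XH o').
apply: (bernstein_grid K0 H0 u_gt0).
- rewrite variance_of_ge0 //= expr2; apply: le_trans (variance_le_mean pp XH) _.
  by rewrite ler_wpM2l ?(ltW H0) //; case/andP: a1.
- rewrite /D; case: (b); rewrite ?expr1 ?expr0; lra.
(* The grid reaches below [u]: the count is at most [(k - 1) * H <= K ^ 2] and [iota >= 1], hence
   [u >= 1 / K >= 2 ^- K]. *)
- have -> : 1 / 3 / 2 ^+ K = 1 / (3 * 2 ^+ K) :> R by rewrite !mul1r invfM.
  have KR0 : 0 < K%:R :> R by rewrite ltr0n.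
  apply: (@le_trans _ _ (1 / K%:R)).
    rewrite !mul1r lef_pV2 ?posrE ?mulr_gt0 ?exprn_gt0 //.
    apply: (@le_trans _ _ (2 ^+ K)); last by rewrite ler_peMl ?exprn_ge0 //; lra.
    by rewrite -natrX ler_nat ltnW // ltn_expl.
  rewrite -[leLHS]ger0_norm ?divr_ge0 // -sqrtr_sqr ler_wsqrtr // expr_div_n expr1n.
  apply: ler_pM => //.
  rewrite lef_pV2 ?posrE ?exprn_gt0 // -natrX ler_nat.
  apply: leq_trans (count2_le k o a) _; rewrite expnS expn1 leq_mul //.
  by apply: leq_trans kK; exact: leq_pred.
move=> j jK /=; set l := 1 / 3 / 2 ^+ j.
have l0 : 0 < l by rewrite mulr_gt0 ?invr_gt0 ?exprn_gt0 //; lra.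
have b2 : ((-1) ^+ b) ^+ 2 = 1 :> R by rewrite sqrr_sign.
have := hsn j jK; rewrite sn_exponent_at_visits -/l.
rewrite !avgZ; set c := (-1) ^+ b * (l / Hr).
have -> : variance_of (ph k o a) (fun o' => c * X o') = c ^+ 2 * variance_of (ph k o a) X.
  rewrite /variance_of mulr_sumr; apply: eq_bigr => o' _.
  by rewrite -/(avg _ _) avgZ -mulrBr exprMn mulrCA.
have c2 : c ^+ 2 = (l / Hr) ^+ 2 by rewrite exprMn b2 mul1r.
rewrite -mulrBr.
have -> : c * (avg (ph k o a) X - avg (trans M o a) X) = l / Hr * D.
  by rewrite /c /D mulrAC mulrC mulrCA mulrA.
have -> : D ^+ 2 = (avg (ph k o a) X - avg (trans M o a) X) ^+ 2.
  by rewrite exprMn b2 mul1r.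
have -> : (l / Hr * D) ^+ 2 = (l / Hr) ^+ 2 * (avg (ph k o a) X - avg (trans M o a) X) ^+ 2.
  by rewrite [LHS]exprMn /D [X in _ * X]exprMn b2 mul1r.
rewrite c2 -mulrDr; set V := variance_of _ _ + _ => hs.
rewrite u2.
have lH : 0 < l / Hr by rewrite divr_gt0.
rewrite -(ler_pM2l lH) mulrDr.
have -> : l / Hr * (Hr * (iota / (N k o a)%:R) / l) = iota / (N k o a)%:R.
  by field; rewrite N0 !gt_eqF.
rewrite -lerBlDr ler_pdivlMr // mulrC.
apply: (le_trans _ hs); rewrite le_eqVlt; apply/orP; left; apply/eqP; ring.
Qed.

(** An indicator equals its square, so the quadratic term of the exponent is at most [t * (Q + P)]
    with [t = 2 / (9 * H)], and the bound becomes [(1 - t) * Q <= (1 + t) * P + 3 * Z]. For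
    [t <= 2 / 9] one has [(1 + t) / (1 - t) <= 1 + 18 / 7 * t] and [3 / (1 - t) <= 27 / 7]. *)
Lemma phat_le o1 :
  sn_exponent (at_visits o a (fun o' => 1 / (3 * Hr) * (o' == o1)%:R)) k <= iota ->
  ph k o a o1 <= (1 + 4 / (7 * Hr)) * trans M o a o1 + 27 / 7 * (Hr * u ^+ 2).
Proof.
rewrite sn_exponent_at_visits.
have pp := phat_pmf; have tp := trans_pmf M o a.
have avg1 (f : Obs -> R) : avg f (fun o' => (o' == o1)%:R) = f o1.
  rewrite /avg (bigD1 o1) //= eqxx mulr1 big1 ?addr0 // => o' /negPf ->.
  by rewrite mulr0.
rewrite -(variance_sqr_dev pp) u2.
have H1 : 1 <= Hr by rewrite ler1n horizon_gt0.
set lam := 1 / (3 * Hr); set P := trans M o a o1; set Q := ph k o a o1.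
rewrite !avgZ !avg1 -/P -/Q.
have -> : avg (ph k o a) (fun o' => (lam * (o' == o1)%:R - lam * P) ^+ 2) =
    lam ^+ 2 * (Q * (1 - 2 * P) + P ^+ 2).
  rewrite (eq_avg _ (Y := fun o' => lam ^+ 2 * ((1 - 2 * P) * (o' == o1)%:R + P ^+ 2))).
    by rewrite avgZ avgD avg_cst // avgZ avg1 -/Q; congr (_ * (_ + _)); rewrite mulrC.
  by move=> o' /=; case: eqP => _; rewrite ?mulr0 ?mulr1; ring.
have P0 : 0 <= P by have [p0 _] := tp; exact: p0.
have P1 : P <= 1.
  have [p0 <-] := tp; rewrite (bigD1 o1) //= lerDl; exact: sumr_ge0.
have Q0 : 0 <= Q by have [q0 _] := pp; exact: q0.
move=> h.
have lam0 : 0 < lam by rewrite divr_gt0 // mulr_gt0.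
have lamH : lam * Hr = 1 / 3 by rewrite /lam; field; rewrite gt_eqF.
have {}h : (Q - P) - 2 / 3 * lam * (Q * (1 - 2 * P) + P ^+ 2) <= 3 * (Hr * (iota / (N k o a)%:R)).
  have -> : 3 * (Hr * (iota / (N k o a)%:R)) = iota / ((N k o a)%:R * lam).
    by rewrite /lam; field; rewrite N0 gt_eqF.
  have nlam : 0 < (N k o a)%:R * lam by exact: mulr_gt0.
  rewrite ler_pdivlMr //; apply: (le_trans _ h).
  by rewrite le_eqVlt; apply/orP; left; apply/eqP; ring.
set Z := Hr * _ in h *.
have Z0 : 0 <= Z by rewrite mulr_ge0 ?divr_ge0 // ltW.
pose t := 2 / 3 * lam.
have t29 : t <= 2 / 9.
  by have : lam <= 1 / 3; [rewrite /lam ler_pdivrMr ?mulr_gt0 //; lra | rewrite /t; lra].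
have t0 : 0 <= t by rewrite /t; lra.
have -> : 4 / (7 * Hr) = 18 / 7 * t.
  by rewrite /t /lam; field; rewrite gt_eqF.
have h2 : Q * (1 - t) <= P * (1 + t) + 3 * Z.
  move: h; rewrite -/t => h.
  have : t * (Q * (1 - 2 * P) + P ^+ 2) <= t * (Q + P) by rewrite ler_wpM2l //; nra.
  lra.
have t1 : 0 < 1 - t by lra.
have ht : 0 <= t * (4 - 18 * t) by rewrite mulr_ge0 //; lra.
have hP : 0 <= P * (t * (4 - 18 * t)) by rewrite mulr_ge0.
have hZ : 0 <= Z * (2 - 9 * t) by rewrite mulr_ge0 //; lra.
by rewrite -(ler_pM2r t1); apply: le_trans h2 _; lra.
Qed.

End Visited.
End EmpiricalEstimates.

(** * Optimism *)

Section MaxAct.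
Variables (R : realType) (Act : finType).
Implicit Types (f : Act -> R) (a : Act).

Let range_ub f : has_ubound (range f).
Proof.
exists (\sum_a `|f a|) => _ [a _ <-].
apply: le_trans (ler_norm _) _; rewrite (bigD1 a) //= lerDl; exact: sumr_ge0.
Qed.

Lemma le_max_act f a : f a <= max_act f.
Proof. by apply: ub_le_sup => //; exists a. Qed.

Lemma max_act_le f c a : (forall a', f a' <= c) -> max_act f <= c.
Proof. by move=> fc; apply: ge_sup; [exists (f a), a|move=> _ [a' _ <-]]. Qed.

Lemma max_act_argmax f a : (forall a', f a' <= f a) -> max_act f = f a.
Proof. by move=> fa; apply: le_anti; rewrite max_act_le // le_max_act. Qed.

End MaxAct.

Section Optimism.
Variables (R : realType) (Obs Act Qst : finType) (AP : Type).
Variable M : labeled_mdp R Obs Act Qst AP.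
Local Notation state := (Qst * Obs)%type.
Local Notation L := (label M).
Local Notation rm := (machine M).
Local Notation H := (horizon M).
Local Notation Hr := (H%:R : R).
Variables (K : nat) (rho : R).
Variables (st : nat -> nat -> state) (ac : nat -> nat -> Act).
Implicit Types (q : Qst) (o : Obs) (a : Act) (s : state) (V : state -> R).

Local Notation iota := (log_factor Obs Act Qst H K rho).
Local Notation N k o a := (count2 H st ac k o a).
Local Notation ph k o a := (phat R H st ac k o a).
Local Notation u k o a := (Num.sqrt (iota / (N k o a)%:R)).
Local Notation Vk k h := (ucb_V rm L H K rho st ac k h).
Local Notation Qk k h := (ucb_Q rm L H K rho st ac k h).
Local Notation vterm k h := (visit_term Act H K rho st k h).

Hypothesis Act_inhabited : Act.
Hypothesis iota_ge1 : 1 <= iota.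

Let iota_gt0 : 0 < iota. Proof. exact: lt_le_trans ltr01 iota_ge1. Qed.
Let H0 : 0 < Hr. Proof. by rewrite ltr0n horizon_gt0. Qed.
Let H1 : 1 <= Hr. Proof. by rewrite ler1n horizon_gt0. Qed.

Definition visit_bonus k h o a : R :=
  Num.sqrt (8 * avg (ph k o a) (vterm k h.+1) / (N k o a)%:R).

Lemma visit_term_itv k h o : 0 <= vterm k h o <= Hr ^+ 2.
Proof.
rewrite /visit_term; case: eqP => _; first by rewrite sqr_ge0 lexx.
by rewrite ge_min lexx orbT andbT le_min sqr_ge0 andbT divr_ge0 // mulr_ge0 ?sqr_ge0 //.
Qed.

Lemma bonusE k h V s a :
  bonus rm L H K rho st ac k h V s a =
  Num.sqrt 8 * (u k s.2 a * Num.sqrt (variance_of (ph k s.2 a) (W rm L V s.1 s.2 a)))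
  + 14 / 3 * (Hr * (iota / (N k s.2 a)%:R)) + Num.sqrt 2 * u k s.2 a
  + visit_bonus k h s.2 a.
Proof.
case: s => q o /=; set v := variance_of _ _; set n := (N k o a)%:R.
have iN : 0 <= iota / n by rewrite divr_ge0 // ltW.
congr (_ + _ + _ + _).
- have -> : 8 * iota * v / n = 8 * (iota / n * v) by rewrite -!mulrA (mulrC v).
  by rewrite sqrtrM // sqrtrM.
- rewrite -/n; have [->|n0] := eqVneq n 0; first by rewrite mulr0 invr0 !mulr0.
  by field.
- by rewrite -sqrtrM // mulrA.
Qed.

Lemma sqrt8_itv : (21 / 8 : R) <= Num.sqrt (8 : R) <= 23 / 8.
Proof.
have e (c : R) : 0 <= c -> c = Num.sqrt (c ^+ 2) by move=> c0; rewrite sqrtr_sqr ger0_norm.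
by rewrite {1}(e (21 / 8)) 1?(e (23 / 8)) ?ler_wsqrtr //; lra.
Qed.

Lemma sqrt2_itv : (21 / 16 : R) <= Num.sqrt (2 : R) <= 23 / 16.
Proof.
have e (c : R) : 0 <= c -> c = Num.sqrt (c ^+ 2) by move=> c0; rewrite sqrtr_sqr ger0_norm.
by rewrite {1}(e (21 / 16)) 1?(e (23 / 16)) ?ler_wsqrtr //; lra.
Qed.

Lemma bonus_ge0 k h V s a : 0 <= bonus rm L H K rho st ac k h V s a.
Proof.
rewrite bonusE !addr_ge0 ?mulr_ge0 ?sqrtr_ge0 ?divr_ge0 ?ler0n //; exact: ltW.
Qed.

Lemma Q_updateE Qprev k h V s a : (0 < N k s.2 a)%N ->
  Q_update rm L H K rho st ac Qprev k h V s a =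
  Num.min (Qprev s a) (Num.min Hr
    (avg (ph k s.2 a) (rbar M s.1 s.2 a) + avg (ph k s.2 a) (W rm L V s.1 s.2 a)
     + bonus rm L H K rho st ac k h V s a)).
Proof.
rewrite lt0n => /negPf n0; rewrite /Q_update n0.
by rewrite cross_rewardE cross_transE.
Qed.

Let Q_update_itv Qprev k h V s a : (forall s a, 0 <= Qprev s a <= Hr) ->
  (forall s, 0 <= V s) -> 0 <= Q_update rm L H K rho st ac Qprev k h V s a <= Hr.
Proof.
move=> Q0 V0; have [n0|n0] := posnP (N k s.2 a).
  by rewrite /Q_update n0 eqxx ltW //= lexx.
rewrite Q_updateE // !ge_min lexx orbT andbT !le_min (ltW H0) /=.
have /andP[-> _] /= := Q0 s a.
have pp := phat_pmf n0; rewrite !addr_ge0 ?bonus_ge0 ?avg_ge0 // => o'.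
  by have /andP[] := rbar_itv M s.1 s.2 a o'.
exact: W_ge0.
Qed.

Let V_back_itv Qprev k n s : (forall h s a, 0 <= Qprev h s a <= Hr) ->
  0 <= V_back rm L H K rho st ac Qprev k n s <= Hr.
Proof.
move=> Q0; elim: n s => [|n IH] s /=; first by rewrite lexx ltW.
have U a := @Q_update_itv (Qprev (H - n)%N) k (H - n)%N _ s a (Q0 _)
  (fun s => let: conj h _ := andP (IH s) in h).
rewrite max_act_le //; last by move=> a; have /andP[] := U a.
rewrite andbT (le_trans _ (le_max_act _ Act_inhabited)) //.
by have /andP[] := U Act_inhabited.
Qed.

Lemma ucb_Q_itv k h s a : 0 <= Qk k h s a <= Hr.
Proof.
elim: k h s a => [|k IH] h s a /=; first by rewrite ltW // lexx.
by apply: Q_update_itv => // s'; case/andP: (@V_back_itv (ucb_Q rm L H K rho st ac k) k.+1 (H - h) s' IH).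
Qed.

Lemma ucb_V_itv k h s : 0 <= Vk k h s <= Hr.
Proof. by apply: V_back_itv => *; exact: ucb_Q_itv. Qed.

Lemma ucb_Q_le_V k h s a : (0 < k)%N -> (0 < h <= H)%N -> Qk k h s a <= Vk k h s.
Proof. by move=> k0 hH; rewrite ucb_VE //; exact: le_max_act. Qed.

Hypothesis HK : (H <= K)%N.

Hypothesis opt_return_event : forall (b : bool) q o a h j k,
  (0 < h <= H)%N -> (j < K)%N -> (0 < k <= K)%N ->
  sn_exponent M st ac (at_visits st ac o a
    (fun o' => (-1) ^+ b * (1 / 3 * 2 ^- j / Hr) * opt_return M h q o a o')) k <= iota.

Let dev k h s a (b : bool) : R :=
  (-1) ^+ b * (avg (ph k s.2 a) (opt_return M h s.1 s.2 a)
    - avg (trans M s.2 a) (opt_return M h s.1 s.2 a)).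

Let gap k h s a o' := W rm L (Vk k h.+1) s.1 s.2 a o' - W rm L (opt_value M h.+1) s.1 s.2 a o'.

(** Minkowski applied to [opt_return = W V_k + rbar - gap]: [rbar] takes values in [[0, 1]], hence
    has standard deviation at most [1 / 2], and [gap] takes values in [[0, H]], hence has variance
    at most [H] times its mean. *)
Let std_opt_return_le k h s a : (0 < N k s.2 a)%N -> (0 < h <= H)%N ->
  (forall o', 0 <= gap k h s a o' <= Hr) ->
  Num.sqrt (variance_of (ph k s.2 a) (opt_return M h s.1 s.2 a)) <=
  Num.sqrt (variance_of (ph k s.2 a) (W rm L (Vk k h.+1) s.1 s.2 a)) + 1 / 2
  + Num.sqrt (Hr * avg (ph k s.2 a) (gap k h s a)).
Proof.
move=> n0 hH g0; have pp := phat_pmf n0.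
have -> : opt_return M h s.1 s.2 a = fun o' => (W rm L (Vk k h.+1) s.1 s.2 a o'
    + rbar M s.1 s.2 a o') + - gap k h s a o'.
  by apply/funext => o'; rewrite /opt_return /gap; lra.
apply: le_trans (std_triangle pp _ _) _; apply: lerD.
  apply: le_trans (std_triangle pp _ _) _; rewrite lerD2l.
  have -> : 1 / 2 = Num.sqrt (1 / 4) :> R.
    by rewrite (_ : 1 / 4 = (1 / 2) ^+ 2) ?sqrtr_sqr ?ger0_norm //; lra.
  rewrite ler_wsqrtr //; apply: variance_le_quarter => // o'; exact: rbar_itv.
rewrite ler_wsqrtr //; apply: le_trans (variance_le_mean pp g0).
rewrite le_eqVlt; apply/orP; left; apply/eqP; apply: eq_bigr => o' _; congr (_ * _).
rewrite -/(avg _ _) -/(avg _ _).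
have -> : avg (ph k s.2 a) (fun o' => - gap k h s a o') = - avg (ph k s.2 a) (gap k h s a).
  by rewrite /avg -sumrN; apply: eq_bigr => o1 _; rewrite mulrN.
by rewrite -opprD sqrrN.
Qed.

Let dev_le k h s a b : (0 < N k s.2 a)%N -> (0 < h <= H)%N -> (0 < k <= K)%N ->
  let sd := Num.sqrt (variance_of (ph k s.2 a) (opt_return M h s.1 s.2 a)) in
  dev k h s a b <= 21 / 8 * u k s.2 a * sd \/
  dev k h s a b <= 21 / 20 * u k s.2 a * sd + 27 / 7 * Hr * u k s.2 a ^+ 2.
Proof.
move=> n0 hH kK; apply: (@empirical_bernstein _ _ _ _ _ M st ac k s.2 a n0 iota _ _ b K) => //.
  by move=> o'; exact: opt_return_itv.
by move=> j jK; exact: opt_return_event.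
Qed.

Let u2 k o a : u k o a ^+ 2 = iota / (N k o a)%:R.
Proof. by rewrite sqr_sqrtr // divr_ge0 // ltW. Qed.

Let gap_itv k h s a : (0 < h <= H)%N ->
  (forall s', opt_value M h.+1 s' <= Vk k h.+1 s') ->
  forall o', 0 <= gap k h s a o' <= Hr.
Proof.
move=> /andP[h0 hH] opt o'; rewrite /gap subr_ge0 le_W //=.
have : W rm L (Vk k h.+1) s.1 s.2 a o' <= Hr.
  by apply: W_le => s'; case/andP: (ucb_V_itv k h.+1 s').
have : 0 <= W rm L (opt_value M h.+1) s.1 s.2 a o'.
  by apply: W_ge0 => s'; case/andP: (opt_value_itv Act_inhabited s' (h := h.+1) hH).
lra.
Qed.

Let opt_return_avg f k h s a : avg f (opt_return M h s.1 s.2 a) =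
  avg f (rbar M s.1 s.2 a) + avg f (W rm L (Vk k h.+1) s.1 s.2 a) - avg f (gap k h s a).
Proof. by rewrite -avgD -avgB; apply: eq_avg => o'; rewrite /opt_return /gap; lra. Qed.

Let Q_optimism_step k h s a : (0 < k <= K)%N -> (0 < h <= H)%N ->
  (forall s', opt_value M h.+1 s' <= Vk k h.+1 s') ->
  avg (trans M s.2 a) (opt_return M h s.1 s.2 a) <= Qk k.-1 h s a ->
  avg (trans M s.2 a) (opt_return M h s.1 s.2 a) <= Qk k h s a.
Proof.
move=> kK hH Vopt Qprev; have /andP[k0 _] := kK.
have ret_le : avg (trans M s.2 a) (opt_return M h s.1 s.2 a) <= Hr.
  apply: avg_le; first exact: trans_pmf.
  by move=> o'; have /andP[] := opt_return_itv Act_inhabited s.1 s.2 a o' hH.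
rewrite ucb_QE //; have [n0|n0] := posnP (N k s.2 a).
  by rewrite /Q_update n0.
rewrite Q_updateE // !le_min Qprev ret_le /=.
have gi := gap_itv s a hH Vopt; have pp := phat_pmf n0.
have y0 : 0 <= avg (ph k s.2 a) (gap k h s a).
  by apply: avg_ge0 => // o'; case/andP: (gi o').
(* The sign [true] is the side on which the true mean exceeds the empirical one. *)
have := optimism_arith H0 (u_gt0 n0 iota_ge1) (sqrtr_ge0 _) y0
  (std_opt_return_le n0 hH gi) (dev_le true n0 hH kK).
rewrite bonusE /dev expr1 u2 (opt_return_avg (ph k s.2 a) k).
set sw := Num.sqrt (variance_of _ _).
have usw : 0 <= u k s.2 a * sw by rewrite mulr_ge0 ?sqrtr_ge0.
have /andP[s8 _] := sqrt8_itv; have /andP[s2 _] := sqrt2_itv.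
have u0 := ltW (u_gt0 n0 iota_ge1).
have := ler_wpM2r usw s8; have := ler_wpM2r u0 s2.
have : 0 <= visit_bonus k h s.2 a by exact: sqrtr_ge0.
lra.
Qed.

Let V_optimism_step k h : (0 < k)%N -> (0 < h <= H)%N ->
  (forall s a, avg (trans M s.2 a) (opt_return M h s.1 s.2 a) <= Qk k h s a) ->
  forall s, opt_value M h s <= Vk k h s.
Proof.
move=> k0 /andP[h0 hH] Qopt s; apply: opt_value_le => //; first exact: leqW.
move=> pi; apply: le_trans (value_le_opt_return Act_inhabited pi s hH) _.
by apply: le_trans (Qopt _ _) (ucb_Q_le_V _ _ k0 _); rewrite h0.
Qed.

(** Since [Q_k] is a minimum with [Q_{k-1}], the induction on [k] must carry the statement on [Q];
    within an episode the induction goes backwards from step [H + 1]. At [k = 0] only the [Q] part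
    is meaningful, [Q_0] being constantly [H]. *)
Lemma ucb_optimism k : (k <= K)%N ->
  (forall h s a, (0 < h <= H)%N ->
     avg (trans M s.2 a) (opt_return M h s.1 s.2 a) <= Qk k h s a) /\
  ((0 < k)%N -> forall h s, (0 < h <= H.+1)%N -> opt_value M h s <= Vk k h s).
Proof.
elim: k => [|k IH] kK.
  split=> // h s a hH /=; apply: avg_le; first exact: trans_pmf.
  by move=> o'; have /andP[] := opt_return_itv Act_inhabited s.1 s.2 a o' hH.
have {IH}[Qprev _] := IH (ltnW kK).
suff both n h : (n + h = H)%N -> (forall s, opt_value M h.+1 s <= Vk k.+1 h.+1 s) /\
    ((0 < h)%N -> forall s a, avg (trans M s.2 a) (opt_return M h s.1 s.2 a) <= Qk k.+1 h s a).
  split=> [h s a /andP[h0 hH]|_ [|h] s // /andP[_ hH]].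
    by apply: (both (H - h)%N h _).2 => //; rewrite subnK.
  by apply: (both (H - h)%N h _).1; rewrite subnK.
suff V m i : (m + i = H)%N -> forall s, opt_value M i.+1 s <= Vk k.+1 i.+1 s.
  move=> nh; split=> [|h0 s a]; first exact: V nh.
  have hH : (0 < h <= H)%N by rewrite h0 -nh leq_addl.
  by apply: Q_optimism_step => //; [exact: V nh|exact: Qprev].
elim: m i => [|m IHm] i nh.
  move=> s; rewrite -[i]add0n nh ucb_V_last.
  by have /andP[] := opt_value_itv Act_inhabited s (leqnn H.+1); rewrite subnn.
have hH : (0 < i.+1 <= H)%N by rewrite /= -nh addSn ltnS leq_addl.
apply: V_optimism_step => // s a; apply: Q_optimism_step => //; last exact: Qprev.
by apply: IHm; rewrite addnS -addSn.
Qed.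

Hypothesis phat_event : forall o a o1 k, (0 < k <= K)%N ->
  sn_exponent M st ac (at_visits st ac o a
    (fun o' => 1 / (3 * Hr) * (o' == o1)%:R)) k <= iota.

(** The pointwise bound on [phat] is summed over the observations, so [X] may depend on the data: it
    is applied to the gap, to the visit terms and to squared deviations of [V_k]. *)
Lemma phat_avg_le k o a X c : (0 < k <= K)%N -> (0 < N k o a)%N ->
  (forall o', 0 <= X o' <= c) ->
  avg (ph k o a) X <= (1 + 4 / (7 * Hr)) * avg (trans M o a) X
    + 27 / 7 * (#|Obs|%:R * c * (Hr * u k o a ^+ 2)).
Proof.
move=> kK n0 Xc.
have Hu : 0 <= Hr * u k o a ^+ 2 by rewrite mulr_ge0 ?sqr_ge0 // ltW.
apply: (@le_trans _ _ (\sum_o' ((1 + 4 / (7 * Hr)) * trans M o a o'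
    + 27 / 7 * (Hr * u k o a ^+ 2)) * X o')).
  apply: ler_sum => o' _; have /andP[X0 _] := Xc o'.
  by rewrite ler_wpM2r //; apply: phat_le => //; exact: phat_event.
under eq_bigr do rewrite mulrDl -mulrA.
rewrite big_split /= -mulr_sumr lerD2l.
apply: (@le_trans _ _ (\sum_(o' : Obs) 27 / 7 * (Hr * u k o a ^+ 2) * c)).
  apply: ler_sum => o' _; have /andP[_ X1] := Xc o'.
  by rewrite ler_wpM2l // mulr_ge0.
rewrite sumr_const -mulr_natr le_eqVlt; apply/orP; left; apply/eqP; ring.
Qed.

(** The bonus plus the deviation of [opt_return] plus all lower-order terms:
    [11 / 2 = 23 / 8 + 21 / 8] and [11 / 4 = 23 / 16 + 21 / 16], while 26 exceeds the sum of all
    coefficients of [u ^+ 2]. *)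
Definition beta k h s a : R :=
  11 / 2 * (u k s.2 a * Num.sqrt (variance_of (ph k s.2 a) (W rm L (Vk k h.+1) s.1 s.2 a)))
  + 11 / 4 * u k s.2 a + 26 * (#|Obs|%:R * Hr ^+ 2 * u k s.2 a ^+ 2)
  + visit_bonus k h s.2 a.

(** The factor [4 / 5] collects [4 / 7], from moving the mean of the gap from [phat] to the true
    kernel, and [11 / 49], from the share [y / (7 * H)] of [regret_arith] moved in the same way. *)
Lemma ucb_Q_le k h s a : (0 < k <= K)%N -> (0 < h <= H)%N -> (0 < N k s.2 a)%N ->
  Qk k h s a <= avg (trans M s.2 a) (rbar M s.1 s.2 a)
    + avg (trans M s.2 a) (W rm L (Vk k h.+1) s.1 s.2 a)
    + 4 / (5 * Hr) * (avg (trans M s.2 a) (W rm L (Vk k h.+1) s.1 s.2 a)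
                      - avg (trans M s.2 a) (W rm L (opt_value M h.+1) s.1 s.2 a))
    + beta k h s a.
Proof.
move=> kK hH n0; have /andP[k0 kK'] := kK; have /andP[h0 hH'] := hH.
have Vopt s' : opt_value M h.+1 s' <= Vk k h.+1 s'.
  by apply: (ucb_optimism kK').2.
have gi := gap_itv s a hH Vopt; have pp := phat_pmf n0; have tp := trans_pmf M s.2 a.
have y0 : 0 <= avg (ph k s.2 a) (gap k h s a).
  by apply: avg_ge0 => // o'; case/andP: (gi o').
have x0 : 0 <= avg (trans M s.2 a) (gap k h s a).
  by apply: avg_ge0 => // o'; case/andP: (gi o').
have := regret_arith H0 (u_gt0 n0 iota_ge1) (sqrtr_ge0 _) y0
  (std_opt_return_le n0 hH gi) (dev_le false n0 hH kK).
have := phat_avg_le kK n0 gi.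
rewrite /dev expr0 mul1r !(opt_return_avg _ k).
rewrite ucb_QE // Q_updateE // => hgap hdev.
apply: le_trans (_ : _ <= avg (ph k s.2 a) (rbar M s.1 s.2 a)
    + avg (ph k s.2 a) (W rm L (Vk k h.+1) s.1 s.2 a)
     + bonus rm L H K rho st ac k h (Vk k h.+1) s a) _.
  by rewrite !ge_min lexx !orbT.
have -> : avg (trans M s.2 a) (W rm L (Vk k h.+1) s.1 s.2 a)
    - avg (trans M s.2 a) (W rm L (opt_value M h.+1) s.1 s.2 a) =
    avg (trans M s.2 a) (gap k h s a) by rewrite -avgB.
rewrite bonusE /beta.
move: hdev hgap; set sw := Num.sqrt (variance_of _ _).
set y := avg (ph k s.2 a) _ in y0 *; set x := avg (trans M s.2 a) (gap _ _ _ _) in x0 *.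
set U := u k s.2 a; rewrite -(u2 k s.2 a : U ^+ 2 = _); set O : R := #|Obs|%:R.
have U0 : 0 <= U by exact: sqrtr_ge0.
have usw : 0 <= U * sw by rewrite mulr_ge0 ?sqrtr_ge0.
have /andP[_ s8] := sqrt8_itv; have /andP[_ s2] := sqrt2_itv.
have := ler_wpM2r usw s8; have := ler_wpM2r U0 s2.
have U2 : 0 <= U ^+ 2 by exact: sqr_ge0.
have O1 : 1 <= O by rewrite ler1n; apply/card_gt0P; exists s.2.
have e1 : 27 / 7 * (O * Hr * (Hr * U ^+ 2)) = 27 / 7 * (O * Hr ^+ 2 * U ^+ 2) by ring.
rewrite e1.
have Z0 : 0 <= Hr ^+ 2 * U ^+ 2 by rewrite mulr_ge0 ?sqr_ge0.
have hZ1 : Hr ^+ 2 * U ^+ 2 <= O * Hr ^+ 2 * U ^+ 2 by rewrite -mulrA ler_peMl.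
have hZ2 : Hr * U ^+ 2 <= O * Hr ^+ 2 * U ^+ 2.
  by apply: le_trans hZ1; rewrite ler_wpM2r // expr2 ler_peMl // ltW.
set Z := O * Hr ^+ 2 * U ^+ 2 in hZ1 hZ2 *.
pose r := Hr^-1.
have r0 : 0 <= r by rewrite invr_ge0 ltW.
have r1 : r <= 1 by rewrite invf_le1.
have -> : 4 / (7 * Hr) = 4 / 7 * r by rewrite invfM mulrA.
have -> : 4 / (5 * Hr) = 4 / 5 * r by rewrite invfM mulrA.
have -> : y / (7 * Hr) = y * r / 7 by rewrite /r; field; rewrite gt_eqF.
move=> h2 h8 hdev hgap.
have Zp : 0 <= Z by apply: le_trans hZ1.
have hyr : y * r <= x * r + 4 / 7 * (x * r) + 27 / 7 * Z.
  have h1 := ler_wpM2r r0 hgap.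
  have xr0 : 0 <= x * r by rewrite mulr_ge0.
  have xrr : x * r * r <= x * r by rewrite ler_piMr.
  have Zr : Z * r <= Z by rewrite ler_piMr.
  lra.
have xr0 : 0 <= x * r by rewrite mulr_ge0.
lra.
Qed.

End Optimism.

(** * Regret on the good event *)

Section Potentials.
Variable R : realType.
Variables (H : nat) (n nu : nat -> nat).
Hypotheses (H_gt0 : (0 < H)%N) (n1 : n 1%N = 0%N).
Hypothesis nS : forall j, n j.+1 = (n j + nu j)%N.

(** Counts are frozen during an episode, so the last episode that starts below [10 * H] can
    overshoot by [H]. The bound by [n k] is what the induction needs. *)
Lemma sum_visits_few k : (forall j, (nu j <= H)%N) ->
  (\sum_(1 <= j < k) nu j * (n j < 10 * H) <= minn (n k) (11 * H))%N.
Proof.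
move=> nuH; elim: k => [|k IH]; first by rewrite big_geq.
case: k IH => [|k] IH; first by rewrite big_geq.
rewrite big_nat_recr //= [n k.+2]nS; have := nuH k.+1; move: IH; set S := (\sum_(1 <= j < k.+1) _)%N.
by case: ltnP => h; rewrite ?muln0 ?muln1; lia.
Qed.

(** Above the threshold [10 * H] one episode multiplies the count by at most [11 / 10]; hence
    [nu / n <= 11 / 10 * nu / (n + nu)], and the latter ratio is at most the increment of [ln n].
    The [maxn] keeps the potential at zero until the threshold is reached. *)
Lemma sum_visits_inv k : (forall j, (nu j <= H)%N) ->
  \sum_(1 <= j < k) (nu j)%:R * (if (10 * H <= n j)%N then (n j)%:R^-1 else 0) <=
  11 / 10 * ln ((maxn (n k) (10 * H))%:R / (10 * H)%:R : R).
Proof.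
move=> nuH.
have H10 : 0 < (10 * H)%:R :> R by rewrite ltr0n muln_gt0.
have base m : 0 <= 11 / 10 * ln ((maxn m (10 * H))%:R / (10 * H)%:R : R).
  by rewrite mulr_ge0 // ln_ge0 // ler_pdivlMr // mul1r ler_nat leq_maxr.
elim: k => [|k IH]; first by rewrite big_geq.
case: k IH => [|k] IH; first by rewrite big_geq.
rewrite big_nat_recr //= [n k.+2]nS; set j := k.+1 in IH *.
case: leqP => hj; last first.
  rewrite mulr0 addr0; apply: le_trans IH _; rewrite ler_wpM2l //.
  have mx m : 0 < (maxn m (10 * H))%:R :> R.
    by rewrite ltr0n leq_max muln_gt0 H_gt0 orbT.
  rewrite ler_ln ?posrE ?divr_gt0 //.
  rewrite ler_pM2r ?invr_gt0 // ler_nat; lia.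
have nj0 : (0 < n j)%N by apply: leq_trans hj; rewrite muln_gt0.
have njR : 0 < (n j)%:R :> R by rewrite ltr0n.
have nnR : 0 < (n j + nu j)%:R :> R by rewrite ltr0n addn_gt0 nj0.
move: IH; rewrite (maxn_idPl hj) (maxn_idPl (leq_trans hj (leq_addr _ _))) => IH.
have ratioE (x y z : R) : x != 0 -> z != 0 -> y / z = x / z * (y / x).
  by move=> x0 z0; field; rewrite x0 z0.
rewrite (ratioE (n j)%:R (n j + nu j)%:R (10 * H)%:R) ?(gt_eqF njR) ?(gt_eqF H10) //.
rewrite lnM ?posrE ?divr_gt0 // mulrDr lerD //.
have := ln_ge_1_sub_inv (divr_gt0 nnR njR); rewrite invf_div => hl.
apply: (@le_trans _ _ (11 / 10 * (1 - (n j)%:R / (n j + nu j)%:R))); last first.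
  by rewrite ler_wpM2l //; lra.
have -> : 1 - (n j)%:R / (n j + nu j)%:R = (nu j)%:R / (n j + nu j)%:R :> R.
  by rewrite natrD; field; rewrite -natrD gt_eqF.
rewrite mulrCA ler_wpM2l // -[leLHS]mul1r ler_pdivrMr // mulrAC ler_pdivlMr // mul1r.
have : (10 * nu j)%:R <= (n j)%:R :> R by rewrite ler_nat (leq_trans _ hj) // leq_mul2l nuH orbT.
by rewrite natrM natrD; lra.
Qed.

(** A harmonic sum: the first visit costs [C] and the [i]-th later one [B / i]. The term [- 1 / n]
    makes the potential exactly [C] after the first visit, so that the induction starts without
    loss. *)
Lemma sum_visits_harmonic (C B : R) (g : nat -> R) k : 0 <= C -> 0 <= B ->
  (forall j, (nu j <= 1)%N) -> g 0%N <= C -> (forall i, (0 < i)%N -> g i <= B / i%:R) ->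
  \sum_(1 <= j < k.+1) (nu j)%:R * g (n j) <=
  if n k.+1 == 0%N then 0 else C + B * (1 + ln (n k.+1)%:R - (n k.+1)%:R^-1).
Proof.
move=> C0 B0 nu1 g0 gi; elim: k => [|k IH]; first by rewrite big_geq // n1 eqxx.
rewrite big_nat_recr //= [n k.+2]nS; set j := k.+1 in IH *.
have [->|->] : nu j = 0%N \/ nu j = 1%N by have := nu1 j; lia.
  by rewrite mul0r addr0 addn0.
rewrite mul1r addn1 /=; case: (posnP (n j)) IH => [->|nj0] IH.
  by rewrite ln1 invr1 addr0 subrr mulr0 addr0; lra.
have njR : 0 < (n j)%:R :> R by rewrite ltr0n.
apply: le_trans (lerD IH (gi _ nj0)) _.
rewrite -addrA lerD2l -mulrDr ler_wpM2l //.
have nR : 0 < (n j).+1%:R :> R by rewrite ltr0n.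
have := ln_ge_1_sub_inv (divr_gt0 nR njR); rewrite invf_div ln_div ?posrE //.
have -> : (n j)%:R / (n j).+1%:R = 1 - (n j).+1%:R^-1 :> R.
  by rewrite -natr1; field; rewrite natr1 gt_eqF.
move: (ln _) (ln _) (_^-1) (_^-1) => l1 l0 i1 i0; lra.
Qed.

End Potentials.

Section StepSums.
Variables (R : realType) (K H : nat).
Implicit Types f g : nat -> nat -> R.

Definition episode_sum f : R := \sum_(1 <= k < K.+1) \sum_(1 <= h < H.+1) f k h.

Local Notation dsum := episode_sum.

Lemma le_dsum f g :
  (forall k h, (0 < k <= K)%N -> (0 < h <= H)%N -> f k h <= g k h) -> dsum f <= dsum g.
Proof. by move=> fg; apply: ler_sum_nat => k kK; apply: ler_sum_nat => h hH; exact: fg. Qed.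

Lemma eq_dsum f g :
  (forall k h, (0 < k <= K)%N -> (0 < h <= H)%N -> f k h = g k h) -> dsum f = dsum g.
Proof. by move=> fg; apply: eq_big_nat => k kK; apply: eq_big_nat => h hH; exact: fg. Qed.

Lemma dsumD f g : dsum (fun k h => f k h + g k h) = dsum f + dsum g.
Proof. by rewrite -big_split; apply: eq_bigr => k _; rewrite big_split. Qed.

Lemma dsumB f g : dsum (fun k h => f k h - g k h) = dsum f - dsum g.
Proof. by rewrite /episode_sum -sumrB; apply: eq_bigr => k _; rewrite sumrB. Qed.

Lemma dsumZ c f : dsum (fun k h => c * f k h) = c * dsum f.
Proof. by rewrite /episode_sum mulr_sumr; apply: eq_bigr => k _; rewrite mulr_sumr. Qed.

Lemma dsum_cst c : dsum (fun _ _ => c) = (K * H)%:R * c.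
Proof.
rewrite /episode_sum (eq_bigr (fun=> H%:R * c)); last first.
  by move=> k _; rewrite big_const_nat iter_addr_0 subn1 mulr_natl.
by rewrite big_const_nat iter_addr_0 subn1 natrM -mulrA [RHS]mulr_natl.
Qed.

Lemma dsum_ge0 f : (forall k h, (0 < k <= K)%N -> (0 < h <= H)%N -> 0 <= f k h) -> 0 <= dsum f.
Proof.
by move=> f0; rewrite -(mulr0 (K * H)%:R) -dsum_cst; exact: le_dsum.
Qed.

Lemma dsum_sqrtM_le f g :
  (forall k h, (0 < k <= K)%N -> (0 < h <= H)%N -> 0 <= f k h) ->
  (forall k h, (0 < k <= K)%N -> (0 < h <= H)%N -> 0 <= g k h) ->
  dsum (fun k h => Num.sqrt (f k h) * Num.sqrt (g k h)) <= Num.sqrt (dsum f * dsum g).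
Proof.
move=> f0 g0; rewrite /episode_sum.
have F0 k : (0 < k < K.+1)%N -> 0 <= \sum_(1 <= h < H.+1) f k h.
  by move=> kK; rewrite big_nat; apply: sumr_ge0 => h hH; exact: f0.
have G0 k : (0 < k < K.+1)%N -> 0 <= \sum_(1 <= h < H.+1) g k h.
  by move=> kK; rewrite big_nat; apply: sumr_ge0 => h hH; exact: g0.
rewrite big_nat [X in X * _]big_nat [X in _ * X]big_nat.
apply: le_trans (sum_sqrtM_le _ F0 G0); apply: ler_sum => k kK.
rewrite -sqrtrM ?F0 // big_nat [X in X * _]big_nat [X in _ * X]big_nat.
by apply: sum_sqrtM_le => h hH; [exact: f0|exact: g0].
Qed.

End StepSums.

Section NoiseBounds.
Variables (R : realType) (Obs Act Qst : finType) (AP : Type).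
Variable M : labeled_mdp R Obs Act Qst AP.
Local Notation state := (Qst * Obs)%type.
Local Notation H := (horizon M).
Variables (K : nat) (st : nat -> nat -> state) (ac : nat -> nat -> Act).
Implicit Types f : nat -> nat -> state -> R.

Local Notation noise := (martingale_diff M st ac).
Local Notation sn_exponent := (sn_exponent M st ac).
Local Notation dsum := (episode_sum K H).
Local Notation T := ((K * H)%:R : R).

Lemma noiseZ (c : R) f j h : noise (fun j h s => c * f j h s) j h = c * noise f j h.
Proof.
rewrite /martingale_diff mulrBr mulr_sumr; congr (_ - _).
by apply: eq_bigr => s _; rewrite mulrCA.
Qed.

Lemma noise_norm_le f (B : R) j h :
  (forall s s', `|f j h s - f j h s'| <= B) -> `|noise f j h| <= B.
Proof.
move=> fB; have [p0 p1] := mdp_trans_pmf M (st j h) (ac j h).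
rewrite /martingale_diff -[X in X - _]mul1r -{1}p1 mulr_suml -sumrB.
apply: le_trans (ler_norm_sum _ _ _) _; rewrite -[leRHS]mul1r -p1 mulr_suml.
by apply: ler_sum => s' _; rewrite -mulrBr normrM ger0_norm // ler_wpM2l.
Qed.

Lemma sn_exponentE f : sn_exponent f K.+1 =
  dsum (noise f) - 2 / 3 * dsum (fun k h => noise f k h ^+ 2).
Proof. by rewrite -dsumZ -dsumB. Qed.

(* With [`|noise f| <= B], the self-normalised bound is of Azuma type. *)
Lemma dsum_noise_le f (B iota : R) : 0 < B -> 0 < iota -> 0 < T ->
  (forall k h, (0 < k <= K)%N -> (0 < h <= H)%N -> `|noise f k h| <= B) ->
  sn_exponent (fun k h s => Num.sqrt (3 * iota / (2 * T)) / B * f k h s) K.+1 <= iota ->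
  dsum (noise f) <= 49 / 30 * B * Num.sqrt (T * iota).
Proof.
move=> B0 i0 T0 fB.
move: (T0); rewrite ltr0n muln_gt0 => /andP[K0 H0]; set th := Num.sqrt _.
(* [th] is the scale for which the quadratic term is at most [iota], leaving
   [th / B * X <= 2 * iota]; [49 / 30] is a rational upper bound of [sqrt (8 / 3)]. *)
have th0 : 0 < th by rewrite sqrtr_gt0 divr_gt0 ?mulr_gt0.
have th2 : th ^+ 2 = 3 * iota / (2 * T).
  by rewrite sqr_sqrtr // divr_ge0 ?mulr_ge0 // ltW.
rewrite sn_exponentE.
rewrite (eq_dsum (g := fun k h => th / B * noise f k h)); last first.
  by move=> k h _ _; rewrite noiseZ.
rewrite (eq_dsum (f := fun k h => _ ^+ 2) (g := fun k h => (th / B) ^+ 2 * noise f k h ^+ 2)); last first.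
  by move=> k h _ _; rewrite noiseZ exprMn.
rewrite !dsumZ => hs.
have sq : dsum (fun k h => noise f k h ^+ 2) <= T * B ^+ 2.
  rewrite -dsum_cst; apply: le_dsum => k h kK hH.
  by rewrite -real_normK ?num_real // lerXn2r ?nnegrE ?(ltW B0) // fB.
set X := dsum (noise f) in hs *.
have h1 : th / B * X <= 2 * iota.
  have := ler_wpM2l (sqr_ge0 (th / B)) sq.
  have -> : (th / B) ^+ 2 * (T * B ^+ 2) = 3 / 2 * iota.
    rewrite expr_div_n th2; field; rewrite !gt_eqF ?ltr0n //.
  lra.
have h2 : X <= 2 * iota / th * B.
  rewrite -(ler_pM2l (divr_gt0 th0 B0)); apply: le_trans h1 _.
  rewrite le_eqVlt; apply/orP; left; apply/eqP; field; rewrite !gt_eqF //.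
apply: le_trans h2 _; rewrite [leRHS]mulrAC ler_wpM2r ?(ltW B0) //.
rewrite -(@ler_pXn2r _ 2) ?nnegrE ?mulr_ge0 ?divr_ge0 ?sqrtr_ge0 ?invr_ge0 ?(ltW th0) ?(ltW i0) //.
rewrite !exprMn exprVn th2 sqr_sqrtr ?mulr_ge0 ?(ltW T0) ?(ltW i0) //.
have -> : 2 ^+ 2 * iota ^+ 2 * (3 * iota / (2 * T))^-1 = 8 / 3 * (T * iota).
  by field; rewrite !gt_eqF ?ltr0n.
have : 0 <= T * iota by rewrite mulr_ge0 // ltW.
by move: (T * iota) => z z0; lra.
Qed.

(* For nonnegative terms the squares are absorbed by the terms themselves, so
   that the bound is multiplicative. *)
Lemma dsum_pred_le (g : nat -> nat -> state -> R) (C iota : R) : 0 < C ->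
  (forall k h s, 0 <= g k h s <= C) ->
  sn_exponent (fun k h s => - (1 / (3 * C)) * g k h s) K.+1 <= iota ->
  dsum (fun k h => \sum_s' mdp_trans M (st k h) (ac k h) s' * g k h s') <=
  11 / 7 * dsum (fun k h => g k h (st k h.+1)) + 27 / 7 * (C * iota).
Proof.
move=> C0 gC; rewrite sn_exponentE.
set P := fun k h => \sum_s' _; set v := fun k h => g k h (st k h.+1).
rewrite (eq_dsum (g := fun k h => 1 / (3 * C) * (P k h - v k h))); last first.
  by move=> k h _ _; rewrite noiseZ /martingale_diff -/(P k h) /v mulNr -mulrN opprB.
rewrite (eq_dsum (f := fun k h => _ ^+ 2) (g := fun k h => (1 / (3 * C)) ^+ 2 * (P k h - v k h) ^+ 2)); last first.
  by move=> k h _ _; rewrite noiseZ /martingale_diff -/(P k h) /v mulNr -mulrN opprB exprMn.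
rewrite !dsumZ dsumB => hs.
(* Both [P] and [v] lie in [[0, C]], so the square of their difference is at most [C] times their
   sum. With the scale [1 / (3 * C)] this leaves [7 / 9 * a <= 11 / 9 * b + 3 * C * iota]. *)
have sq : dsum (fun k h => (P k h - v k h) ^+ 2) <= C * (dsum P + dsum v).
  rewrite -dsumD -dsumZ; apply: le_dsum => k h _ _.
  have [p0 p1] := mdp_trans_pmf M (st k h) (ac k h).
  have /andP[v0 vC] := gC k h (st k h.+1).
  have P0 : 0 <= P k h.
    by apply: sumr_ge0 => s _; rewrite mulr_ge0 //; case/andP: (gC k h s).
  have PC : P k h <= C.
    rewrite -[leRHS]mul1r -p1 mulr_suml; apply: ler_sum => s _.
    by rewrite ler_wpM2l //; case/andP: (gC k h s).
  rewrite /v; move: (P k h) (g k h _) P0 PC v0 vC => x y; nra.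
have := ler_wpM2l (sqr_ge0 (1 / (3 * C))) sq.
set Q := dsum (fun k h => (P k h - v k h) ^+ 2) in hs *.
set a := dsum P in hs *; set b := dsum v in hs *.
have -> : (1 / (3 * C)) ^+ 2 * (C * (a + b)) = 1 / (3 * C) * ((a + b) / 3).
  by field; rewrite gt_eqF.
move=> h2.
have h3 : 1 / (3 * C) * (a - b - 2 / 9 * (a + b)) <= iota.
  by apply: le_trans hs; move: h2; move: (1 / (3 * C)) => c h2; lra.
move: h3; rewrite mul1r mulrC ler_pdivrMr ?mulr_gt0 //; lra.
Qed.

End NoiseBounds.

(** * Closing the inequality for the sum of the bonuses *)

Section RegretArithmetic.
Variable R : realType.
Variables (T H O A i S S1 Sv Sp Sm SPm Sm' nbad Y : R).
(* The [S]'s stand for sums over all steps: [S] of the regret excess of a step,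
   [S1] of [1 / n], [Sv] and [Sp] of the variances of the optimistic values under
   the empirical and the true kernels, [Sm], [SPm] and [Sm'] of the minima of the
   last bonus term: empirical means, true means and realised values.  [nbad]
   counts the steps at which fewer than [10 * H] samples are available. *)
Hypotheses (H1 : 1 <= H) (O1 : 1 <= O) (A1 : 1 <= A) (i1 : 1 <= i).
Hypotheses (S0 : 0 <= S) (S10 : 0 <= S1) (Sv0 : 0 <= Sv) (Sm0 : 0 <= Sm).
Hypothesis YE : Y = H ^+ 2 * O ^+ 2 * A * i ^+ 2.
Hypothesis T_large : 2500 * Y <= T.

Let H0 : 0 < H. Proof. exact: lt_le_trans ltr01 H1. Qed.
Let O0 : 0 < O. Proof. exact: lt_le_trans ltr01 O1. Qed.
Let A0 : 0 < A. Proof. exact: lt_le_trans ltr01 A1. Qed.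
Let i0 : 0 < i. Proof. exact: lt_le_trans ltr01 i1. Qed.
Let Y0 : 0 < Y. Proof. by rewrite YE !mulr_gt0 ?exprn_gt0. Qed.
Let T0 : 0 < T. Proof. by apply: lt_le_trans T_large; rewrite mulr_gt0 ?ltr0n. Qed.

Let le_mul1 (x y : R) : 0 <= x -> 1 <= y -> x <= x * y.
Proof. by move=> x0 y1; rewrite ler_peMr. Qed.

Let HsqrtT : H * Num.sqrt (T * i) <= T / 50.
Proof.
rewrite -(@ler_pXn2r _ 2) ?nnegrE ?mulr_ge0 ?divr_ge0 ?sqrtr_ge0 ?(ltW H0) ?(ltW T0) //.
rewrite exprMn sqr_sqrtr ?mulr_ge0 ?(ltW T0) ?(ltW i0) //.
have : H ^+ 2 * i <= Y.
  have -> : Y = H ^+ 2 * i * (O ^+ 2 * A * i) by rewrite YE; ring.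
  apply: le_mul1; first by rewrite mulr_ge0 ?sqr_ge0 // ltW.
  by rewrite !mulr_ege1 // exprn_ege1.
move=> hY; have : T * (2500 * (H ^+ 2 * i)) <= T * T.
  by rewrite ler_wpM2l ?(ltW T0) //; move: T_large; lra.
lra.
Qed.

Hypothesis nbad_le : nbad <= 11 * H * O * A.

Let nbadH : H * nbad <= 11 * Y.
Proof.
apply: le_trans (_ : _ <= H * (11 * H * O * A)) _; first by rewrite ler_wpM2l // ltW.
have -> : 11 * Y = H * (11 * H * O * A) * (O * i ^+ 2) by rewrite YE; ring.
apply: le_mul1; first by rewrite !mulr_ge0 // ltW.
by rewrite mulr_ege1 // exprn_ege1.
Qed.

Hypothesis S1_le : S1 <= 11 / 10 * (O * A * i).

Let S1Y : O * H ^+ 2 * (i * S1) <= 11 / 10 * Y.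
Proof.
have -> : 11 / 10 * Y = O * H ^+ 2 * (i * (11 / 10 * (O * A * i))) by rewrite YE; ring.
rewrite ler_wpM2l //; first by rewrite mulr_ge0 ?sqr_ge0 // ltW.
by rewrite ler_wpM2l // ltW.
Qed.

Hypothesis Sv_le : Sv <= 11 / 7 * Sp + 27 / 7 * (O * H ^+ 3 * i * S1).
Hypothesis Sp_le : Sp <= 2 * H * (9 / 5 * T + S + H * nbad) + 49 / 30 * H ^+ 2 * Num.sqrt (T * i).

(** [X] stands for the larger of [T] and [S]: the variances depend on the very sum [S] being
    bounded, and the two cases are separated only at the end. *)
Let SvX X : T <= X -> S <= X -> Sv <= 9 * (H * X).
Proof.
move=> TX SX.
have hSp : Sp <= 565 / 100 * (H * X).
  apply: le_trans Sp_le _.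
  have -> : 2 * H * (9 / 5 * T + S + H * nbad) + 49 / 30 * H ^+ 2 * Num.sqrt (T * i) =
     H * (2 * (9 / 5 * T + S + H * nbad) + 49 / 30 * (H * Num.sqrt (T * i))) by ring.
  rewrite [leRHS]mulrCA ler_wpM2l ?(ltW H0) //.
  have : H * nbad <= 11 / 2500 * T.
    by move: nbadH T_large; move: (H * nbad) Y T; move=> *; lra.
  move: HsqrtT TX SX T0; move: (H * nbad) (H * Num.sqrt _) => x y; lra.
have hS1 : O * H ^+ 3 * i * S1 <= 1 / 2000 * (H * X).
  have -> : O * H ^+ 3 * i * S1 = H * (O * H ^+ 2 * (i * S1)) by ring.
  rewrite [leRHS]mulrCA ler_wpM2l ?(ltW H0) //.
  by move: S1Y T_large TX T0; move: (O * _ * _) Y T; move=> *; lra.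
have HX : 0 <= H * X by rewrite mulr_ge0 ?(ltW H0) // (le_trans (ltW T0)).
apply: le_trans Sv_le _; move: hSp hS1 HX.
by move: (O * _ * _ * _) (H * X) Sp; move=> *; lra.
Qed.

Hypothesis Sm_le : Sm <= 11 / 7 * SPm + 27 / 7 * (O * H ^+ 3 * i * S1).
Hypothesis SPm_le : SPm <= 11 / 7 * Sm' + 27 / 7 * (H ^+ 2 * i).
Hypothesis Sm'_le : Sm' <= H * O * (H ^+ 2 + 100 ^+ 2 * H ^+ 3 * O ^+ 2 * A * i ^+ 3).

(** [S1] is of order [O * A * i] and [Sm] of order [100 ^+ 2 * Z], and [O * A * i * Z = Y ^+ 2]; so
    the last bonus term, despite its large constant, contributes to the lower order only. *)
Let bonus_sum : Num.sqrt (8 * S1 * Sm) <= 467 * Y.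
Proof.
pose Z := H ^+ 4 * O ^+ 3 * A * i ^+ 3.
have Z0 : 0 < Z by rewrite !mulr_gt0 ?exprn_gt0.
have hSm' : Sm' <= (100 ^+ 2 + 1) * Z.
  apply: le_trans Sm'_le _; rewrite mulrDl mul1r mulrDr addrC; apply: lerD.
    by rewrite le_eqVlt; apply/orP; left; apply/eqP; rewrite /Z; ring.
  have -> : Z = H * O * H ^+ 2 * (H * O ^+ 2 * A * i ^+ 3) by rewrite /Z; ring.
  apply: le_mul1; first by rewrite !mulr_ge0 ?sqr_ge0 // ltW.
  by rewrite !mulr_ege1 ?exprn_ege1.
have hH : H ^+ 2 * i <= Z.
  have -> : Z = H ^+ 2 * i * (H ^+ 2 * O ^+ 3 * A * i ^+ 2) by rewrite /Z; ring.
  apply: le_mul1; first by rewrite !mulr_ge0 ?sqr_ge0 // ltW.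
  by rewrite !mulr_ege1 ?exprn_ege1.
have hS1 : O * H ^+ 3 * i * S1 <= 11 / 10 * Z.
  apply: le_trans (_ : _ <= O * H ^+ 3 * i * (11 / 10 * (O * A * i))) _.
    by rewrite ler_wpM2l // !mulr_ge0 ?exprn_ge0 // ltW.
  have -> : 11 / 10 * Z = O * H ^+ 3 * i * (11 / 10 * (O * A * i)) * (H * O * i) by rewrite /Z; ring.
  apply: le_mul1; first by rewrite !mulr_ge0 ?exprn_ge0 ?divr_ge0 // ltW.
  by rewrite !mulr_ege1.
have hSm : Sm <= 2471 / 10 * (100 * Z).
  move: Sm_le SPm_le hSm' hH hS1 Z0; lra.
have {}hSm : 8 * S1 * Sm <= (467 * Y) ^+ 2.
  apply: le_trans (_ : _ <= 8 * (11 / 10 * (O * A * i)) * (2471 / 10 * (100 * Z))) _.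
    apply: ler_pM => //; first by rewrite mulr_ge0.
    by rewrite ler_wpM2l.
  have -> : (467 * Y) ^+ 2 = (467 * 467) * (O * A * i * Z) by rewrite YE /Z; ring.
  have : 0 < O * A * i * Z by rewrite !mulr_gt0.
  have -> : 8 * (11 / 10 * (O * A * i)) * (2471 / 10 * (100 * Z)) =
     (88 * 2471) * (O * A * i * Z) by field.
  by move: (O * A * i * Z) => z z0; lra.
rewrite -[leRHS]ger0_norm ?mulr_ge0 ?ler0n ?(ltW Y0) // -sqrtr_sqr.
exact: ler_wsqrtr.
Qed.

Hypothesis S_le : S <= 11 / 2 * Num.sqrt (i * S1 * Sv) + 11 / 4 * Num.sqrt (i * S1 * T)
  + 26 * (O * H ^+ 2 * (i * S1)) + Num.sqrt (8 * S1 * Sm).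

Let S_le_X X : T <= X -> S <= X -> S <= 21 * (i * Num.sqrt (O * A * H * X)) + 500 * Y.
Proof.
move=> TX SX; set r := Num.sqrt (O * A * H * X).
have X0 : 0 < X by exact: lt_le_trans TX.
have b0 : 0 <= O * A * H * X by rewrite !mulr_ge0 // ltW.
have b1 : Num.sqrt (i * S1 * Sv) <= 63 / 20 * (i * r).
  rewrite -[leRHS]ger0_norm ?mulr_ge0 ?sqrtr_ge0 ?(ltW i0) // -sqrtr_sqr ler_wsqrtr //.
  rewrite !exprMn sqr_sqrtr //.
  apply: le_trans (_ : _ <= i * (11 / 10 * (O * A * i)) * (9 * (H * X))) _.
    apply: ler_pM => //; first by rewrite mulr_ge0 ?(ltW i0).
      by rewrite ler_wpM2l ?(ltW i0).
    exact: SvX.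
  have -> : i * (11 / 10 * (O * A * i)) * (9 * (H * X)) = 99 / 10 * (i ^+ 2 * (O * A * H * X)) by field.
  have : 0 <= i ^+ 2 * (O * A * H * X) by rewrite mulr_ge0 ?sqr_ge0.
  by move: (_ * _) => z z0; lra.
have b2 : Num.sqrt (i * S1 * T) <= 21 / 20 * (i * r).
  rewrite -[leRHS]ger0_norm ?mulr_ge0 ?sqrtr_ge0 ?(ltW i0) // -sqrtr_sqr ler_wsqrtr //.
  rewrite !exprMn sqr_sqrtr //.
  apply: le_trans (_ : _ <= i * (11 / 10 * (O * A * i)) * (H * X)) _.
    apply: ler_pM => //; [by rewrite mulr_ge0 ?(ltW i0) | exact: ltW | | ].
      by rewrite ler_wpM2l ?(ltW i0).
    by apply: le_trans TX _; rewrite ler_peMl // ltW.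
  have -> : i * (11 / 10 * (O * A * i)) * (H * X) = 11 / 10 * (i ^+ 2 * (O * A * H * X)) by field.
  have : 0 <= i ^+ 2 * (O * A * H * X) by rewrite mulr_ge0 ?sqr_ge0.
  by move: (_ * _) => z z0; lra.
have ir0 : 0 <= i * r by rewrite mulr_ge0 ?sqrtr_ge0 ?(ltW i0).
(* [11 / 2 * (63 / 20) + 11 / 4 * (21 / 20) <= 21] and [467 + 26 * (11 / 10) <= 500]. *)
apply: le_trans S_le _; move: bonus_sum S1Y b1 b2 (ltW Y0) ir0.
move: (Num.sqrt _) (Num.sqrt _) (Num.sqrt _) (O * H ^+ 2 * _) (i * r) Y => *; lra.
Qed.

(** If [S > T], the bound at [X = S] and AM-GM give [S <= 1441 * Y], which contradicts
    [2500 * Y <= T < S]. So [X = T], and 511 is 500 plus the 11 of [nbadH]. *)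
Lemma regret_sum_le :
  S + H * nbad <= 21 * (i * Num.sqrt (O * A * H * T)) + 511 * Y.
Proof.
have [ST|TS] := leP S T.
  have := S_le_X (lexx T) ST; move: nbadH.
  by move: (H * nbad) (i * Num.sqrt _) Y => *; lra.
exfalso; have := S_le_X (ltW TS) (lexx S).
set r := Num.sqrt _.
have r2 : r ^+ 2 = O * A * H * S by rewrite sqr_sqrtr // !mulr_ge0 // ltW.
have hr : 21 * (i * r) <= S / 2 + 441 / 2 * Y.
  have Spos : 0 < S by exact: lt_trans T0 TS.
  have e : i ^+ 2 * (O * A * H) <= Y.
    have -> : Y = i ^+ 2 * (O * A * H) * (H * O) by rewrite YE; ring.
    by apply: le_mul1; [rewrite !mulr_ge0 ?sqr_ge0 // ltW|rewrite mulr_ege1].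
  apply: le_trans (_ : _ <= S / 2 + 441 / 2 * (i ^+ 2 * (O * A * H))) _; last by lra.
  rewrite -(ler_pM2l Spos).
  have : 0 <= (S - 21 * (i * r)) ^+ 2 by exact: sqr_ge0.
  have : (i * r) ^+ 2 = S * (i ^+ 2 * (O * A * H)) by rewrite exprMn r2; ring.
  move: (i * r) (i ^+ 2 * _) => x y; nra.
by move: T_large TS hr Y0; move: (i * r) Y T S; move=> *; lra.
Qed.

End RegretArithmetic.

Section RegretBound.
Variables (R : realType) (Obs Act Qst : finType) (AP : Type).
Variable M : labeled_mdp R Obs Act Qst AP.
Local Notation state := (Qst * Obs)%type.
Local Notation L := (label M).
Local Notation rm := (machine M).
Local Notation H := (horizon M).
Local Notation Hr := (H%:R : R).
Variables (K : nat) (rho : R) (argmax : (Act -> R) -> Act).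
Variables (st : nat -> nat -> state) (ac : nat -> nat -> Act).
Implicit Types (q : Qst) (o : Obs) (a : Act) (s : state).

Local Notation iota := (log_factor Obs Act Qst H K rho).
Local Notation N k o a := (count2 H st ac k o a).
Local Notation ph k o a := (phat R H st ac k o a).
Local Notation V k h := (ucb_V rm L H K rho st ac k h).
Local Notation vterm k h := (visit_term Act H K rho st k h).
Local Notation pol k := (ucb_policy rm L H K rho st ac argmax k).
Local Notation O := (#|Obs|%:R : R).
Local Notation A := (#|Act|%:R : R).
Local Notation T := ((K * H)%:R : R).
Local Notation dsum := (episode_sum K H).
Local Notation noise := (martingale_diff M st ac).

(** The integrating factor of the recursion [gap_step]; it stays below [expR (4 / 5)], hence below
    [7 / 3]. *)
Definition weight (h : nat) : R := (1 + 4 / (5 * Hr)) ^+ h.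

(** The sign is negative because the exponent bounds the noise from above only, and the conditional
    mean of the gap must be bounded by its realised value. The maximum with 0 keeps the function
    bounded even where optimism fails: the supermartingale lives on all trajectories, not just on
    the good event. *)
Definition gap_family (k h : nat) (s' : state) : R :=
  - (weight h * Num.max (V k h.+1 s' - value M (pol k) h.+1 s') 0).

Definition square_family (k h : nat) (s' : state) : R := - (V k h.+1 s' ^+ 2).

Definition azuma_rate (B : R) : R := Num.sqrt (3 * iota / (2 * T)) / B.

Let H0 : 0 < Hr. Proof. by rewrite ltr0n horizon_gt0. Qed.
Let H1 : 1 <= Hr. Proof. by rewrite ler1n horizon_gt0. Qed.

Lemma weight_ge1 h : 1 <= weight h.
Proof. by rewrite exprn_ege1 // lerDl divr_ge0 // mulr_ge0. Qed.

Lemma weight_le h : (h <= H)%N -> weight h <= 7 / 3.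
Proof.
move=> hH; apply: (@le_trans _ _ (weight H)).
  by rewrite /weight ler_weXn2l // lerDl divr_ge0 // mulr_ge0.
apply: (@le_trans _ _ (expR (4 / 5))).
  have -> : 4 / 5 = H%:R * (4 / (5 * Hr)) :> R by field; rewrite gt_eqF.
  rewrite expRM_natl lerXn2r ?nnegrE ?expR_ge0 ?expR_ge1Dx //.
(* [(1 - 1 / 10) ^+ 8 <= expR (- (4 / 5))], and the left-hand side exceeds [3 / 7]. *)
have h8 : (9 / 10) ^+ 8 <= expR (- (4 / 5) : R).
  have -> : - (4 / 5) = - (1 / 10) * 8%:R :> R by lra.
  rewrite expRM_natr lerXn2r ?nnegrE ?expR_ge0 //.
  by have := expR_ge1Dx (- (1 / 10) : R); lra.
by rewrite -(opprK (4 / 5)) expRN -div1r ler_pdivrMr ?expR_gt0 //; lra.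
Qed.

Hypothesis argmaxP : forall (f : Act -> R) a, f a <= f (argmax f).
Hypothesis plays : forall k h, (0 < k <= K)%N -> (0 < h <= H)%N ->
  ac k h = pol k h (st k h).
Hypothesis HK : (H <= K)%N.
Hypothesis logK : 1 + ln K%:R <= iota.

Let K_gt0 : (0 < K)%N. Proof. exact: leq_trans (horizon_gt0 M) HK. Qed.

Let iota_ge1 : 1 <= iota.
Proof. by apply: le_trans logK; rewrite lerDl ln_ge0 // ler1n. Qed.

Let iota_gt0 : 0 < iota. Proof. exact: lt_le_trans ltr01 iota_ge1. Qed.

Let T_gt0 : 0 < T. Proof. by rewrite ltr0n muln_gt0 K_gt0 horizon_gt0. Qed.

Let ai : Act := ac 0 0.

Let nu k o a := (\sum_(1 <= h < H.+1) ((st k h).2 == o) && (ac k h == a))%N.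

Let nu_le k o a : (nu k o a <= H)%N.
Proof.
apply: (@leq_trans (\sum_(1 <= h < H.+1) 1)); last by rewrite sum_nat_const_nat muln1 subn1.
by apply: leq_sum => h _; exact: leq_b1.
Qed.

Let N1 o a : N 1 o a = 0%N. Proof. by rewrite count2E big_geq. Qed.

Let NS k o a : (0 < k)%N -> N k.+1 o a = (N k o a + nu k o a)%N.
Proof. by move=> k0; rewrite !count2E big_nat_recr. Qed.

Let sum_by_visits (g : nat -> Obs -> Act -> R) :
  dsum (fun k h => g k (st k h).2 (ac k h)) =
  \sum_o \sum_a \sum_(1 <= k < K.+1) (nu k o a)%:R * g k o a.
Proof.
rewrite /episode_sum; under [RHS]eq_bigr do rewrite exchange_big.
rewrite [RHS]exchange_big; apply: eq_bigr => k _ /=.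
under [RHS]eq_bigr do under eq_bigr do rewrite natr_sum mulr_suml.
under [RHS]eq_bigr do rewrite exchange_big.
rewrite [RHS]exchange_big; apply: eq_bigr => h _ /=.
rewrite (bigD1 (st k h).2) //= [X in _ + X]big1 ?addr0; last first.
  move=> o /negPf; rewrite eq_sym => ->; by rewrite big1 // => a _; rewrite mul0r.
rewrite (bigD1 (ac k h)) //= !eqxx mul1r big1 ?addr0 // => a /negPf.
by rewrite eq_sym => ->; rewrite mul0r.
Qed.

Let sum2_cst (c : R) : \sum_(o : Obs) \sum_(a : Act) c = O * A * c.
Proof.
rewrite (eq_bigr (fun=> A * c)); last by move=> o _; rewrite sumr_const [RHS]mulr_natl.
by rewrite sumr_const -mulrA [RHS]mulr_natl.
Qed.

Let inv_count k o a : R := if (10 * H <= N k o a)%N then (N k o a)%:R^-1 else 0.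

Let S1 := dsum (fun k h => inv_count k (st k h).2 (ac k h)).

(** The potential lemmas want the recursion from index 0 on. Episode 0 is junk and may contain
    visits although [N 1] is zero, so its values are replaced by 0. *)
Let n_seq o a j := if j is j'.+1 then N j o a else 0%N.
Let nu_seq o a j := if j is j'.+1 then nu j o a else 0%N.

Let n_seqS o a j : n_seq o a j.+1 = (n_seq o a j + nu_seq o a j)%N.
Proof. by case: j => [|j] /=; [exact: N1|exact: NS]. Qed.

Let nu_seq_le o a j : (nu_seq o a j <= H)%N.
Proof. by case: j => //= j; exact: nu_le. Qed.

Let S1_le : S1 <= 11 / 10 * (O * A * iota).
Proof.
rewrite /S1 (sum_by_visits inv_count).
apply: (@le_trans _ _ (\sum_(o : Obs) \sum_(a : Act) 11 / 10 * iota)); last first.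
  by rewrite sum2_cst le_eqVlt; apply/orP; left; apply/eqP; ring.
apply: ler_sum => o _; apply: ler_sum => a _.
have := @sum_visits_inv R H (n_seq o a) (nu_seq o a) (horizon_gt0 M) (N1 o a) (n_seqS o a) K.+1 (nu_seq_le o a).
rewrite (eq_big_nat _ _ (F2 := fun k => (nu k o a)%:R * inv_count k o a)); last first.
  by case.
move=> h; apply: le_trans h _; rewrite ler_wpM2l //.
apply: (@le_trans _ _ (ln K%:R)); last by move: logK; lra.
have H10 : 0 < (10 * H)%:R :> R by rewrite ltr0n muln_gt0 horizon_gt0.
rewrite ler_ln ?posrE ?divr_gt0 ?ltr0n ?leq_max ?muln_gt0 ?horizon_gt0 ?orbT //.
rewrite ler_pdivrMr // -natrM ler_nat geq_max /=.
apply/andP; split; last by rewrite leq_pmull.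
by apply: leq_trans (count2_le _ _ _ _ _ _) _; rewrite /= leq_mul2l leq_pmull ?orbT.
Qed.

Let nbad := dsum (fun k h => (N k (st k h).2 (ac k h) < 10 * H)%N%:R : R).

Let nbad_le : nbad <= 11 * Hr * O * A.
Proof.
rewrite /nbad (sum_by_visits (fun k o a => (N k o a < 10 * H)%N%:R)).
apply: (@le_trans _ _ (\sum_(o : Obs) \sum_(a : Act) 11 * Hr)); last first.
  by rewrite sum2_cst le_eqVlt; apply/orP; left; apply/eqP; ring.
apply: ler_sum => o _; apply: ler_sum => a _.
have := @sum_visits_few H (n_seq o a) (nu_seq o a) (horizon_gt0 M) (N1 o a) (n_seqS o a) K.+1 (nu_seq_le o a).
rewrite leq_min => /andP[_]; rewrite -(ler_nat R) natrM; apply: le_trans.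
rewrite natr_sum le_eqVlt; apply/orP; left; apply/eqP; apply: eq_big_nat.
by case=> // k _; rewrite -natrM.
Qed.

Let Sm' := dsum (fun k h => vterm k h.+1 (st k h.+1).2).

(** For a fixed step, an observation is visited at most once per episode, so its visit terms form a
    harmonic sum of at most [K] terms; [logK] turns [1 + ln K] into one more factor [iota]. *)
Let Sm'_le : Sm' <= Hr * O * (Hr ^+ 2 + 100 ^+ 2 * Hr ^+ 3 * O ^+ 2 * A * iota ^+ 3).
Proof.
rewrite /Sm' /episode_sum exchange_big /=.
apply: (@le_trans _ _ (\sum_(1 <= h < H.+1)
    O * (Hr ^+ 2 + 100 ^+ 2 * Hr ^+ 3 * O ^+ 2 * A * iota ^+ 3))); last first.
  by rewrite big_const_nat iter_addr_0 subn1 -[leRHS]mulrA [leRHS]mulr_natl.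
apply: ler_sum => h _.
apply: (@le_trans _ _ (\sum_(o : Obs) \sum_(1 <= k < K.+1)
    ((st k h.+1).2 == o)%:R * vterm k h.+1 o)).
  rewrite exchange_big; apply: ler_sum => k _.
  rewrite (bigD1 (st k h.+1).2) //= eqxx mul1r lerDl; apply: sumr_ge0 => o _.
  by rewrite mulr_ge0 //; have /andP[] := visit_term_itv M K rho st k h.+1 o.
rewrite mulr_natl -sumr_const; apply: ler_sum => o _.
pose B := 100 ^+ 2 * Hr ^+ 3 * O ^+ 2 * A * iota ^+ 2.
have B0 : 0 <= B by rewrite !mulr_ge0 ?exprn_ge0 ?ler0n ?(ltW iota_gt0).
pose n j := if j is j'.+1 then count_visit st j h.+1 o else 0%N.
pose v j := if j is j'.+1 then ((st j h.+1).2 == o : nat) else 0%N.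
have n1 : n 1%N = 0%N by rewrite /n /count_visit big_geq.
have nS j : n j.+1 = (n j + v j)%N.
  by case: j => [|j] //; rewrite /n /v /count_visit big_nat_recr.
pose g i := if i == 0%N then Hr ^+ 2 else Num.min (B / i%:R) (Hr ^+ 2).
have := @sum_visits_harmonic R H n v (horizon_gt0 M) n1 nS (Hr ^+ 2) B g K.
rewrite (eq_big_nat _ _ (F2 := fun k => ((st k h.+1).2 == o)%:R * vterm k h.+1 o)); last first.
  by case.
move=> hs; apply: le_trans (hs _ _ _ _ _) _ => //.
- by case=> //= j; exact: leq_b1.
- by move=> i i0; rewrite /g gtn_eqF // ge_min lexx.
have nK : (n K.+1 <= K)%N.
  apply: (@leq_trans (\sum_(1 <= j < K.+1) 1)); last by rewrite sum_nat_const_nat muln1 subn1.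
  by apply: leq_sum => j _; exact: leq_b1.
have BB : 100 ^+ 2 * Hr ^+ 3 * O ^+ 2 * A * iota ^+ 3 = B * iota by rewrite /B; ring.
rewrite BB; case: eqP => [_|/eqP n0]; first by rewrite addr_ge0 ?sqr_ge0 ?mulr_ge0 // ltW.
rewrite lerD2l ler_wpM2l //; apply: le_trans logK.
have nR : 0 < (n K.+1)%:R :> R by rewrite ltr0n lt0n.
have lnK : ln (n K.+1)%:R <= ln K%:R :> R.
  by rewrite ler_ln ?ler_nat // posrE ltr0n.
have ninv : 0 <= (n K.+1)%:R^-1 :> R by rewrite invr_ge0 ltW.
by move: lnK ninv; move: (ln _) (ln _) (_^-1) => x y z; lra.
Qed.

Hypothesis T_large : 2500 * (Hr ^+ 2 * O ^+ 2 * A * iota ^+ 2) <= T.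

Hypothesis opt_return_event : forall (b : bool) q o a h j k,
  (0 < h <= H)%N -> (j < K)%N -> (0 < k <= K)%N ->
  sn_exponent M st ac (at_visits st ac o a
    (fun o' => (-1) ^+ b * (1 / 3 * 2 ^- j / Hr) * opt_return M h q o a o')) k <= iota.
Hypothesis phat_event : forall o a o1 k, (0 < k <= K)%N ->
  sn_exponent M st ac (at_visits st ac o a
    (fun o' => 1 / (3 * Hr) * (o' == o1)%:R)) k <= iota.
Hypothesis gap_event :
  sn_exponent M st ac (fun k h s' => azuma_rate (7 / 3 * Hr) * gap_family k h s') K.+1 <= iota.
Hypothesis square_event :
  sn_exponent M st ac (fun k h s' => azuma_rate (Hr ^+ 2) * square_family k h s') K.+1 <= iota.
Hypothesis visit_event :
  sn_exponent M st ac (fun k h s' => - (1 / (3 * Hr ^+ 2)) * vterm k h.+1 s'.2) K.+1 <= iota.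

Let good k h := (10 * H <= N k (st k h).2 (ac k h))%N.
Let Wk k h := W rm L (V k h.+1) (st k h).1 (st k h).2 (ac k h).
Let tr k h := trans M (st k h).2 (ac k h).
Let emp k h := ph k (st k h).2 (ac k h).
Let bad k h : R := (~~ good k h)%:R.
Let be k h : R := if good k h then beta M K rho st ac k h (st k h) (ac k h) else 0.

Let trp k h : is_pmf (tr k h). Proof. exact: trans_pmf. Qed.

Let good_gt0 k h : good k h -> (0 < N k (st k h).2 (ac k h))%N.
Proof. by apply: leq_trans; rewrite muln_gt0 horizon_gt0. Qed.

Let V_itv k h s : 0 <= V k h s <= Hr.
Proof. by apply: ucb_V_itv. Qed.

Let opt_le_V k h s : (0 < k <= K)%N -> (0 < h <= H.+1)%N -> opt_value M h s <= V k h s.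
Proof.
by move=> /andP[k0 kK]; apply: (ucb_optimism ai iota_ge1 HK opt_return_event kK).2.
Qed.

Let value_le_V k h s : (0 < k <= K)%N -> (0 < h <= H.+1)%N ->
  value M (pol k) h s <= V k h s.
Proof.
move=> kK hH; apply: le_trans (opt_le_V s kK hH).
by apply: value_le_opt => //; case/andP: hH.
Qed.

Let V_played k h : (0 < k <= K)%N -> (0 < h <= H)%N ->
  V k h (st k h) = ucb_Q rm L H K rho st ac k h (st k h) (ac k h).
Proof.
move=> kK hH; rewrite plays // ucb_VE //; last by case/andP: kK.
exact: max_act_argmax (argmaxP _).
Qed.

Let PV k h := avg (tr k h) (Wk k h).

Let PV_itv k h : 0 <= PV k h <= Hr.
Proof.
rewrite /PV avg_ge0 ?avg_le // => o'; rewrite /Wk.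
  by apply: W_le => s'; case/andP: (V_itv k h.+1 s').
by apply: W_ge0 => s'; case/andP: (V_itv k h.+1 s').
Qed.

Let be_ge0 k h : 0 <= be k h.
Proof.
rewrite /be; case: ifP => // _.
by rewrite !addr_ge0 // ?mulr_ge0 ?sqrtr_ge0 ?sqr_ge0 ?ler0n.
Qed.

Let Popt k h := avg (tr k h) (W rm L (opt_value M h.+1) (st k h).1 (st k h).2 (ac k h)).
Let Prbar k h := avg (tr k h) (rbar M (st k h).1 (st k h).2 (ac k h)).

Let Prbar_le1 k h : 0 <= Prbar k h <= 1.
Proof.
rewrite /Prbar avg_ge0 ?avg_le // => o'; first by have /andP[] := rbar_itv M (st k h).1 (st k h).2 (ac k h) o'.
by have /andP[] := rbar_itv M (st k h).1 (st k h).2 (ac k h) o'.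
Qed.

Let V_step k h : (0 < k <= K)%N -> (0 < h <= H)%N -> good k h ->
  V k h (st k h) <= Prbar k h + PV k h + 4 / (5 * Hr) * (PV k h - Popt k h) + be k h.
Proof.
move=> kK hH gd; rewrite V_played // /be gd.
exact: (ucb_Q_le ai iota_ge1 HK opt_return_event phat_event kK hH (good_gt0 gd)).
Qed.

Let Popt_ge0 k h : (h <= H)%N -> 0 <= Popt k h.
Proof.
move=> hH; apply: avg_ge0 => // o'; apply: W_ge0 => s'.
by have /andP[] := opt_value_itv ai s' (h := h.+1) hH.
Qed.

(** [9 / 5] is 1 for the reward plus [4 / 5] for the excess [4 / (5 * H)] times a gap of at most
    [H]. A step with too few samples is charged [H]. *)
Let V_drop k h : (0 < k <= K)%N -> (0 < h <= H)%N ->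
  V k h (st k h) - PV k h <= 9 / 5 + be k h + Hr * bad k h.
Proof.
move=> kK hH; have /andP[p0 p1] := PV_itv k h; have b0 := be_ge0 k h.
rewrite /bad; case: (boolP (good k h)) => gd /=; last first.
  rewrite mulr1; have /andP[_] := V_itv k h (st k h); lra.
have := V_step kK hH gd; have /andP[_ r1] := Prbar_le1 k h.
have : 4 / (5 * Hr) * (PV k h - Popt k h) <= 4 / (5 * Hr) * Hr.
  rewrite ler_wpM2l ?divr_ge0 ?mulr_ge0 //.
  by have := @Popt_ge0 k h (andP hH).2; lra.
have -> : 4 / (5 * Hr) * Hr = 4 / 5 by field; rewrite gt_eqF.
rewrite mulr0; lra.
Qed.

Let gap k h s' := Num.max (V k h.+1 s' - value M (pol k) h.+1 s') 0.
Let Pgap k h := \sum_s' mdp_trans M (st k h) (ac k h) s' * gap k h s'.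

Let gap_itv k h s' : (h <= H)%N -> 0 <= gap k h s' <= Hr.
Proof.
move=> hH; rewrite /gap le_max lexx orbT /= ge_max (ltW H0) andbT.
have /andP[_ v1] := V_itv k h.+1 s'; have /andP[v0 _] := value_itv (pol k) s' (h := h.+1) hH.
by move: v0 v1; lra.
Qed.

(** The value of [pi_k] is below the optimal one, so the excess over the optimum in [V_step] is at
    most the excess over [pi_k]; both occurrences of the gap merge into one factor. *)
Let gap_step k h : (0 < k <= K)%N -> (0 < h <= H)%N ->
  V k h (st k h) - value M (pol k) h (st k h) <=
  (1 + 4 / (5 * Hr)) * Pgap k h + (be k h + Hr * bad k h).
Proof.
move=> kK hH; have /andP[h0 hH'] := hH; have b0 := be_ge0 k h.
have r0 : 0 <= 4 / (5 * Hr) by rewrite divr_ge0 // mulr_ge0.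
have PgapE : Pgap k h = PV k h
    - avg (tr k h) (W rm L (value M (pol k) h.+1) (st k h).1 (st k h).2 (ac k h)).
  rewrite /Pgap mdp_transE -avgB; apply: eq_avg => o'; rewrite -WB !WE.
  apply: eq_avg => q'; rewrite /gap max_l // subr_ge0; exact: value_le_V.
have Pgap0 : 0 <= Pgap k h.
  apply: sumr_ge0 => s' _; have /andP[g0 _] := gap_itv k s' hH'.
  by rewrite mulr_ge0 //; case: (mdp_trans_pmf M (st k h) (ac k h)).
rewrite /bad; case: (boolP (good k h)) => gd /=; last first.
  have /andP[_] := V_itv k h (st k h).
  have /andP[v0 _] := value_itv (pol k) (st k h) (leqW hH').
  have : 0 <= (1 + 4 / (5 * Hr)) * Pgap k h by rewrite mulr_ge0 // addr_ge0.
  by move: v0; rewrite mulr1; lra.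
have := V_step kK hH gd.
rewrite (valueS (pol k) (st k h) hH') -plays // avgD.
rewrite -/(Prbar k h) -/(tr k h).
set x := avg (tr k h) (W rm L (value _ _ _) _ _ _) in PgapE *.
have : x <= Popt k h.
  apply: le_avg => // o'; apply: le_W => s'; exact: value_le_opt.
have -> : x = PV k h - Pgap k h by rewrite PgapE; lra.
move=> hx hV.
have : 4 / (5 * Hr) * (PV k h - Popt k h) <= 4 / (5 * Hr) * Pgap k h.
  by rewrite ler_wpM2l //; lra.
by move: hV; rewrite mulr0; lra.
Qed.

Let inv k h := inv_count k (st k h).2 (ac k h).
Let Pv k h := avg (tr k h) (fun o' => vterm k h.+1 o').
Let gvh k h : R := if good k h then variance_of (emp k h) (Wk k h) else 0.
Let gvm k h : R := if good k h then avg (emp k h) (fun o' => vterm k h.+1 o') else 0.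
Let vp k h := variance_of (tr k h) (Wk k h).

Let emp_pmf k h : good k h -> is_pmf (emp k h).
Proof. by move=> gd; apply: phat_pmf; exact: good_gt0. Qed.

Let inv_ge0 k h : 0 <= inv k h.
Proof. by rewrite /inv /inv_count; case: ifP => // _; rewrite invr_ge0. Qed.

Let vterm_itv k h o : 0 <= vterm k h o <= Hr ^+ 2.
Proof. exact: visit_term_itv. Qed.

Let Pv_ge0 k h : 0 <= Pv k h.
Proof. by apply: avg_ge0 => // o'; case/andP: (vterm_itv k h.+1 o'). Qed.

Let gvm_ge0 k h : 0 <= gvm k h.
Proof.
rewrite /gvm; case: ifP => // gd; apply: avg_ge0; first exact: emp_pmf.
by move=> o'; case/andP: (vterm_itv k h.+1 o').
Qed.

Let gvh_ge0 k h : 0 <= gvh k h.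
Proof. by rewrite /gvh; case: ifP => // gd; apply: variance_of_ge0; exact: emp_pmf. Qed.

(** The shape required by Cauchy-Schwarz over all steps. It also holds at steps with too few
    samples, since [inv] is 0 there. *)
Let beE k h : be k h =
  11 / 2 * (Num.sqrt (iota * inv k h) * Num.sqrt (gvh k h))
  + 11 / 4 * (Num.sqrt (iota * inv k h) * Num.sqrt 1)
  + 26 * (O * Hr ^+ 2 * (iota * inv k h))
  + Num.sqrt (8 * inv k h) * Num.sqrt (gvm k h).
Proof.
rewrite /be /gvh /gvm /inv /inv_count -/(good k h); case: (good k h); last first.
  by rewrite !mulr0 sqrtr0 !mul0r !mulr0 !addr0.
rewrite /beta /visit_bonus sqrtr1 mulr1.
rewrite sqr_sqrtr ?divr_ge0 ?(ltW iota_gt0) //; congr (_ + _).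
rewrite -sqrtrM ?mulr_ge0 ?invr_ge0 //; congr (Num.sqrt _); exact: mulrAC.
Qed.

Let S := dsum be.
Let Sv := dsum gvh.
Let Sp := dsum vp.
Let Sm := dsum gvm.
Let SPm := dsum Pv.

Let S_le : S <= 11 / 2 * Num.sqrt (iota * S1 * Sv) + 11 / 4 * Num.sqrt (iota * S1 * T)
  + 26 * (O * Hr ^+ 2 * (iota * S1)) + Num.sqrt (8 * S1 * Sm).
Proof.
have iinv0 k h : 0 <= iota * inv k h by rewrite mulr_ge0 // ltW.
rewrite /S (eq_dsum (fun k h _ _ => beE k h)) !dsumD !dsumZ.
have e1 c : c * S1 = dsum (fun k h => c * inv k h) by rewrite dsumZ.
apply: lerD; [apply: lerD; [apply: lerD|]|].
- rewrite ler_wpM2l // e1; exact: dsum_sqrtM_le.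
- rewrite ler_wpM2l // e1 -(mulr1 T) -dsum_cst; exact: dsum_sqrtM_le.
- by rewrite -dsumZ.
- rewrite e1; apply: dsum_sqrtM_le => // k h _ _; by rewrite mulr_ge0.
Qed.

Let emp_avg_le k h X : good k h -> (0 < k <= K)%N -> (forall o', 0 <= X o' <= Hr ^+ 2) ->
  avg (emp k h) X <= 11 / 7 * avg (tr k h) X + 27 / 7 * (O * Hr ^+ 3 * iota * inv k h).
Proof.
move=> gd kK X0; have n0 := good_gt0 gd.
apply: le_trans (phat_avg_le iota_ge1 phat_event kK n0 X0) _; apply: lerD.
  rewrite ler_wpM2r //; first by apply: (avg_ge0 (trp k h)) => o'; case/andP: (X0 o').
  have : 4 / (7 * Hr) <= 4 / 7.
    by rewrite ler_pM2l // lef_pV2 ?posrE ?mulr_gt0 // ler_peMr.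
  lra.
rewrite sqr_sqrtr ?divr_ge0 ?(ltW iota_gt0) // /inv /inv_count.
rewrite -/(good k h) gd le_eqVlt; apply/orP; left; apply/eqP; ring.
Qed.

Let Sm_le : Sm <= 11 / 7 * SPm + 27 / 7 * (O * Hr ^+ 3 * iota * S1).
Proof.
rewrite /Sm /SPm /S1 -!dsumZ -dsumD; apply: le_dsum => k h kK hH.
rewrite /gvm; case: ifP => gd; first exact: emp_avg_le.
by rewrite addr_ge0 ?mulr_ge0 ?exprn_ge0 ?ler0n ?Pv_ge0 ?inv_ge0 // ltW.
Qed.

Let vp_ge0 k h : 0 <= vp k h. Proof. exact: variance_of_ge0. Qed.

Let Sv_le : Sv <= 11 / 7 * Sp + 27 / 7 * (O * Hr ^+ 3 * iota * S1).
Proof.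
rewrite /Sv /Sp /S1 -!dsumZ -dsumD; apply: le_dsum => k h kK hH.
rewrite /gvh; case: ifP => gd; last first.
  by rewrite addr_ge0 ?mulr_ge0 ?exprn_ge0 ?ler0n ?vp_ge0 ?inv_ge0 // ltW.
(* Centring at the true mean instead of the empirical one makes the right-hand side an average under
   [phat] of a bounded nonnegative function; moved to the true kernel it is exactly [vp]. *)
apply: le_trans (variance_le_dev (emp_pmf gd) _ (PV k h)) _.
apply: emp_avg_le => // o'; rewrite sqr_ge0 /=.
have /andP[p0 p1] := PV_itv k h.
have w1 : Wk k h o' <= Hr by apply: W_le => s'; case/andP: (V_itv k h.+1 s').
have w0 : 0 <= Wk k h o' by apply: W_ge0 => s'; case/andP: (V_itv k h.+1 s').
rewrite -[X in X <= _]real_normK ?num_real // lerXn2r ?nnegrE ?(ltW H0) //.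
by rewrite ler_norml; lra.
Qed.

Let SPm_le : SPm <= 11 / 7 * Sm' + 27 / 7 * (Hr ^+ 2 * iota).
Proof.
have C0 : 0 < Hr ^+ 2 by rewrite exprn_gt0.
have := dsum_pred_le C0 (fun k h (s : state) => vterm_itv k h.+1 s.2) visit_event.
rewrite (eq_dsum (f := fun k h => \sum_s' _) (g := Pv)) // => k h _ _.
rewrite mdp_transE; apply: eq_avg => o'; rewrite WE (eq_avg _ (Y := fun=> vterm k h.+1 o')) //.
by rewrite avg_cst //; exact: tau_pmf.
Qed.

Let sum_square_le k : (0 < k <= K)%N ->
  \sum_(1 <= h < H.+1) (V k h.+1 (st k h.+1) ^+ 2 - V k h (st k h) ^+ 2) <= 0.
Proof.
move=> kK; rewrite (telescope_sumr (fun h => V k h (st k h) ^+ 2)) //.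
by rewrite ucb_V_last expr0n sub0r oppr_le0 sqr_ge0.
Qed.

Let sqd k h := V k h.+1 (st k h.+1) ^+ 2 - V k h (st k h) ^+ 2.

(** The variance is at most the conditional mean of [V_{h+1} ^+ 2] minus [PV ^+ 2]. Its first part
    is noise plus the realised square; what then remains beyond the telescoping [sqd] is
    [V_h ^+ 2 - PV ^+ 2], which is at most [2 * H] times the bound of [V_drop]. *)
Let vp_le k h : (0 < k <= K)%N -> (0 < h <= H)%N ->
  vp k h <= noise square_family k h + sqd k h
    + 2 * Hr * (9 / 5 + be k h + Hr * bad k h).
Proof.
move=> kK hH; rewrite /sqd /martingale_diff /square_family.
rewrite (eq_bigr (fun s' => - (mdp_trans M (st k h) (ac k h) s' * V k h.+1 s' ^+ 2))); last first.
  by move=> s' _; rewrite mulrN.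
rewrite sumrN opprK mdp_transE /vp variance_ofE // -/(PV k h).
have : avg (tr k h) (fun o' => Wk k h o' ^+ 2) <=
    avg (tr k h) (W rm L (fun s => V k h.+1 s ^+ 2) (st k h).1 (st k h).2 (ac k h)).
  by apply: le_avg => // o'; exact: W_sqr_le.
rewrite -/(tr k h); set x := avg _ _; set y := avg _ _ => xy.
have g0 : 0 <= 9 / 5 + be k h + Hr * bad k h.
  by rewrite !addr_ge0 ?mulr_ge0 ?be_ge0 ?ler0n.
have := V_drop kK hH; move: g0; set G := 9 / 5 + _ + _ => g0.
have /andP[v0 v1] := V_itv k h (st k h); have /andP[p0 p1] := PV_itv k h.
move: v0 v1 p0 p1; set v := V k h (st k h); set P := PV k h => v0 v1 p0 p1 drop.
have : v ^+ 2 - P ^+ 2 <= 2 * Hr * G.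
  apply: le_trans (_ : _ <= G * (v + P)) _.
    by rewrite subr_sqr ler_wpM2r // addr_ge0.
  by rewrite mulrC ler_wpM2r //; lra.
by move: xy; lra.
Qed.

Let Sp_le : Sp <= 2 * Hr * (9 / 5 * T + S + Hr * nbad)
  + 49 / 30 * Hr ^+ 2 * Num.sqrt (T * iota).
Proof.
have B0 : 0 < Hr ^+ 2 by rewrite exprn_gt0.
have h1 : dsum (noise square_family) <= 49 / 30 * Hr ^+ 2 * Num.sqrt (T * iota).
  apply: dsum_noise_le => // k h kK hH; apply: noise_norm_le => s s'.
  rewrite /square_family -opprD normrN.
  have /andP[? ?] := V_itv k h.+1 s; have /andP[? ?] := V_itv k h.+1 s'.
  have sq x : 0 <= x -> x <= Hr -> 0 <= x ^+ 2 <= Hr ^+ 2.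
    by move=> x0 x1; rewrite sqr_ge0 lerXn2r ?nnegrE ?(ltW H0).
  have /andP[a0 a1] : 0 <= V k h.+1 s ^+ 2 <= Hr ^+ 2 by exact: sq.
  have /andP[b0 b1] : 0 <= V k h.+1 s' ^+ 2 <= Hr ^+ 2 by exact: sq.
  by rewrite ler_norml; lra.
have h2 : dsum sqd <= 0.
  rewrite /episode_sum big_nat; apply: sumr_le0 => k kK; exact: sum_square_le.
have : Sp <= dsum (fun k h => noise square_family k h + sqd k h
    + 2 * Hr * (9 / 5 + be k h + Hr * bad k h)) by apply: le_dsum; exact: vp_le.
rewrite (dsumD _ _ (fun k h => noise square_family k h + sqd k h)).
rewrite (dsumD _ _ (noise square_family) sqd) dsumZ.
rewrite (dsumD _ _ (fun k h => 9 / 5 + be k h)) (dsumD _ _ (fun _ _ => 9 / 5) be).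
rewrite dsumZ dsum_cst -/S.
have -> : dsum bad = nbad.
  by apply: eq_dsum => k h _ _; rewrite /bad /good -ltnNge.
set X := dsum (noise square_family) in h1 *.
by move: h1 h2; set Z := dsum sqd => h1 h2; rewrite (mulrC T); lra.
Qed.

Let gap_telescope k : (0 < k <= K)%N ->
  V k 1 (st k 1%N) - value M (pol k) 1 (st k 1%N) <=
  \sum_(1 <= h < H.+1) (noise gap_family k h + 7 / 3 * (be k h + Hr * bad k h)).
Proof.
move=> kK; pose D h := V k h (st k h) - value M (pol k) h (st k h).
have step h : (0 < h < H.+1)%N -> - (weight h * D h.+1 - weight h.-1 * D h) <=
    noise gap_family k h + 7 / 3 * (be k h + Hr * bad k h).
  move=> hH; have /andP[h0 hH'] := hH.
  have b0 : 0 <= be k h + Hr * bad k h by rewrite addr_ge0 ?be_ge0 ?mulr_ge0 ?ler0n.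
  have gE : noise gap_family k h = weight h * Pgap k h - weight h * D h.+1.
    rewrite /martingale_diff /gap_family -/(gap k h _).
    rewrite (eq_bigr (fun s' => - weight h * (mdp_trans M (st k h) (ac k h) s' * gap k h s'))); last first.
      by move=> s' _; rewrite /gap; ring.
    rewrite -mulr_sumr -/(Pgap k h).
    have -> : gap k h (st k h.+1) = D h.+1.
      by rewrite /gap max_l // subr_ge0; exact: value_le_V.
    by ring.
  have w0 : 0 <= weight h.-1 by apply: le_trans (weight_ge1 _).
  have := ler_wpM2l w0 (gap_step kK hH).
  rewrite [leRHS]mulrDr [X in _ <= X + _]mulrA -exprSr prednK // -/(weight h) -/(D h).
  have : weight h.-1 * (be k h + Hr * bad k h) <= 7 / 3 * (be k h + Hr * bad k h).
    by rewrite ler_wpM2r // weight_le // (leq_trans (leq_pred _)).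
  by rewrite gE; lra.
apply: le_trans (ler_sum_nat step); rewrite sumrN.
rewrite (telescope_sumr (fun h => weight h.-1 * D h)) //.
have -> : D H.+1 = 0 by rewrite /D ucb_V_last value_last subrr.
by rewrite mulr0 sub0r opprK /weight expr0 mul1r.
Qed.

Lemma regret_bound :
  regret M K (fun k => st k 1%N) (fun k => pol k) <=
  7 / 3 * (21 * (iota * Num.sqrt (O * A * Hr * T))
           + 511 * (Hr ^+ 2 * O ^+ 2 * A * iota ^+ 2))
  + 49 / 30 * (7 / 3 * Hr) * Num.sqrt (T * iota).
Proof.
have B0 : 0 < 7 / 3 * Hr by rewrite mulr_gt0.
have h1 : dsum (noise gap_family) <= 49 / 30 * (7 / 3 * Hr) * Num.sqrt (T * iota).
  apply: dsum_noise_le => // k h kK /andP[h0 hH]; apply: noise_norm_le => s s'.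
  rewrite /gap_family -!/(gap k h _) -opprD normrN.
  have /andP[? ?] := gap_itv k s hH; have /andP[? ?] := gap_itv k s' hH.
  rewrite -mulrBr normrM ler_pM //.
    rewrite ger0_norm ?weight_le //; exact: le_trans ler01 (weight_ge1 _).
  by rewrite ler_norml; lra.
have h2 : regret M K (fun k => st k 1%N) (fun k => pol k) <=
    dsum (noise gap_family) + 7 / 3 * (S + Hr * nbad).
  apply: (@le_trans _ _ (\sum_(1 <= k < K.+1)
      (V k 1 (st k 1%N) - value M (pol k) 1 (st k 1%N)))).
    by apply: ler_sum_nat => k kK; rewrite lerB // opt_le_V.
  apply: (@le_trans _ _ (dsum (fun k h => noise gap_family k h
      + 7 / 3 * (be k h + Hr * bad k h)))).
    by apply: ler_sum_nat => k kK; exact: gap_telescope.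
  have -> : nbad = dsum bad.
    by apply: eq_dsum => k h _ _; rewrite /bad /good -ltnNge.
  rewrite (dsumD _ _ (noise gap_family)) dsumZ (dsumD _ _ be) dsumZ.
  exact: lexx.
have h3 : S + Hr * nbad <= 21 * (iota * Num.sqrt (O * A * Hr * T))
    + 511 * (Hr ^+ 2 * O ^+ 2 * A * iota ^+ 2).
  apply: (@regret_sum_le R T Hr O A iota S S1 Sv Sp Sm SPm Sm' nbad _) => //.
  - by rewrite ler1n; apply/card_gt0P; exists (st 0 0).2.
  - by rewrite ler1n; apply/card_gt0P; exists ai.
  - by apply: dsum_ge0 => k h _ _; exact: be_ge0.
  - by apply: dsum_ge0 => k h _ _; exact: inv_ge0.
  - by apply: dsum_ge0 => k h _ _; exact: gvh_ge0.
  - by apply: dsum_ge0 => k h _ _; exact: gvm_ge0.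
apply: le_trans h2 _; rewrite addrC; apply: lerD => //.
by rewrite ler_wpM2l.
Qed.

End RegretBound.

(** * The law of the interaction *)

Section Extensionality.
Variables (R : realType) (Obs Act Qst : finType) (AP : Type).
Variable M : labeled_mdp R Obs Act Qst AP.
Local Notation state := (Qst * Obs)%type.
Local Notation L := (label M).
Local Notation rm := (machine M).
Local Notation H := (horizon M).
Variables (K : nat) (rho : R) (argmax : (Act -> R) -> Act).
Implicit Types (x : nat -> nat -> state) (y : nat -> nat -> Act).

Definition same_past x x' (k : nat) :=
  forall j i, (0 < j < k)%N -> (0 < i <= H.+1)%N -> x j i = x' j i.

Definition same_past_actions y y' (k : nat) :=
  forall j i, (0 < j < k)%N -> (0 < i <= H)%N -> y j i = y' j i.

Lemma same_past_le x x' k k' : (k' <= k)%N -> same_past x x' k -> same_past x x' k'.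
Proof.
move=> kk h j i /andP[j0 jk] iH; apply: h => //.
by rewrite j0 (leq_trans jk).
Qed.

Lemma same_past_actions_le y y' k k' : (k' <= k)%N ->
  same_past_actions y y' k -> same_past_actions y y' k'.
Proof.
move=> kk h j i /andP[j0 jk] iH; apply: h => //.
by rewrite j0 (leq_trans jk).
Qed.

Section SamePast.
Variables (x x' : nat -> nat -> state) (y y' : nat -> nat -> Act) (k : nat).
Hypotheses (xx : same_past x x' k) (yy : same_past_actions y y' k).

Lemma eq_count3 o a o' : count3 H x y k o a o' = count3 H x' y' k o a o'.
Proof.
rewrite /count3; apply: eq_big_nat => j jk; apply: eq_big_nat => h /andP[h0 hH].
by rewrite !xx ?yy // ?h0 ?(ltnW hH) //= ?ltnS.
Qed.

Lemma eq_count2 o a : count2 H x y k o a = count2 H x' y' k o a.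
Proof. by apply: eq_bigr => o' _; exact: eq_count3. Qed.

Lemma eq_count_visit h o : (0 < h <= H.+1)%N -> count_visit x k h o = count_visit x' k h o.
Proof. by move=> hH; apply: eq_big_nat => j jk; rewrite xx. Qed.

Lemma eq_phat o a : phat R H x y k o a = phat R H x' y' k o a.
Proof. by apply/funext => o'; rewrite /phat eq_count3 eq_count2. Qed.

(** [h <= H] keeps the step [h.+1] read by the visit counts among the recorded steps. *)
Lemma eq_Q_update Qprev Qprev' h V : (h <= H)%N -> Qprev = Qprev' ->
  Q_update rm L H K rho x y Qprev k h V = Q_update rm L H K rho x' y' Qprev' k h V.
Proof.
move=> hH <-; apply/funext => -[q o]; apply/funext => a; rewrite /Q_update /= eq_count2.
case: eqP => // _; congr (Num.min _ (Num.min _ (_ + _ + _))).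
- by apply: eq_bigr => s' _; rewrite /cross_trans eq_phat.
- by apply: eq_bigr => s' _; rewrite /cross_trans eq_phat.
rewrite /bonus eq_phat; congr (_ + Num.sqrt (8 * _ / _)).
by apply: eq_bigr => o' _; rewrite /visit_term eq_count_visit.
Qed.

Lemma eq_V_back Qprev Qprev' n : (forall h, (h <= H)%N -> Qprev h = Qprev' h) ->
  V_back rm L H K rho x y Qprev k n = V_back rm L H K rho x' y' Qprev' k n.
Proof.
move=> QQ; elim: n => [//|n IH]; apply/funext => s; rewrite /V_back -!/(V_back _ _ _ _ _ _ _ _ _ _).
by rewrite IH (eq_Q_update _ (leq_subr n H) (QQ _ (leq_subr n H))).
Qed.

End SamePast.

Lemma eq_ucb_Q x x' y y' k h : same_past x x' k -> same_past_actions y y' k ->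
  (h <= H)%N -> ucb_Q rm L H K rho x y k h = ucb_Q rm L H K rho x' y' k h.
Proof.
elim: k h => [//|k IH] h xx yy hH; rewrite /ucb_Q -!/(ucb_Q _ _ _ _ _ _ _ _).
have IHk h' : (h' <= H)%N -> ucb_Q rm L H K rho x y k h' = ucb_Q rm L H K rho x' y' k h'.
  by apply: IH; [exact: same_past_le xx|exact: same_past_actions_le yy].
by rewrite (eq_V_back xx yy _ IHk) (eq_Q_update xx yy _ hH (IHk h hH)).
Qed.

Lemma eq_ucb_V x x' y y' k h : (0 < k)%N -> same_past x x' k -> same_past_actions y y' k ->
  ucb_V rm L H K rho x y k h = ucb_V rm L H K rho x' y' k h.
Proof.
case: k => [//|k] _ xx yy; apply: (eq_V_back xx yy) => h' hH.
apply: eq_ucb_Q => //; [exact: same_past_le xx|exact: same_past_actions_le yy].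
Qed.

(* The actions of UCBVI-PRM as a function of the states only; [played_upto x n]
   is meaningful for the episodes up to [n]. *)
Fixpoint played_upto x (n : nat) : nat -> nat -> Act :=
  if n is n'.+1 then fun k h =>
    if (k <= n')%N then played_upto x n' k h
    else argmax (ucb_Q rm L H K rho x (played_upto x n') k h (x k h))
  else fun _ _ => argmax (fun=> 0).

Definition played x (k h : nat) : Act := played_upto x k k h.

Lemma played_uptoE x n k h : (k <= n)%N -> played_upto x n k h = played x k h.
Proof.
elim: n => [|n IH] kn; first by move: kn; rewrite leqn0 => /eqP ->.
have [{}kn|nk] := leqP k n; first by rewrite /= kn IH.
by have -> : k = n.+1 by apply/eqP; rewrite eqn_leq kn.
Qed.

Lemma playedE x k h : (0 < k)%N -> (h <= H)%N ->
  played x k h = ucb_policy rm L H K rho x (played x) argmax k h (x k h).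
Proof.
case: k => [//|k] _ hH; rewrite {1}/played; cbn [played_upto]; rewrite ltnn /ucb_policy.
rewrite (@eq_ucb_Q x x (played_upto x k) (played x)) // => j i /andP[_ jk] _.
exact: played_uptoE.
Qed.

Lemma eq_played x x' k h : (h <= H)%N -> same_past x x' k -> x k h = x' k h ->
  played x k h = played x' k h.
Proof.
elim/ltn_ind: k h => k IH h hH xx xkh; case: k IH xx xkh => [|k] IH xx xkh; first by [].
rewrite !playedE // /ucb_policy xkh; congr (argmax (_ _)).
apply: eq_ucb_Q => // j i /andP[j0 jk] /andP[i0 iH].
apply: IH => //; first exact: same_past_le (ltnW jk) xx.
by apply: xx; rewrite ?j0 ?i0 ?(leqW iH).
Qed.

Lemma same_past_played x x' k : same_past x x' k -> same_past_actions (played x) (played x') k.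
Proof.
move=> xx j i /andP[j0 jk] /andP[i0 iH]; apply: eq_played => //.
  exact: same_past_le (ltnW jk) xx.
by apply: xx; rewrite ?j0 ?i0 ?(leqW iH).
Qed.

Lemma eq_value (pi pi' : policy Obs Act Qst) h s : (h <= H.+1)%N ->
  (forall i, (h <= i <= H)%N -> pi i = pi' i) -> value M pi h s = value M pi' h s.
Proof.
move=> hH; have [n hn] : exists n, (n + h = H.+1)%N by exists (H.+1 - h)%N; rewrite subnK.
elim: n h s hH hn => [|n IH] h s hH hn pp.
  by rewrite -[h]add0n hn !value_last.
have hH' : (h <= H)%N by rewrite -ltnS -hn ltnS leq_addl.
rewrite !valueS // pp ?leqnn //; apply: eq_avg => o'; congr (_ + _).
apply: eq_bigr => q' _; congr (_ * _); apply: IH => //; first by rewrite addnS -hn.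
by move=> i /andP[hi iH]; apply: pp; rewrite (ltnW hi).
Qed.

Lemma eq_ucb_value x x' y y' k s h : (h <= H.+1)%N -> same_past x x' k ->
  same_past_actions y y' k ->
  value M (ucb_policy rm L H K rho x y argmax k) h s =
  value M (ucb_policy rm L H K rho x' y' argmax k) h s.
Proof.
move=> hH xx yy; apply: eq_value => // i /andP[_ iH].
by apply/funext => s'; rewrite /ucb_policy (eq_ucb_Q xx yy).
Qed.

End Extensionality.

Section TrajectoryLaw.
Variables (R : realType) (Obs Act Qst : finType) (AP : Type).
Variable M : labeled_mdp R Obs Act Qst AP.
Local Notation state := (Qst * Obs)%type.
Local Notation H := (horizon M).
Variables (d : measure_display) (Omega : measurableType d) (Pr : probability Omega R).
Variables (K : nat) (st : nat -> nat -> Omega -> state) (ac : nat -> nat -> Omega -> Act).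
Variables (rho : R) (argmax : (Act -> R) -> Act).
Hypothesis dyn : mdp_interaction M Pr K st ac.
Hypothesis plays : plays_ucbvi M K st ac rho argmax.
Variable s0 : state.

Local Notation played := (played M K rho argmax).
Local Notation X := {ffun 'I_K.+1 * 'I_H.+2 -> state}.

Definition coords (x : X) (k h : nat) : state := x (inord k, inord h).

(* Episodes and steps are numbered from 1: the coordinates with index 0 are junk. *)
Definition traj (w : Omega) : X :=
  [ffun p : 'I_K.+1 * 'I_H.+2 => if (p.1 == 0%N :> nat) || (p.2 == 0%N :> nat) then s0 else st p.1 p.2 w].

Lemma coords_traj w k h : (0 < k <= K)%N -> (0 < h <= H.+1)%N ->
  coords (traj w) k h = st k h w.
Proof.
move=> /andP[k0 kK] /andP[h0 hH]; rewrite /coords /traj ffunE /= !inordK //.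
by rewrite !eqn0Ngt k0 h0.
Qed.

Lemma same_past_traj w k : (k <= K.+1)%N ->
  same_past M (fun j i => st j i w) (coords (traj w)) k.
Proof.
move=> kK j i /andP[j0 jk] iH; rewrite coords_traj // j0 /=.
by rewrite -ltnS (leq_trans jk).
Qed.

Lemma ac_played w k h : (0 < k <= K)%N -> (0 < h <= H)%N ->
  ac k h w = played (coords (traj w)) k h.
Proof.
elim/ltn_ind: k h => k IH h kK hH; have /andP[k0 kK'] := kK; have /andP[h0 hH'] := hH.
rewrite plays // playedE // /ucbvi_policy /ucb_policy coords_traj //; last by rewrite h0 leqW.
congr (argmax (_ _)); apply: eq_ucb_Q => //.
  exact: same_past_traj (leqW kK').
move=> j i /andP[j0 jk] iH; apply: IH => //.
by rewrite j0 (leq_trans (ltnW jk)).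
Qed.

Lemma measurable_traj (x : X) : measurable [set w | traj w = x].
Proof.
have -> : [set w | traj w = x] = \bigcap_(p in [set: 'I_K.+1 * 'I_H.+2]) [set w | traj w p = x p].
  apply/seteqP; split=> w /=; first by move=> <-.
  by move=> h; apply/ffunP => p; exact: h.
apply: fin_bigcap_measurable => // p _.
(* The interaction gives measurability from index 1 on only; the coordinates with index 0 are
   constant, so their events are full or empty. *)
case: (boolP ((p.1 == 0%N :> nat) || (p.2 == 0%N :> nat))) => p0.
  have [e|e] := eqVneq s0 (x p).
    by rewrite (_ : [set w | _] = setT) //; apply/seteqP; split=> w //= _; rewrite ffunE p0.
  rewrite (_ : [set w | _] = set0) //; apply/seteqP; split=> w //=.
  by rewrite ffunE p0 => h; move: e; rewrite h eqxx.
rewrite (_ : [set w | _] = [set w | st p.1 p.2 w = x p]).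
  move: p0; rewrite negb_or -!lt0n => /andP[p1 p2].
  by apply: dyn.1; rewrite ?p1 ?p2 -ltnS ltn_ord.
by apply/seteqP; split=> w /=; rewrite ffunE (negPf p0).
Qed.

Definition traj_law (x : X) : R := fine (Pr [set w | traj w = x]).

Local Notation law := traj_law.

Lemma law_ge0 x : 0 <= law x. Proof. exact: fine_ge0. Qed.

Definition law_prob (B : pred X) : R := \sum_(x | B x) law x.

Local Notation prob := law_prob.

Let measurable_traj_seq (r : seq X) : measurable [set w | traj w \in r].
Proof.
elim: r => [|x r IH]; first by rewrite (_ : [set w | _] = set0) //; apply/seteqP; split.
rewrite (_ : [set w | _] = [set w | traj w = x] `|` [set w | traj w \in r]).
  by apply: measurableU => //; exact: measurable_traj.
apply/seteqP; split=> w /=; rewrite inE; first by move=> /orP[/eqP|]; [left|right].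
by move=> [->|->]; rewrite ?eqxx ?orbT.
Qed.

Let Pr_traj_seq (r : seq X) : uniq r ->
  Pr [set w | traj w \in r] = (\sum_(x <- r) law x)%:E.
Proof.
elim: r => [|x r IH] /=.
  by move=> _; rewrite big_nil (_ : [set w | _] = set0) ?measure0 //; apply/seteqP; split.
move=> /andP[xr ur]; rewrite big_cons EFinD -IH //.
rewrite (_ : [set w | traj w \in x :: r] = [set w | traj w = x] `|` [set w | traj w \in r]); last first.
  apply/seteqP; split=> w /=; rewrite inE; first by move=> /orP[/eqP|]; [left|right].
  by move=> [->|->]; rewrite ?eqxx ?orbT.
rewrite measureU //; [|exact: measurable_traj|].
  by rewrite /traj_law fineK // fin_num_measure //; exact: measurable_traj.
apply/seteqP; split=> w //= -[-> h]; by move: xr; rewrite h.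
Qed.

Lemma Pr_traj (B : pred X) : Pr [set w | B (traj w)] = (prob B)%:E.
Proof.
rewrite (_ : [set w | _] = [set w | traj w \in enum B]); last first.
  by apply/seteqP; split=> w /=; rewrite mem_enum.
by rewrite Pr_traj_seq ?enum_uniq // /law_prob big_enum.
Qed.

Lemma law_sum1 : \sum_x law x = 1.
Proof.
have := Pr_traj xpredT; rewrite (_ : [set w | _] = setT) ?probability_setT; last first.
  by apply/seteqP; split.
by rewrite /law_prob => -[->].
Qed.

(** The fibres of [prefix k h] are the atoms of the information available at step [h] of episode
    [k]; padding with [s0] keeps them inside the finite type of trajectories. *)
Definition prefix (k h : nat) (x : X) : X :=
  [ffun p : 'I_K.+1 * 'I_H.+2 => if (p.1 < k)%N || ((p.1 == k :> nat) && (p.2 <= h)%N) then x p else s0].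

Lemma coords_prefix_past k h x : (k <= K.+1)%N -> same_past M (coords (prefix k h x)) (coords x) k.
Proof.
move=> kK j i /andP[j0 jk] /andP[i0 iH].
by rewrite /coords /prefix ffunE /= !inordK ?(leq_trans jk) // jk.
Qed.

Lemma coords_prefix_now k h x i : (k <= K)%N -> (h <= H.+1)%N -> (i <= h)%N ->
  coords (prefix k h x) k i = coords x k i.
Proof.
by move=> kK hH ih; rewrite /coords /prefix ffunE /= !inordK ?eqxx ?ih ?orbT // ltnS (leq_trans ih).
Qed.

(** The actions are functions of the past states, so conditioning on states and actions amounts to
    fixing the prefix of the state trajectory. *)
Let history_prefix w0 k h (y := prefix k h (traj w0)) :
  (0 < k <= K)%N -> (0 < h <= H)%N ->
  history M st ac k h (coords y) (played (coords y)) = [set w | prefix k h (traj w) = y].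
Proof.
move=> kK hH; have /andP[k0 kK'] := kK; have /andP[h0 hH'] := hH.
have past0 := @coords_prefix_past k h (traj w0) (leqW kK').
have stE w : prefix k h (traj w) = y ->
    (forall j i, (0 < j < k)%N -> (0 < i <= H.+1)%N -> st j i w = coords y j i) /\
    (forall i, (0 < i <= h)%N -> st k i w = coords y k i).
  move=> <-; split=> [j i jk iH|i /andP[i0 ih]].
    rewrite coords_prefix_past // ?(leqW kK') // coords_traj //.
    by case/andP: jk => -> /ltnW /leq_trans ->.
  rewrite coords_prefix_now // ?(leqW hH') // coords_traj //.
  by rewrite i0 (leq_trans ih) // leqW.
apply/seteqP; split=> w /=.
  move=> [h1 _ h3 _]; apply/ffunP => p; rewrite /prefix !ffunE.
  case: ifP => // pk.
  case: ifP => // /negbT; rewrite negb_or -!lt0n => /andP[p1 p2].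
  have pH : (p.2 <= H.+1)%N by rewrite -ltnS.
  have pK : (p.1 <= K)%N by rewrite -ltnS.
  have inE' : (inord p.1, inord p.2) = p by case: (p) => a b; rewrite !inord_val.
  have cy : coords y p.1 p.2 = st p.1 p.2 w0.
    rewrite /coords inE' /y /prefix ffunE pk /traj ffunE.
    by rewrite !eqn0Ngt p1 p2.
  case/orP: pk => [pk|/andP[/eqP pk ph]].
    by rewrite h1 ?cy // ?p1 ?p2.
  by rewrite -cy pk h3 // p2.
move=> wy; have [e1 e2] := stE w wy.
split=> //.
  move=> j i jk iH; have /andP[j0 jk'] := jk; have /andP[i0 iH'] := iH.
  rewrite ac_played ?j0 ?(leq_trans (ltnW jk')) // -wy.
  have jK : (j < K.+1)%N by rewrite ltnS (leq_trans (ltnW jk')).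
  apply: eq_played => //.
    move=> j' i' /andP[? ?] ?; rewrite coords_prefix_past // ?(leqW kK') //.
    by rewrite (leq_trans _ (ltnW jk')) // andbT.
  by rewrite coords_prefix_past ?(leqW kK') // i0 leqW.
move=> i /andP[i0 ih]; have iH := leq_trans ih hH'.
rewrite ac_played ?i0 // -wy; apply: eq_played => //.
  by move=> j' i' ? ?; rewrite coords_prefix_past // (leqW kK').
by rewrite coords_prefix_now // leqW.
Qed.

Lemma prob_next k h (y : X) (s' : state) : (0 < k <= K)%N -> (0 < h <= H)%N ->
  prob (fun x => (prefix k h x == y) && (coords x k h.+1 == s')) =
  mdp_trans M (coords y k h) (played (coords y) k h) s' * prob (fun x => prefix k h x == y).
Proof.
move=> kK hH; have /andP[h0 hH'] := hH.
(* A [y] that is not the prefix of a realised trajectory need not describe a history, but then both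
   sides are 0. *)
have [[w0 wy]|none] := pselect (exists w0, prefix k h (traj w0) = y).
  apply/EFin_inj; rewrite EFinM -!Pr_traj.
  have := dyn.2 k h (coords y) (played (coords y)) s' kK hH.
  rewrite -wy history_prefix // wy => e.
  have -> : [set w | prefix k h (traj w) == y] = [set w | prefix k h (traj w) = y].
    by apply/seteqP; split=> w /= /eqP.
  rewrite -e; congr (Pr _); apply/seteqP; split=> w /=.
    by rewrite coords_traj // => /andP[/eqP ? /eqP ?].
  by rewrite coords_traj // => -[-> ->]; rewrite !eqxx.
have zero (B : pred X) : (forall x, B x -> prefix k h x = y) -> prob B = 0.
  move=> By; apply/EFin_inj; rewrite -Pr_traj (_ : [set w | _] = set0) ?measure0 //.
  by apply/seteqP; split=> w //= /By h1; apply: none; exists w.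
by rewrite !zero ?mulr0 // => x; [move=> /eqP|move=> /andP[/eqP]].
Qed.

Definition law_expect (f : X -> R) : R := \sum_x f x * law x.

Local Notation expect := law_expect.

Lemma le_expect f g : (forall x, f x <= g x) -> expect f <= expect g.
Proof. by move=> fg; apply: ler_sum => x _; rewrite ler_wpM2r ?law_ge0. Qed.

(** The tower property: the last hypothesis says that [G] depends on the past only, so on each fibre
    of [prefix] the next state is integrated out by [prob_next]. *)
Lemma expect_next (G : X -> state -> R) k h : (0 < k <= K)%N -> (0 < h <= H)%N ->
  (forall x s', G (prefix k h x) s' = G x s') ->
  expect (fun x => G x (coords x k h.+1)) =
  expect (fun x => \sum_s' mdp_trans M (coords x k h) (played (coords x) k h) s' * G x s').
Proof.
move=> kK hH GP; have /andP[k0 kK'] := kK; have /andP[h0 hH'] := hH.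
rewrite /law_expect (partition_big (prefix k h) xpredT) //=.
rewrite [RHS](partition_big (prefix k h) xpredT) //=.
apply: eq_bigr => y _.
transitivity (\sum_s' G y s' * prob (fun x => (prefix k h x == y) && (coords x k h.+1 == s'))).
  rewrite (partition_big (fun x => coords x k h.+1) xpredT) //=.
  apply: eq_bigr => s' _; rewrite /law_prob mulr_sumr; apply: eq_bigr => x /andP[/eqP xy /eqP xs].
  by rewrite -GP xy xs.
rewrite (eq_bigr _ (fun s' _ => congr1 ( *%R (G y s')) (prob_next y s' kK hH))).
under eq_bigr do rewrite mulrA.
rewrite -mulr_suml /law_prob mulr_sumr; apply: eq_bigr => x /eqP xy.
congr (_ * _); apply: eq_bigr => s' _; rewrite mulrC -[G x s']GP xy.
congr (mdp_trans _ _ _ _ * _); rewrite -xy.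
  by rewrite coords_prefix_now // leqW.
apply: eq_played => //.
  by move=> j i ? ?; rewrite coords_prefix_past // leqW.
by rewrite coords_prefix_now // leqW.
Qed.

End TrajectoryLaw.

(** * Supermartingales and maximal inequalities *)

Section Supermartingale.
Variables (R : realType) (Obs Act Qst : finType) (AP : Type).
Variable M : labeled_mdp R Obs Act Qst AP.
Local Notation state := (Qst * Obs)%type.
Local Notation H := (horizon M).
Variables (d : measure_display) (Omega : measurableType d) (Pr : probability Omega R).
Variables (K : nat) (st : nat -> nat -> Omega -> state) (ac : nat -> nat -> Omega -> Act).
Variables (rho : R) (argmax : (Act -> R) -> Act).
Hypothesis dyn : mdp_interaction M Pr K st ac.
Hypothesis plays : plays_ucbvi M K st ac rho argmax.
Variable s0 : state.

Local Notation played := (played M K rho argmax).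
Local Notation X := {ffun 'I_K.+1 * 'I_H.+2 -> state}.
Local Notation prob := (@law_prob R Obs Act Qst AP M d Omega Pr K st s0).
Local Notation expect := (@law_expect R Obs Act Qst AP M d Omega Pr K st s0).
Local Notation law := (@traj_law R Obs Act Qst AP M d Omega Pr K st s0).
Local Notation family := ((nat -> nat -> state) -> nat -> nat -> state -> R).

Definition predictable (F : family) := forall x x' k h,
  (0 < k <= K)%N -> (0 < h <= H)%N -> same_past M x x' k ->
  (forall i, (0 < i <= h)%N -> x k i = x' k i) -> F x k h = F x' k h.

Definition oscillation_le (F : family) (c : R) := forall x k h s s',
  (0 < k <= K)%N -> (0 < h <= H)%N -> `|F x k h s - F x k h s'| <= c.

Definition exponent (F : family) x k := sn_exponent M x (played x) (F x) k.

Section Fixed.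
Variable F : family.
Hypothesis F_pred : predictable F.

Local Notation noise x := (martingale_diff M x (played x) (F x)).

Lemma eq_noise x x' k h : (0 < k <= K)%N -> (0 < h <= H)%N -> same_past M x x' k ->
  (forall i, (0 < i <= h.+1)%N -> x k i = x' k i) -> noise x k h = noise x' k h.
Proof.
move=> kK hH xx xk; have /andP[h0 hH'] := hH.
have xk' i : (0 < i <= h)%N -> x k i = x' k i by move=> /andP[i0 ih]; rewrite xk // i0 leqW.
have xh : x k h = x' k h by rewrite xk' // h0 leqnn.
by rewrite /martingale_diff (F_pred kK hH xx xk') xk ?leqnn // xh (eq_played _ _ _ hH' xx xh).
Qed.

Lemma eq_exponent x x' k : (k <= K.+1)%N -> same_past M x x' k ->
  exponent F x k = exponent F x' k.
Proof.
move=> kK xx; apply: eq_big_nat => j /andP[j0 jk]; apply: eq_big_nat => h hH.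
have jK : (0 < j <= K)%N by rewrite j0 -ltnS (leq_trans jk).
rewrite !(eq_noise (x := x) (x' := x')) //; first exact: same_past_le (ltnW jk) xx.
by move=> i /andP[i0 ih]; apply: xx; rewrite ?j0 ?i0 ?(leq_trans ih) //; case/andP: hH.
Qed.

Hypothesis F_osc : oscillation_le F (1 / 3).

Let increment x k h : R := noise x k h - 2 / 3 * noise x k h ^+ 2.

Let partial x k h : R := exponent F x k + \sum_(1 <= i < h) increment x k i.

(** By predictability all but the last factor depend on the prefix; [expect_next] integrates out the
    next state and [pmf_expR_le1] bounds the resulting factor by 1. *)
Let partial_step k h : (0 < k <= K)%N -> (0 < h <= H)%N ->
  expect (fun x => expR (partial (coords x) k h.+1)) <=
  expect (fun x => expR (partial (coords x) k h)).
Proof.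
move=> kK hH; have /andP[k0 kK'] := kK; have /andP[h0 hH'] := hH.
pose xi (x : X) s' := F (coords x) k h s' -
  \sum_s' mdp_trans M (coords x k h) (played (coords x) k h) s' * F (coords x) k h s'.
pose G (x : X) s' := expR (partial (coords x) k h) * expR (xi x s' - 2 / 3 * xi x s' ^+ 2).
have past (x : X) := @coords_prefix_past _ _ _ _ _ M K s0 k h x (leqW kK').
have now (x : X) i : (0 < i <= h)%N -> coords (prefix s0 k h x) k i = coords x k i.
  by move=> /andP[i0 ih]; apply: coords_prefix_now => //; exact: leqW.
have GP (x : X) s' : G (prefix s0 k h x) s' = G x s'.
  have xh : coords (prefix s0 k h x) k h = coords x k h by apply: now; rewrite h0 leqnn.
  have partialE : partial (coords (prefix s0 k h x)) k h = partial (coords x) k h.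
    rewrite /partial (eq_exponent (leqW kK') (past x)); congr (_ + _).
    apply: eq_big_nat => i /andP[i0 ih]; rewrite /increment (eq_noise kK _ (past x)) //.
      by rewrite i0 (leq_trans (ltnW ih)).
    by move=> i' /andP[i'0 i'i]; rewrite now // i'0 (leq_trans i'i).
  have xiE : xi (prefix s0 k h x) s' = xi x s'.
    rewrite /xi (F_pred kK hH (past x) (now x)) xh.
    by rewrite (eq_played _ _ _ hH' (past x) xh).
  by rewrite /G partialE xiE.
have -> : expect (fun x => expR (partial (coords x) k h.+1)) =
    expect (fun x => G x (coords x k h.+1)).
  apply: eq_bigr => x _; congr (_ * _); rewrite /G -expRD; congr expR.
  by rewrite /partial big_nat_recr // addrA.
rewrite (expect_next dyn plays kK hH GP); apply: le_expect => x.
under eq_bigr do rewrite mulrCA.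
rewrite -mulr_sumr ler_piMr ?expR_ge0 //.
apply: pmf_expR_le1; first exact: mdp_trans_pmf.
by move=> s s'; exact: F_osc.
Qed.

Lemma expect_exponent_le1 : expect (fun x => expR (exponent F (coords x) K.+1)) <= 1.
Proof.
have partialS x k : (0 < k)%N -> partial x k H.+1 = exponent F x k.+1.
  by move=> k0; rewrite /partial /exponent /sn_exponent [RHS]big_nat_recr.
have steps k h : (0 < k <= K)%N -> (h <= H)%N ->
    expect (fun x => expR (partial (coords x) k h.+1)) <=
    expect (fun x => expR (exponent F (coords x) k)).
  move=> kK; elim: h => [|h IH] hH.
    apply: le_expect => x; by rewrite /partial big_geq // addr0.
  by apply: le_trans (IH (ltnW hH)); exact: partial_step.
suff all_k k : (k <= K)%N -> expect (fun x => expR (exponent F (coords x) k.+1)) <= 1 by exact: all_k.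
elim: k => [|k IH] kK.
  rewrite -(law_sum1 dyn s0) /law_expect; apply: ler_sum => x _.
  by rewrite /exponent /sn_exponent big_geq // expR0 mul1r.
apply: le_trans (IH (ltnW kK)); apply: le_trans (steps k.+1 H kK (leqnn _)).
by apply: le_expect => x; rewrite partialS.
Qed.

Lemma prob_exponent_gt c : prob (fun x => c < exponent F (coords x) K.+1) <= expR (- c).
Proof.
apply: (@le_trans _ _ (expect (fun x => expR (- c) * expR (exponent F (coords x) K.+1)))).
  rewrite /law_prob /law_expect big_mkcond; apply: ler_sum => x _.
  case: ifP => cx; last by rewrite mulr_ge0 ?law_ge0 // mulr_ge0 ?expR_ge0.
  rewrite -expRD ler_peMl ?law_ge0 //.
  by rewrite -expR0 ler_expR addrC subr_ge0 ltW.
rewrite /law_expect; under eq_bigr do rewrite -mulrA.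
by rewrite -mulr_sumr ler_piMr ?expR_ge0 // expect_exponent_le1.
Qed.

End Fixed.

(* Ville's maximal inequality: stop the family at the first episode at which
   the exponent exceeds [c]. *)
Lemma prob_exceed_le F c : predictable F -> oscillation_le F (1 / 3) ->
  prob (fun x => ~~ all (fun k => exponent F (coords x) k <= c) (index_iota 1 K.+2)) <=
  expR (- c).
Proof.
move=> F_pred F_osc.
(* The stopped family is still predictable, because the exponents at the starts of episodes up to
   [k] only read earlier episodes. Once one of them exceeds [c] the noise of [F'] is 0, so its final
   exponent keeps the value at the first excess. *)
pose F' : family := fun x k h s' =>
  (all (fun j => exponent F x j <= c) (index_iota 1 k.+1))%:R * F x k h s'.
have F'_pred : predictable F'.
  move=> x x' k h kK hH xx xk; apply/funext => s'.
  rewrite /F' (F_pred _ _ _ _ kK hH xx xk); congr (_%:R * _).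
  congr nat_of_bool; apply: eq_in_all => j; rewrite mem_index_iota => /andP[j0 jk].
  rewrite (eq_exponent F_pred (x' := x')) //.
    by rewrite (leq_trans (ltnW jk)) // ltnS; case/andP: kK.
  by apply: same_past_le xx; rewrite -ltnS.
have F'_osc : oscillation_le F' (1 / 3).
  move=> x k h s s' kK hH; rewrite /F' -mulrBr; case: all; last by rewrite mul0r normr0.
  by rewrite [_ * (_ - _)]mul1r; exact: F_osc.
apply: le_trans (prob_exponent_gt F'_pred F'_osc c); rewrite /law_prob.
rewrite big_mkcond [leRHS]big_mkcond; apply: ler_sum => x _.
case: ifP => [exc|_]; last by case: ifP => // _; exact: law_ge0.
suff -> : c < exponent F' (coords x) K.+1 by [].
move: exc; set y := coords x; rewrite -has_predC => /hasP[k1 k1I /= ck1].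
have ex : exists k, (k \in index_iota 1 K.+2) && (c < exponent F y k).
  by exists k1; rewrite k1I ltNge.
case: (ex_minnP ex) => k /andP[kI ck] kmin.
move: kI; rewrite mem_index_iota ltnS => /andP[k0 kK].
have -> // : exponent F' y K.+1 = exponent F y k.
rewrite /exponent /sn_exponent (big_cat_nat (n := k)) //= [X in _ + X]big1_seq ?addr0.
  apply: eq_big_nat => j /andP[j0 jk]; apply: eq_bigr => h _.
  suff e : martingale_diff M y (played y) (F' y) j h = martingale_diff M y (played y) (F y) j h by rewrite e.
  have on : all (fun j => exponent F y j <= c) (index_iota 1 j.+1).
    apply/allP => j'; rewrite mem_index_iota ltnS => /andP[j'0 j'j].
    rewrite leNgt; apply/negP => cj'.
    have := kmin j'; rewrite mem_index_iota j'0 cj' andbT ltnS.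
    have j'k := leq_ltn_trans j'j jk.
    rewrite (leq_trans (ltnW j'k)) //= => /(_ isT); by rewrite leqNgt j'k.
  rewrite /martingale_diff /F' on mul1r; congr (_ - _).
  by apply: eq_bigr => s' _; rewrite mul1r.
move=> j /andP[_]; rewrite mem_index_iota => /andP[kj jK]; rewrite big1 // => h _.
have off : all (fun j => exponent F y j <= c) (index_iota 1 j.+1) = false.
  apply/negP => /allP /(_ k); rewrite mem_index_iota k0 ltnS kj => /(_ isT).
  by rewrite leNgt ck.
have -> : martingale_diff M y (played y) (F' y) j h = 0.
  rewrite /martingale_diff /F' off mul0r big1 ?subr0 // => s' _; by rewrite mul0r mulr0.
by rewrite expr0n /= mulr0 subr0.
Qed.

Lemma prob_union (I : finType) (B : I -> pred X) :
  prob (fun x => [exists i, B i x]) <= \sum_i prob (B i).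
Proof.
rewrite /law_prob big_mkcond.
under [leRHS]eq_bigr do rewrite big_mkcond.
rewrite exchange_big; apply: ler_sum => x _ /=.
have s0' (P : pred I) : 0 <= \sum_(i | P i) (if B i x then law x else 0).
  by apply: sumr_ge0 => i _; case: ifP => // _; exact: law_ge0.
case: ifP => [/existsP[i Bi]|_]; last exact: s0'.
by rewrite (bigD1 i) //= Bi lerDl.
Qed.

Lemma prob_setC B : prob (predC B) = 1 - prob B.
Proof.
rewrite -(law_sum1 dyn s0) /law_prob [in RHS](bigID B) /=; lra.
Qed.

Lemma le_prob (B B' : pred X) : (forall x, B x -> B' x) -> prob B <= prob B'.
Proof.
move=> BB; rewrite /law_prob big_mkcond [leRHS]big_mkcond; apply: ler_sum => x _.
case: ifP => [/BB ->//|_]; case: ifP => // _; exact: law_ge0.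
Qed.

End Supermartingale.

(** * The good event and the final bound *)

Section Main.
Variables (R : realType) (Obs Act Qst : finType) (AP : Type).
Variable M : labeled_mdp R Obs Act Qst AP.
Local Notation state := (Qst * Obs)%type.
Local Notation L := (label M).
Local Notation rm := (machine M).
Local Notation H := (horizon M).
Local Notation Hr := (H%:R : R).
Variables (d : measure_display) (Omega : measurableType d) (Pr : probability Omega R).
Variables (K : nat) (st : nat -> nat -> Omega -> state) (ac : nat -> nat -> Omega -> Act).
Variables (rho : R) (argmax : (Act -> R) -> Act).
Hypothesis dyn : mdp_interaction M Pr K st ac.
Hypothesis plays : plays_ucbvi M K st ac rho argmax.
Hypothesis argmaxP : forall (f : Act -> R) (a : Act), f a <= f (argmax f).
Hypothesis rho01 : 0 < rho < 1.
Hypothesis K_gt0 : (0 < K)%N.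
Variable w0 : Omega.

Local Notation iota := (log_factor Obs Act Qst H K rho).
Local Notation O := (#|Obs|%:R : R).
Local Notation A := (#|Act|%:R : R).
Local Notation Q := (#|Qst|%:R : R).
Local Notation T := ((K * H)%:R : R).
Local Notation played := (played M K rho argmax).
Local Notation family := ((nat -> nat -> state) -> nat -> nat -> state -> R).
Local Notation X := {ffun 'I_K.+1 * 'I_H.+2 -> state}.

Let s0 : state := st 0 0 w0.
Let ai : Act := argmax (fun=> 0).

Let O1 : 1 <= O. Proof. by rewrite ler1n; apply/card_gt0P; exists s0.2. Qed.
Let A1 : 1 <= A. Proof. by rewrite ler1n; apply/card_gt0P; exists ai. Qed.
Let Q1 : 1 <= Q. Proof. by rewrite ler1n; apply/card_gt0P; exists s0.1. Qed.
Let H1 : 1 <= Hr. Proof. by rewrite ler1n horizon_gt0. Qed.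
Let H0 : 0 < Hr. Proof. by rewrite ltr0n horizon_gt0. Qed.
Let T0 : 0 < T. Proof. by rewrite ltr0n muln_gt0 K_gt0 horizon_gt0. Qed.

Let D0 : 0 < 6 * Q * O * A * T.
Proof.
have Q0 := lt_le_trans ltr01 Q1; have O0 := lt_le_trans ltr01 O1.
have A0 := lt_le_trans ltr01 A1.
by do 4 (apply: mulr_gt0 => //).
Qed.

(** The logarithms produced by the visit counts are at most [ln K]; the factor 6 inside [iota]
    exceeds [expR 1] and pays for the additional 1. *)
Lemma iota_ge : 1 + ln K%:R <= iota.
Proof.
have /andP[r0 r1] := rho01.
have KR : 0 < K%:R :> R by rewrite ltr0n.
have e6 : 1 <= ln 6 :> R.
  rewrite -[leLHS](expRK (1 : R)) ler_ln ?posrE ?expR_gt0 ?ltr0n //.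
  have h : (1 / 2) ^+ 2 <= expR (- 1 : R).
    have -> : - 1 = - (1 / 2) * 2%:R :> R by lra.
    rewrite expRM_natr lerXn2r ?nnegrE ?expR_ge0 //.
    by have := expR_ge1Dx (- (1 / 2) : R); lra.
  by rewrite -(opprK 1) expRN -div1r ler_pdivrMr ?expR_gt0 //; lra.
apply: (@le_trans _ _ (ln 6 + ln K%:R)); first by rewrite lerD2r.
rewrite -lnM ?posrE ?ltr0n //.
have pos : 0 < 6 * Q * O * A * T / rho.
  exact: divr_gt0.
rewrite /log_factor ler_ln ?posrE //; last by rewrite mulr_gt0 ?ltr0n.
rewrite ler_pdivlMr //.
apply: (@le_trans _ _ (6 * K%:R)); first by rewrite ler_piMr ?mulr_ge0 ?ler0n // ltW.
have -> : 6 * Q * O * A * T = 6 * K%:R * (Q * O * A * Hr) by rewrite natrM; ring.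
by rewrite ler_peMr ?mulr_ge0 ?ler0n // !mulr_ege1.
Qed.

Let iota1 : 1 <= iota.
Proof. by apply: le_trans iota_ge; rewrite lerDl ln_ge0 // ler1n. Qed.

Let expR_iota : expR (- iota) = rho / (6 * Q * O * A * T).
Proof.
have /andP[r0 _] := rho01.
rewrite expRN /log_factor lnK ?posrE ?divr_gt0 // invf_div //.
Qed.

Hypothesis T_large : 2500 * (Hr ^+ 2 * O ^+ 2 * A * iota ^+ 2) <= T.

Let Y1 : 1 <= Hr ^+ 2 * O ^+ 2 * A * iota ^+ 2.
Proof. by rewrite !mulr_ege1 // exprn_ege1. Qed.

(** Exactly what makes the Azuma scale [sqrt (3 * iota / (2 * T))] at most [1 / 3], the oscillation
    allowed by the supermartingale. *)
Let iota_T : 27 * iota <= 2 * T.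
Proof.
have : iota <= Hr ^+ 2 * O ^+ 2 * A * iota ^+ 2.
  have -> : Hr ^+ 2 * O ^+ 2 * A * iota ^+ 2 = iota * (Hr ^+ 2 * O ^+ 2 * A * iota) by ring.
  rewrite ler_peMr //; first exact: le_trans ler01 iota1.
  by rewrite !mulr_ege1 // exprn_ege1.
by move: T_large iota1; move: (Hr ^+ 2 * _ * _ * _) => y *; lra.
Qed.

Let O_T : O <= T.
Proof.
have : O <= Hr ^+ 2 * O ^+ 2 * A * iota ^+ 2.
  have -> : Hr ^+ 2 * O ^+ 2 * A * iota ^+ 2 = O * (Hr ^+ 2 * O * A * iota ^+ 2) by ring.
  by rewrite ler_peMr // !mulr_ege1 // exprn_ege1.
by move: T_large Y1; move: (Hr ^+ 2 * _ * _ * _) => y *; lra.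
Qed.

Let HK : (H <= K)%N.
Proof.
have : Hr * Hr <= T.
  have : Hr * Hr <= Hr ^+ 2 * O ^+ 2 * A * iota ^+ 2.
    have -> : Hr ^+ 2 * O ^+ 2 * A * iota ^+ 2 = Hr * Hr * (O ^+ 2 * A * iota ^+ 2) by ring.
    by rewrite ler_peMr ?mulr_ge0 // !mulr_ege1 // exprn_ege1.
  by move: T_large Y1; move: (Hr ^+ 2 * _ * _ * _) => y *; lra.
by rewrite natrM ler_pM2r // ler_nat.
Qed.

Let at_family o a (Y : Obs -> R) : family := fun x => at_visits x (played x) o a Y.

Let at_family_pred o a Y : predictable M K (at_family o a Y).
Proof.
move=> x x' k h kK hH xx xk; have /andP[h0 hH'] := hH.
have xh : x k h = x' k h by rewrite xk // h0 leqnn.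
by apply/funext => s'; rewrite /at_family /at_visits xh (eq_played _ _ _ hH' xx xh).
Qed.

Let at_family_osc o a Y c : 0 <= c -> (forall o1 o2, `|Y o1 - Y o2| <= c) ->
  oscillation_le M K (at_family o a Y) c.
Proof.
move=> c0 Yc x k h s s' _ _; rewrite /at_family /at_visits -mulrBr.
case: (_ == o); case: (_ == a); rewrite ?(mul0r, mulr0, mul1r, mulr1, normr0) //; exact: Yc.
Qed.

Let opt_family (b : bool) q o a (h : 'I_H) (j : 'I_K) : family :=
  at_family o a (fun o' => (-1) ^+ b * (1 / 3 * 2 ^- j / Hr) * opt_return M h.+1 q o a o').

Let phat_family o a o1 : family :=
  at_family o a (fun o' => 1 / (3 * Hr) * (o' == o1)%:R).

Let rate B := azuma_rate M K rho B.

Let global_family (i : 'I_3) : family := fun x k h s' =>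
  if i == 0%N :> nat then rate (7 / 3 * Hr) * gap_family M K rho argmax x (played x) k h s'
  else if i == 1%N :> nat then rate (Hr ^+ 2) * square_family M K rho x (played x) k h s'
  else - (1 / (3 * Hr ^+ 2)) * visit_term Act H K rho x k h.+1 s'.2.

(** One entry per supermartingale. The component in ['I_K] is the scale of the Bernstein grid, not
    an episode: each entry already covers all episodes. *)
Let index := ((bool * Qst * Obs * Act * 'I_H * 'I_K + Obs * Act * Obs) + 'I_3)%type.

Let fam (i : index) : family :=
  match i with
  | inl (inl (b, q, o, a, h, j)) => opt_family b q o a h j
  | inl (inr (o, a, o1)) => phat_family o a o1
  | inr i => global_family i
  end.

Let fam_pred i : predictable M K (fam i).
Proof.
case: i => [[i|i]|i]; [case: i => [[[[[b q] o] a] h] j]|case: i => [[x a] o1]|]; try exact: at_family_pred.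
move=> x x' k h kK hH xx xk; apply/funext => s'; have /andP[h0 hH'] := hH.
have yy := same_past_played K rho argmax xx; have /andP[k0 _] := kK.
rewrite /fam /global_family /gap_family /square_family.
rewrite (eq_ucb_V K rho h.+1 k0 xx yy) (eq_ucb_value K rho argmax s' _ xx yy) //.
by rewrite /visit_term (eq_count_visit xx).
Qed.

Let rate_le B : 0 < B -> 0 <= rate B /\ rate B * B <= 1 / 3.
Proof.
move=> B0; rewrite /rate /azuma_rate; split; first by rewrite divr_ge0 ?sqrtr_ge0 // ltW.
rewrite divfK ?gt_eqF //.
have -> : 1 / 3 = Num.sqrt ((1 / 3) ^+ 2) :> R by rewrite sqrtr_sqr ger0_norm //.
rewrite ler_wsqrtr // ler_pdivrMr ?mulr_gt0 //; move: iota_T; lra.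
Qed.

Let scaled_osc (f : state -> R) c B s s' : 0 <= c -> (forall s, - B <= f s <= 0) ->
  c * B <= 1 / 3 -> `|c * f s - c * f s'| <= 1 / 3.
Proof.
move=> c0 fB cB; rewrite -mulrBr normrM (ger0_norm c0); apply: le_trans cB.
rewrite ler_wpM2l // ler_norml.
by have /andP[? ?] := fB s; have /andP[? ?] := fB s'; lra.
Qed.

Let fam_osc i : oscillation_le M K (fam i) (1 / 3).
Proof.
case: i => [[i|i]|i]; [case: i => [[[[[b q] o] a] h] j]|case: i => [[x a] o1]|].
- apply: at_family_osc => // o1 o2.
  rewrite -mulrBr -[_ * _ * (_ - _)]mulrA normrM normrX normrN1 expr1n [leLHS]mul1r normrM.
  have l0 : 0 <= 1 / 3 / 2 ^+ j / Hr by rewrite !divr_ge0 ?exprn_ge0.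
  rewrite (ger0_norm l0).
  have hH : (0 < h.+1 <= H)%N by rewrite /= ltn_ord.
  have /andP[? ?] := opt_return_itv ai q o a o1 hH.
  have /andP[? ?] := opt_return_itv ai q o a o2 hH.
  apply: (@le_trans _ _ (1 / 3 / 2 ^+ j / Hr * Hr)).
    by rewrite ler_wpM2l // ler_norml; lra.
  rewrite divfK ?gt_eqF // ler_pdivrMr ?exprn_gt0 // ler_peMr ?divr_ge0 //.
  by rewrite exprn_ege1 // ler1n.
- apply: at_family_osc => // o2 o3; rewrite -mulrBr normrM.
  have l0 : 0 <= 1 / (3 * Hr) by rewrite divr_ge0 // mulr_ge0.
  rewrite (ger0_norm l0).
  apply: (@le_trans _ _ (1 / (3 * Hr) * 1)).
    rewrite ler_wpM2l //; case: (o2 == o1); case: (o3 == o1).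
    - by rewrite subrr normr0.
    - by rewrite subr0 normr1.
    - by rewrite sub0r normrN normr1.
    - by rewrite subrr normr0.
  rewrite mulr1 ler_pdivrMr ?mulr_gt0 //; move: H1; lra.
- move=> x k h s s' kK hH; rewrite /fam /global_family; have /andP[h0 hH'] := hH.
  have V_itv s1 : 0 <= ucb_V rm L H K rho x (played x) k h.+1 s1 <= Hr.
    by apply: ucb_V_itv; [exact: ai|exact: iota1].
  case: eqP => _; last case: eqP => _.
  + have B0 : 0 < 7 / 3 * Hr by rewrite mulr_gt0.
    have [c0 cB] := rate_le B0; apply: (scaled_osc (f := gap_family M K rho argmax x (played x) k h)) cB => // s1.
    have w1 := weight_ge1 M h; have w0' := weight_le hH'.
    have /andP[? ?] := V_itv s1.
    have /andP[? ?] := value_itv (ucb_policy rm L H K rho x (played x) argmax k) s1 (h := h.+1) hH'.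
    rewrite /gap_family oppr_le0 lerN2 andbC mulr_ge0 ?le_max ?lexx ?orbT ?(le_trans ler01 w1) //=.
    apply: ler_pM => //; first exact: le_trans ler01 w1.
      by rewrite le_max lexx orbT.
    by rewrite ge_max (ltW H0) andbT; lra.
  + have B0 : 0 < Hr ^+ 2 by rewrite exprn_gt0.
    have [c0 cB] := rate_le B0; apply: (scaled_osc (f := square_family M K rho x (played x) k h)) cB => // s1.
    have /andP[? ?] := V_itv s1.
    by rewrite /square_family oppr_le0 lerN2 sqr_ge0 andbT lerXn2r ?nnegrE ?(ltW H0).
  + have B0 : 0 < Hr ^+ 2 by rewrite exprn_gt0.
    have mN (y z : R) : - y * z = y * - z by rewrite mulNr mulrN.
    rewrite !mN; apply: (scaled_osc (f := fun s => - visit_term Act H K rho x k h.+1 s.2) (B := Hr ^+ 2)).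
    * by rewrite divr_ge0 // mulr_ge0 // ltW.
    * by by move=> s1; rewrite oppr_le0 lerN2 andbC; exact: visit_term_itv.
    * by rewrite le_eqVlt; apply/orP; left; apply/eqP; field; rewrite gt_eqF.
Qed.

Let bad (i : index) : pred X := fun x =>
  ~~ all (fun k => exponent M K rho argmax (fam i) (coords x) k <= iota) (index_iota 1 K.+2).

Let good : pred X := fun x => ~~ [exists i, bad i x].

Local Notation prob := (@law_prob R Obs Act Qst AP M d Omega Pr K st s0).

Let prob_good : 1 - rho <= prob good.
Proof.
rewrite (prob_setC dyn s0 (fun x => [exists i, bad i x])) lerD2l lerN2.
apply: le_trans (prob_union Pr st s0 bad) _.
apply: (@le_trans _ _ (\sum_(i : index) expR (- iota))).
  by apply: ler_sum => i _; exact: (prob_exceed_le dyn plays s0 iota (@fam_pred i) (@fam_osc i)).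
rewrite sumr_const !card_sum !card_prod card_bool !card_ord expR_iota.
have /andP[r0 _] := rho01.
set D := 6 * Q * O * A * T.
have D_gt0 : 0 < D := D0.
rewrite -mulr_natl mulrA ler_pdivrMr // [leLHS]mulrC ler_wpM2l ?(ltW r0) //.
rewrite !natrD !natrM.
(* There are [2 * Q * O * A * T] Bernstein families, [O * A * O] families for [phat] (at most
   [Q * O * A * T], as [O <= T]) and 3 global ones: [2 + 1 + 3] is the 6 inside [iota]. *)
have -> : D = 2 * (Q * O * A * T) + 4 * (Q * O * A * T) by rewrite /D; ring.
have e1 : 2 * Q * O * A * Hr * K%:R = 2 * (Q * O * A * T) by rewrite natrM; ring.
rewrite e1 -addrA lerD2l.
have h1 : O * A * O <= Q * O * A * T.
  have -> : Q * O * A * T = Q * (O * A * T) by ring.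
  apply: (@le_trans _ _ (O * A * T)); first by rewrite ler_wpM2l // mulr_ge0.
  by rewrite ler_peMl // !mulr_ge0 ?(ltW T0).
have h2 : 1 <= Q * O * A * T by rewrite !mulr_ege1 //; apply: le_trans O_T.
by move: h1 h2; move: (O * A * O) (Q * O * A * T) => y z *; lra.
Qed.

Let bound : R := 7 / 3 * (21 * (iota * Num.sqrt (O * A * Hr * T))
           + 511 * (Hr ^+ 2 * O ^+ 2 * A * iota ^+ 2))
  + 49 / 30 * (7 / 3 * Hr) * Num.sqrt (T * iota).

Let regret_of (x : X) := regret M K (fun k => coords x k 1%N)
  (fun k => ucb_policy rm L H K rho (coords x) (played (coords x)) argmax k).

Let good_regret x : good x -> regret_of x <= bound.
Proof.
move=> /existsPn gx.
have ev i k : (0 < k <= K.+1)%N -> exponent M K rho argmax (fam i) (coords x) k <= iota.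
  move=> kK; have := gx i; rewrite negbK => /allP; apply.
  by rewrite mem_index_iota ltnS.
apply: regret_bound => //.
- by move=> k h kK hH; apply: playedE; [case/andP: kK|case/andP: hH].
- exact: iota_ge.
- move=> b q o a h j k /andP[h0 hH] jK /andP[k0 kK].
  case: h h0 hH => // h _ hH.
  have := ev (inl (inl (b, q, o, a, Ordinal hH, Ordinal jK))) k.
  by apply; rewrite k0 leqW.
- move=> o a o1 k /andP[k0 kK].
  by have := ev (inl (inr (o, a, o1))) k; apply; rewrite k0 leqW.
- exact: (ev (inr (@Ordinal 3 0 isT)) K.+1 (leqnn _)).
- exact: (ev (inr (@Ordinal 3 1 isT)) K.+1 (leqnn _)).
- exact: (ev (inr (@Ordinal 3 2 isT)) K.+1 (leqnn _)).
Qed.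

Let regret_ofE w : regret M K (fun k => st k 1%N w) (ucbvi_policy M K st ac rho argmax w) =
  regret_of (traj M K st s0 w).
Proof.
apply: eq_big_nat => k kK; have -> := coords_traj st s0 w (kK : (0 < k <= K)%N) (isT : (0 < 1 <= H.+1)%N).
congr (_ - _).
have /andP[k0 kK'] := kK.
apply: eq_ucb_value => //; first exact: same_past_traj (ltnW kK').
move=> j i /andP[j0 jk] iH; apply: ac_played => //.
by rewrite j0 -ltnS (leq_trans jk) // ltnW.
Qed.

Lemma regret_high_probability (B : R) : bound <= B ->
  ((1 - rho)%:E <= Pr [set w | (regret M K (fun k => st k 1%N w)
    (ucbvi_policy M K st ac rho argmax w) <= B)%R])%E.
Proof.
move=> bB.
rewrite (_ : [set w | _] = [set w | (fun x => regret_of x <= B) (traj M K st s0 w)]); last first.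
  by apply/seteqP; split=> w /=; rewrite regret_ofE.
rewrite (Pr_traj dyn s0 (fun x => regret_of x <= B)) lee_fin; apply: le_trans prob_good _.
by apply: le_prob => x /good_regret rx; exact: le_trans bB.
Qed.

End Main.

Theorem theorem1 (R : realType) (Obs Act Qst : finType) (AP : Type)
    (M : labeled_mdp R Obs Act Qst AP)
    (rho : R) (hrho : 0 < rho < 1)
    (K : nat) (hK : (1 <= K)%N)
    (argmax : (Act -> R) -> Act)
    (hargmax : forall (f : Act -> R) (a : Act), f a <= f (argmax f))
    (d : measure_display) (Omega : measurableType d) (Pr : probability Omega R)
    (st : nat -> nat -> Omega -> state Obs Qst)
    (ac : nat -> nat -> Omega -> Act)
    (hdyn : mdp_interaction M Pr K st ac)
    (hplay : plays_ucbvi M K st ac rho argmax) :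
  let H : R := (horizon M)%:R in
  let O : R := #|Obs|%:R in
  let A : R := #|Act|%:R in
  let Q : R := #|Qst|%:R in
  let T : R := (K * horizon M)%:R in
  let iota : R := ln (6 * Q * O * A * T / rho) in
  let bound : R := 72 * iota * Num.sqrt (O * A * H * T)
                   + 2500 * H ^+ 2 * O ^+ 2 * A `^ (3 / 2) * iota ^+ 2
                   + 4 * H * Num.sqrt (T * iota) in
  ((1 - rho)%:E <=
   Pr [set w | (regret M K (fun k => st k 1%N w)
                  (ucbvi_policy M K st ac rho argmax w) <= bound)%R])%E.
Proof.
cbv zeta; set H : R := (horizon M)%:R; set O : R := #|Obs|%:R; set A : R := #|Act|%:R.
set Q : R := #|Qst|%:R; set T : R := (K * horizon M)%:R; set iota : R := ln _.
set bound : R := _ + 4 * H * _.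
(* A probability space is nonempty; a sample point provides a state, hence that [Obs] and [Qst] are
   inhabited. *)
have [[w0 _]|none] := pselect (exists w : Omega, True); last first.
  have := probability_setT Pr; rewrite (_ : setT = set0) ?measure0; last first.
    by apply/seteqP; split=> w // _; apply: none; exists w.
  by move=> /eqP; rewrite eqe eq_sym oner_eq0.
pose a0 : Act := argmax (fun=> 0).
have O1 : 1 <= O by rewrite ler1n; apply/card_gt0P; exists (st 0 0 w0).2.
have A1 : 1 <= A by rewrite ler1n; apply/card_gt0P; exists a0.
have Q1 : 1 <= Q by rewrite ler1n; apply/card_gt0P; exists (st 0 0 w0).1.
have H1 : 1 <= H by rewrite ler1n horizon_gt0.
have iota1 : 1 <= iota.
  apply: le_trans (iota_ge M st argmax hrho hK w0).
  by rewrite lerDl ln_ge0 // ler1n.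
have A32 : A <= A `^ (3 / 2).
  rewrite -[leLHS]powRr1 ?(le_trans ler01) // ler_powR //; lra.
pose Y := H ^+ 2 * O ^+ 2 * A * iota ^+ 2.
have Y0 : 0 <= Y by rewrite !mulr_ge0 ?sqr_ge0 // (le_trans ler01).
set S1 := iota * Num.sqrt (O * A * H * T); set S2 := H * Num.sqrt (T * iota).
have S1_ge0 : 0 <= S1 by rewrite mulr_ge0 ?sqrtr_ge0 // (le_trans ler01).
have S2_ge0 : 0 <= S2 by rewrite mulr_ge0 ?sqrtr_ge0 // (le_trans ler01).
have bound_ge : 72 * S1 + 2500 * Y + 4 * S2 <= bound.
  rewrite /bound -[72 * iota * _]mulrA -[4 * H * _]mulrA lerD2r lerD2l.
  rewrite -!(mulrA 2500) ler_wpM2l ?ler0n // ler_wpM2r ?sqr_ge0 // ler_wpM2l //.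
  by rewrite mulr_ge0 ?sqr_ge0.
(* For small [T] the regret is at most [K * H = T < 2500 * Y] surely, which is where the constant
   2500 is spent. *)
have [T_large|T_small] := leP (2500 * Y) T.
  apply: (regret_high_probability hdyn hplay hargmax hrho hK w0 T_large).
  (* [7 / 3 * 21 = 49 <= 72], [7 / 3 * 511 <= 2500] and [49 / 30 * (7 / 3) <= 4]. *)
  apply: le_trans bound_ge; rewrite -[49 / 30 * (7 / 3 * H) * _]mulrA -[7 / 3 * H * _]mulrA.
  rewrite -/H -/O -/A -/T -/iota -/Y -/S1 -/S2.
  by move: S1_ge0 S2_ge0 Y0; lra.
rewrite (_ : [set w | _] = setT) ?probability_setT.
  by rewrite lee_fin lerBlDr lerDl; case/andP: hrho => /ltW.
apply/seteqP; split=> w //= _.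
apply: (@le_trans _ _ T); last first.
  by apply: le_trans bound_ge; move: S1_ge0 S2_ge0 T_small; lra.
rewrite /regret; apply: (@le_trans _ _ (\sum_(1 <= k < K.+1) H)); last first.
  by rewrite big_const_nat iter_addr_0 subn1 /= /T natrM mulr_natl.
apply: ler_sum_nat => k _.
have /andP[_ o1] := opt_value_itv a0 (st k 1%N w) (h := 1%N) (isT : (1 <= (horizon M).+1)%N).
have /andP[v0 _] := value_itv (ucbvi_policy M K st ac rho argmax w k) (st k 1%N w) (h := 1%N) (isT : (1 <= (horizon M).+1)%N).
by move: o1 v0; rewrite subn1 /= -/H; lra.
Qed.
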